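(* Let $X$ be a complex Banach space, let $\{U(t,\tau)\}_{t\ge\tau}$ be an exponentially bounded evolution family on $X$ and let $\Gamma$ denote the generator of the induced evolution semigroup on $L^p(\mathbb R_+,X)$, $1\le p<\infty$, or on $C_{00}(\mathbb R_+,X)$. The following are equivalent: (i) $\{U(t,\tau)\}_{t\ge\tau}$ is exponentially stable; (ii) $\Gamma$ is invertible with $\Gamma^{-1}=-\mathbb G$; (iii) $s(\Gamma)<0$.
   Context: $\mathbb R_+=[0,\infty)$. $C_{00}(\mathbb R_+,X)$ is the space of continuous $f:\mathbb R_+\to X$ vanishing at infinity with $f(0)=0$, with the sup norm. An evolution family on $X$ is a family $\{U(t,\tau)\}_{t\ge\tau\ge0}$ of bounded linear operators on $X$ such that $U(t,\tau)=U(t,s)U(s,\tau)$ and $U(t,t)=I$ for $t\ge s\ge\tau$, and for each $x\in X$ the map $(t,\tau)\mapsto U(t,\tau)x$ is continuous for $t\ge\tau$. It is exponentially bounded if there are $M\ge1$, $\omega\in\mathbb R$ with $\|U(t,\tau)\|\le Me^{\omega(t-\tau)}$ for all $t\ge\tau$; it is (uniformly) exponentially stable if this holds with some $\omega<0$. The induced evolution semigroup is the strongly continuous semigroup $(E^tf)(\tau)=U(\tau,\tau-t)f(\tau-t)$ for $0\le t\le\tau$ and $(E^tf)(\tau)=0$ for $0\le\tau<t$. The operator $\mathbb G$ is $(\mathbb Gf)(t)=\int_0^tU(t,\tau)f(\tau)\,d\tau$, $t\ge0$. ''Invertible'' means having a bounded everywhere-defined inverse, i.e. $0\in\rho(\Gamma)$.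 The spectral bound is $s(\Gamma)=\sup\{\operatorname{Re}\lambda:\lambda\in\sigma(\Gamma)\}$ (with $\sup\emptyset=-\infty$). *)

(* Defs.v *)
From HB Require Import structures.
From mathcomp Require Import all_boot all_order all_algebra.
From mathcomp Require Import complex.
From mathcomp Require Import all_classical all_reals all_analysis.

Set Implicit Arguments.
Unset Strict Implicit.
Unset Printing Implicit Defensive.

Import Order.TTheory GRing.Theory Num.Theory.
Import numFieldNormedType.Exports.

Local Open Scope classical_set_scope.
Local Open Scope ring_scope.
Local Open Scope complex_scope.

(* The norm of a normed space over R[i] takes its values in R[i]; they are
   nonnegative reals, so taking the real part loses nothing. *)
Definition vnorm (R : realType) (X : normedModType R[i]) (x : X) : R :=
  complex.Re `|x|.

Section Bochner.
Context d (T : measurableType d) (R : realType).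
Variables (mu : {measure set T -> \bar R}) (X : completeNormedModType R[i]).

Definition simple_on (D : set T) (s : T -> X) : Prop :=
  [/\ finite_set (s @` D),
      forall x, measurable (D `&` s @^-1` [set x]) &
      forall x, x != 0 -> (mu (D `&` s @^-1` [set x]) < +oo)%E].

(* For x = 0 the measure may be infinite, but the summand is 0 anyway. *)
Definition simple_integral (D : set T) (s : T -> X) : X :=
  \sum_(x \in s @` D) (fine (mu (D `&` s @^-1` [set x])))%:C *: x.

Definition strongly_measurable (D : set T) (f : T -> X) : Prop :=
  exists s : nat -> T -> X, (forall n, simple_on D (s n)) /\
    {ae mu, forall t, D t -> s n t @[n --> \oo] --> f t}.

Definition is_bochner_integral (D : set T) (f : T -> X) (v : X) : Prop :=
  strongly_measurable D f /\
  exists s : nat -> T -> X, [/\ forall n, simple_on D (s n),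
    (\int[mu]_(t in D) (vnorm (f t - s n t))%:E)%E @[n --> \oo] --> 0%E &
    simple_integral D (s n) @[n --> \oo] --> v].

(* Equal to 0 by convention if f is not Bochner integrable on D. *)
Definition bochner_integral (D : set T) (f : T -> X) : X :=
  xget 0 [set v | is_bochner_integral D f v].

End Bochner.

Section EvolutionFamily.
Context (R : realType) (X : completeNormedModType R[i]).
(* Only the values U t tau with 0 <= tau <= t are meaningful. *)
Variable U : R -> R -> {linear X -> X}.

Definition evolution_family : Prop :=
  [/\ forall t tau, 0 <= tau <= t ->
        exists C : R, forall x, vnorm (U t tau x) <= C * vnorm x,
      forall t s tau, 0 <= tau -> tau <= s -> s <= t ->
        forall x, U t tau x = U t s (U s tau x),
      forall t, 0 <= t -> forall x, U t t x = x &
      forall x, {within [set z : R * R | 0 <= z.2 <= z.1],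
                  continuous (fun z : R * R => U z.1 z.2 x)}].

Definition growth_bound (M omega : R) : Prop :=
  forall t tau, 0 <= tau <= t ->
    forall x, vnorm (U t tau x) <= M * expR (omega * (t - tau)) * vnorm x.

Definition exponentially_bounded : Prop :=
  exists M omega : R, 1 <= M /\ growth_bound M omega.

Definition exponentially_stable : Prop :=
  exists M omega : R, [/\ 1 <= M, omega < 0 & growth_bound M omega].

Definition evolution_semigroup (t : R) (f : R -> X) : R -> X :=
  fun tau => if 0 <= t <= tau then U tau (tau - t) (f (tau - t)) else 0.

Definition green (f : R -> X) : R -> X :=
  fun t => bochner_integral lebesgue_measure `[0, t]
             (fun tau => U t tau (f tau)).

End EvolutionFamily.

(* A space of (classes of) X-valued functions on [0, +oo[, presented by
   functions on R whose values on ]-oo, 0[ are irrelevant: fcarrier is the set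
   of representatives and fnorm the norm, which is a seminorm on
   representatives.  Two representatives denote the same element when their
   difference has fnorm 0. *)
Record function_space (R : realType) (X : completeNormedModType R[i]) :=
  FunctionSpace { fcarrier : set (R -> X) ; fnorm : (R -> X) -> \bar R }.

Section Spaces.
Context (R : realType) (X : completeNormedModType R[i]).

Definition Lp_norm (p : R) (f : R -> X) : \bar R :=
  Lnorm lebesgue_measure p%:E ((fun t => (vnorm (f t))%:E) \_ `[0, +oo[).

(* L^p(R_+, X); representatives are identified when they are equal a.e. *)
Definition Lp_space (p : R) : function_space X :=
  FunctionSpace
    [set f : R -> X | strongly_measurable lebesgue_measure `[0, +oo[ f
             /\ (Lp_norm p f < +oo)%E]
    (Lp_norm p).

(* C_00(R_+, X); representatives are identified when they agree on R_+. *)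
Definition C00_space : function_space X :=
  FunctionSpace
    [set f : R -> X | [/\ {within `[0, +oo[, continuous f},
                 f t @[t --> +oo] --> (0 : X) & f 0 = 0]]
    (fun f => ereal_sup [set (vnorm (f t))%:E | t in `[0, +oo[]).

End Spaces.

Section UnboundedOperators.
Context (R : realType) (X : completeNormedModType R[i]).
Variable E : function_space X.

Definition feq (f g : R -> X) : Prop := fnorm E (f \- g) = 0%E.

(* Unbounded operators are given by their graphs: A f g means that f is in the
   domain of A and A f = g. *)
Definition graph := (R -> X) -> (R -> X) -> Prop.

(* Infinitesimal generator: derivative at 0^+ of S^h f, in the norm of E. *)
Definition generator (S : R -> (R -> X) -> (R -> X)) : graph :=
  fun f g => [/\ fcarrier E f, fcarrier E g &
    fnorm E (fun tau => (h^-1)%:C *: (S h f tau - f tau) - g tau)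
      @[h --> 0^'+] --> 0%E].

(* B is an everywhere defined bounded two-sided inverse of A; its linearity,
   up to feq, follows from that of A. *)
Definition bounded_inverse (A : graph) (B : (R -> X) -> (R -> X)) : Prop :=
  [/\ forall g, fcarrier E g -> A (B g) g,
      forall f g, A f g -> feq (B g) f &
      exists C : R, forall g, fcarrier E g ->
        (fnorm E (B g) <= C%:E * fnorm E g)%E].

Definition scalar_sub (lambda : R[i]) (A : graph) : graph :=
  fun f g => A f (fun tau => lambda *: f tau - g tau).

Definition resolvent_set (A : graph) : set R[i] :=
  [set lambda | exists B, bounded_inverse (scalar_sub lambda A) B].

Definition spectrum (A : graph) : set R[i] := ~` resolvent_set A.

Definition spectral_bound (A : graph) : \bar R :=
  ereal_sup [set (complex.Re lambda)%:E | lambda in spectrum A].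

End UnboundedOperators.

Definition evolution_generator (R : realType) (X : completeNormedModType R[i])
    (E : function_space X) (U : R -> R -> {linear X -> X}) :=
  generator E (evolution_semigroup U).

(* Main.v *)
Require Import Defs.
From HB Require Import structures.
From mathcomp Require Import all_boot all_order all_algebra.
From mathcomp Require Import complex.
From mathcomp Require Import all_classical all_reals all_analysis.
From mathcomp Require Import measurable_realfun.
From mathcomp Require Import ring lra.
Import Order.TTheory GRing.Theory Num.Theory.
Import numFieldNormedType.Exports.
Local Open Scope classical_set_scope.
Local Open Scope ring_scope.
Local Open Scope complex_scope.

(* If U is stable, h^-1 (G g - E^h G g) is the average of U(t, s) g(s) over
   ]t - h, t], up to the boundary layer t < h; it tends to g (Lebesgue points in
   L^p, uniform continuity in C_00), so Gamma (- G g) = g.  Moreover Gamma u = 0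
   forces E^t u = u, hence u = 0 because E^t decays.  This gives (ii).
   Replacing U(t, s) by e^{- z (t - s)} U(t, s) replaces Gamma by Gamma - z, so
   the previous step puts every z with Re z > omega in the resolvent set, which
   gives (iii).
   Conversely, (ii) and (iii) both make Gamma f = g solvable with |f| <= C |g|.
   Take g = psi v with v = U(., s) x and psi a trapezoid.  For l > 0 large the
   family e^{- l (t - s)} U(t, s) is stable and the injectivity of its generator
   identifies f with - Psi v, where Psi is the primitive of psi; hence
   |Psi v| <= C |psi v|.  A first trapezoid of length 1 bounds |Psi_1 v| by a
   multiple of |x|; a second one of length N, supported where Psi_1 = 1, satisfies
   |psi_N v| <= |Psi_1 v|, so that N |U(s + N + 4, s) x| is bounded by a multiple
   of |x| independent of N and s.  For N large this operator has norm at most 1/2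
   for every s, which implies (i). *)

Set Implicit Arguments.
Unset Strict Implicit.
Unset Printing Implicit Defensive.

(** Elements of [E] are representatives and [fnorm] is only an extended seminorm, so two solutions
    are never identified as elements of a quotient: each identification says that the seminorm of a
    difference is 0. L^p and C_00 enter the semigroup argument only through the properties listed in
    [well_behaved]; the analysis specific to each space goes into proving that list. In the converse
    direction the difficulty is that [Psi v] may grow exponentially and lie outside [E], where even
    an injective Gamma says nothing about it. Multiplication by [e^{- l t}] settles this: it
    intertwines the semigroup of [U] with that of a stable family, maps [E] into itself, and brings
    [Psi v] into [E]. It is removed as soon as the two functions have been identified, so that the
    final estimate does not depend on [l]. Only the existence of a solution with a bound is taken
    from (ii) or (iii), which is why one argument serves both. In L^p the difference quotients have
    no fixed integrable majorant; their majorants are convolutions that change with [h], hence the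
    variant of dominated convergence. *)

Lemma Re_normc_ge0 (R : realType) (z : R[i]) : 0 <= complex.Re `|z|.
Proof. by rewrite normc_def/= sqrtr_ge0. Qed.

Lemma Re_normc_real (R : realType) (r : R) : complex.Re `|r%:C| = `|r|.
Proof. by rewrite normc_def/= expr0n addr0 sqrtr_sqr. Qed.

(** * The norm as a real number, and convergence in norm *)

Section VectorNorm.
Context (R : realType) (X : normedModType R[i]).
Implicit Types (x y : X) (r : R).

Lemma norm_vnorm x : `|x| = (vnorm x)%:C.
Proof.
by have := normr_ge0 x; rewrite /vnorm; case: `|x| => a b; rewrite lecE /= => /andP[/eqP -> _].
Qed.

Lemma vnorm_ge0 x : 0 <= vnorm x.
Proof. by have := normr_ge0 x; rewrite norm_vnorm ler0c. Qed.

Lemma vnorm0 : vnorm (0 : X) = 0.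
Proof. by rewrite /vnorm normr0. Qed.

Lemma vnorm_eq0 x : (vnorm x == 0) = (x == 0).
Proof. by rewrite -(normr_eq0 x) norm_vnorm; apply/eqP/eqP => [->|[]]. Qed.

Lemma vnormN x : vnorm (- x) = vnorm x.
Proof. by rewrite /vnorm normrN. Qed.

Lemma vnormB x y : vnorm (x - y) = vnorm (y - x).
Proof. by rewrite -opprB vnormN. Qed.

Lemma ler_vnormD x y : vnorm (x + y) <= vnorm x + vnorm y.
Proof. by rewrite -lecR rmorphD /= -!norm_vnorm ler_normD. Qed.

Lemma ler_vnormB x y : vnorm (x - y) <= vnorm x + vnorm y.
Proof. by rewrite (le_trans (ler_vnormD _ _))// vnormN. Qed.

Lemma ler_vdist x y z : vnorm (x - z) <= vnorm (x - y) + vnorm (y - z).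
Proof. by rewrite -(subrKA y) ler_vnormD. Qed.

Lemma ler_dist_vnorm x y : `|vnorm x - vnorm y| <= vnorm (x - y).
Proof.
have H (a b : X) : vnorm a - vnorm b <= vnorm (a - b).
  by rewrite lerBlDr -{1}(subrK b a) ler_vnormD.
by rewrite ler_norml lerNl opprB H vnormB H.
Qed.

Lemma vnormZ (c : R[i]) x : vnorm (c *: x) = complex.Re `|c| * vnorm x.
Proof.
rewrite /vnorm normrZ; have := normr_ge0 c.
by case: `|c| => a b; rewrite lecE/= norm_vnorm => /andP[/eqP -> _] /=; rewrite mul0r subr0.
Qed.

Lemma vnormZr r x : vnorm (r%:C *: x) = `|r| * vnorm x.
Proof. by rewrite vnormZ Re_normc_real. Qed.

Lemma vnorm_sum (I : Type) (s : seq I) (P : pred I) (F : I -> X) :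
  vnorm (\sum_(i <- s | P i) F i) <= \sum_(i <- s | P i) vnorm (F i).
Proof.
elim/big_rec2 : _ => [|i a b _ ab]; first by rewrite vnorm0.
by rewrite (le_trans (ler_vnormD _ _))// lerD2l.
Qed.

(** The metric of [X] has radii in [R[i]], but a positive element of [R[i]] has imaginary part 0, so
    real radii suffice. *)
Lemma vnorm_cvgP {T : Type} (F : set_system T) {FF : Filter F} (f : T -> X) l :
  f @ F --> l <-> vnorm (f t - l) @[t --> F] --> (0 : R).
Proof.
split=> [fl|fl].
  apply/cvgrPdist_lt => e e0; move/cvgrPdist_lt : fl => /(_ e%:C).
  rewrite ltcR => /(_ e0); apply: filterS => t.
  by rewrite norm_vnorm ltcR vnormB sub0r normrN ger0_norm// vnorm_ge0.
apply/cvgrPdist_lt => -[e e'] /[!ltcE]/= /andP[/eqP -> e0].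
move/cvgrPdist_lt : fl => /(_ _ e0); apply: filterS => t.
by rewrite norm_vnorm vnormB sub0r normrN ger0_norm ?vnorm_ge0// ltcR.
Qed.

Lemma cvg_vnorm {T : Type} (F : set_system T) {FF : Filter F} (f : T -> X) l :
  f @ F --> l -> vnorm (f t) @[t --> F] --> vnorm l.
Proof.
move=> /vnorm_cvgP/cvgrPdist_lt fl; apply/cvgrPdist_lt => e /fl.
apply: filterS => t; rewrite sub0r normrN ger0_norm ?vnorm_ge0//.
by apply: le_lt_trans; rewrite distrC ler_dist_vnorm.
Qed.

Lemma cvg_squeeze_vnorm {T : Type} (F : set_system T) {FF : Filter F} (f : T -> X) l (g : T -> R) :
  (\forall t \near F, vnorm (f t - l) <= g t) -> g @ F --> 0 -> f @ F --> l.
Proof.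
move=> fg /cvgrPdist_lt g0; apply/vnorm_cvgP/cvgrPdist_lt => e /g0.
apply: filterS2 fg => t fg.
rewrite !sub0r !normrN [`|vnorm _|]ger0_norm ?vnorm_ge0//; apply: le_lt_trans.
exact: le_trans fg (ler_norm _).
Qed.
End VectorNorm.

(** * Simple functions and the Bochner integral *)

(** [simple_on] without the finite measure of the support. This part is stable under pairing and
    under arbitrary maps, so sums and truncations of simple functions become compositions. *)
Definition fin_valued {d} {T : measurableType d} {Y : Type} (D : set T) (s : T -> Y) :=
  finite_set (s @` D) /\ forall y, measurable (D `&` s @^-1` [set y]).

Section FinValued.
Context d (T : measurableType d).
Implicit Types D : set T.

Lemma fin_valued_preimage (Y : Type) D (s : T -> Y) : fin_valued D s ->
  forall B, measurable (D `&` s @^-1` B).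
Proof.
move=> [fs ms] B.
have -> : D `&` s @^-1` B = \bigcup_(y in s @` D `&` B) (D `&` s @^-1` [set y]).
  apply/seteqP; split => [t [Dt Bt]|t [y [_ By]] [Dt /= ty]].
    by exists (s t) => //; split => //; exists t.
  by split => //=; rewrite ty.
by apply: fin_bigcup_measurable => //; exact: finite_setIl.
Qed.

Lemma fin_valued_comp (Y Z : Type) D (s : T -> Y) (g : Y -> Z) :
  fin_valued D s -> fin_valued D (g \o s).
Proof.
move=> fs; split; first by rewrite -image_comp; apply: finite_image; case: fs.
by move=> z; exact: (fin_valued_preimage fs (g @^-1` [set z])).
Qed.

Lemma fin_valued_pair (Y Z : Type) D (s : T -> Y) (s' : T -> Z) :
  fin_valued D s -> fin_valued D s' -> fin_valued D (fun t => (s t, s' t)).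
Proof.
move=> [fs ms] [fs' ms']; split.
  apply: (@sub_finite_set _ _ ((s @` D) `*` (s' @` D))); last exact: finite_setX.
  by move=> _ [t Dt <-]; split; exists t.
move=> [y z]; have -> : D `&` (fun t => (s t, s' t)) @^-1` [set (y, z)] =
   (D `&` s @^-1` [set y]) `&` (D `&` s' @^-1` [set z]).
  by apply/seteqP; split => [t /= [Dt [-> ->]]|t /= [[Dt ->] [_ ->]]].
exact: measurableI.
Qed.

Lemma fin_valued_subset (Y : Type) D D' (s : T -> Y) : measurable D' -> D' `<=` D ->
  fin_valued D s -> fin_valued D' s.
Proof.
move=> mD' D'D [fs ms]; split.
  by apply: sub_finite_set fs; exact: image_subset.
move=> y; rewrite -(setIidl D'D) -setIA; exact: measurableI.
Qed.

Lemma fin_valued_in D (A : set T) : measurable D -> measurable (D `&` A) ->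
  fin_valued D (fun t => `[< A t >]).
Proof.
move=> mD mA; split => [|b].
  by apply: (@sub_finite_set _ _ setT).
case: b.
  rewrite [X in measurable X](_ : _ = D `&` A)//.
  by apply/seteqP; split => t /= [Dt] /asboolP.
rewrite [X in measurable X](_ : _ = D `\` (D `&` A)); last first.
  apply/seteqP; split => t /= [Dt H]; split => //.
    by case => _ At; move/asboolP : H.
  by apply/asboolP => At; apply: H.
exact: measurableD.
Qed.

Lemma fin_valued_measurable d' (Y : measurableType d') D (s : T -> Y) :
  fin_valued D s -> measurable_fun D s.
Proof. by move=> fs _ B _; exact: fin_valued_preimage. Qed.

End FinValued.

Section SimpleFunctions.
Context d (T : measurableType d) (R : realType).
Variables (mu : {measure set T -> \bar R}) (X : completeNormedModType R[i]).
Implicit Types (D : set T) (s : T -> X).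

(** The support is the finite disjoint union of the fibres over the nonzero values. *)
Lemma simple_onP D s : simple_on mu D s <->
  fin_valued D s /\ (mu (D `&` s @^-1` [set~ 0%R]) < +oo)%E.
Proof.
split=> [[fs ms sy]|[[fs ms] sy]]; last first.
  split => // x x0; apply: le_lt_trans sy; apply: le_measure; rewrite ?inE//.
    exact: fin_valued_preimage.
  by move=> t /= [Dt ->]; split => //; exact/eqP.
split => //.
have -> : D `&` s @^-1` [set~ 0%R] = \bigcup_(y in s @` D `&` [set~ 0%R]) (D `&` s @^-1` [set y]).
  apply/seteqP; split => [t [Dt Bt]|t [y [_ By]] [Dt /= ty]].
    by exists (s t) => //; split => //; exists t.
  by split => //=; rewrite ty.
rewrite measure_fin_bigcup//; last 2 first.
- exact: finite_setIl.
- by apply: trivIset_setIl; exact: trivIset_preimage1.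
rewrite fsbig_finite/=; last exact: finite_setIl.
rewrite big_seq; apply: lte_sum_pinfty => y; rewrite in_fset_set; last exact: finite_setIl.
by move=> /set_mem[_ y0]; apply: sy; exact/eqP.
Qed.

(** In the applications [q] is [s] itself or [s] paired with a set indicator. The hypothesis on [F]
    places the support of [F \o q] inside that of [s]. *)
Lemma simple_on_comp (Y : Type) D (q : T -> Y) (F : Y -> X) (s : T -> X) :
  fin_valued D q -> simple_on mu D s ->
  (forall t, D t -> s t = 0 -> F (q t) = 0) -> simple_on mu D (F \o q).
Proof.
move=> fq /simple_onP[fs sy] Fq; apply/simple_onP; split; first exact: fin_valued_comp.
apply: le_lt_trans sy; apply: le_measure; rewrite ?inE//.
- exact: (fin_valued_preimage fq (F @^-1` [set~ 0%R])).
- exact: fin_valued_preimage.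
- by move=> t /= [Dt Ft]; split => // /(Fq _ Dt).
Qed.

Lemma simple_on_add D s s' : simple_on mu D s -> simple_on mu D s' ->
  simple_on mu D (s \+ s').
Proof.
move=> /simple_onP[fs sy] /simple_onP[fs' sy']; apply/simple_onP; split.
  exact: (fin_valued_comp (fun x : X * X => x.1 + x.2) (fin_valued_pair fs fs')).
apply: (@le_lt_trans _ _ (mu (D `&` s @^-1` [set~ 0%R]) + mu (D `&` s' @^-1` [set~ 0%R]))%E); last exact: lte_add_pinfty.
apply: (@le_trans _ _ (mu ((D `&` s @^-1` [set~ 0%R]) `|` (D `&` s' @^-1` [set~ 0%R])))%E); last first.
  by apply: measureU2; exact: fin_valued_preimage.
apply: le_measure; rewrite ?inE.
- apply: (fin_valued_preimage (fin_valued_pair fs fs') (fun x : X * X => x.1 + x.2 <> 0)); rewrite //.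
- by apply: measurableU; exact: fin_valued_preimage.
- move=> t /= [Dt]; have [-> |/eqP s0 _] := eqVneq (s t) 0; last by left.
  by rewrite add0r; right.
Qed.

Lemma simple_on_opp D s : simple_on mu D s -> simple_on mu D (fun t => - s t).
Proof.
move=> ss; have /simple_onP[fs _] := ss.
by apply: (simple_on_comp (F := fun x => - x) fs ss) => t _ ->; rewrite oppr0.
Qed.

Lemma simple_on_sub D s s' : simple_on mu D s -> simple_on mu D s' ->
  simple_on mu D (s \- s').
Proof. by move=> ss ss'; apply: simple_on_add => //; exact: simple_on_opp. Qed.

Lemma simple_on_subset D D' s : measurable D' -> D' `<=` D ->
  simple_on mu D s -> simple_on mu D' s.
Proof.
move=> mD' D'D /simple_onP[fs sy]; apply/simple_onP.
have fs' : fin_valued D' s by exact: fin_valued_subset fs.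
split => //; apply: le_lt_trans sy; apply: le_measure; rewrite ?inE.
- exact: fin_valued_preimage.
- exact: fin_valued_preimage.
- by move=> t /= [/D'D].
Qed.

Lemma simple_on_cst D (x : X) : measurable D -> (mu D < +oo)%E -> simple_on mu D (cst x).
Proof.
move=> mD Dy; apply/simple_onP.
have fc : fin_valued D (cst x : T -> X).
  split => [|y]; first by apply: (@sub_finite_set _ _ [set x]) => // _ [? _ <-].
  by rewrite preimage_cst; case: ifPn; rewrite ?setIT ?setI0.
split => //; apply: le_lt_trans Dy; apply: le_measure; rewrite ?inE//.
exact: fin_valued_preimage.
Qed.

(** The fibres of [q] refine the level sets of [F \o q], so terms can be regrouped by the value of
    [F]. With a pair of simple functions as [q], both are integrated over a common partition, which
    yields additivity. *)
Lemma simple_integral_partition (Y : choiceType) D (q : T -> Y) (F : Y -> X) :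
  fin_valued D q -> (mu (D `&` (F \o q) @^-1` [set~ 0%R]) < +oo)%E ->
  simple_integral mu D (F \o q) =
  \sum_(y \in q @` D) (fine (mu (D `&` q @^-1` [set y])))%:C *: F y.
Proof.
move=> fq Fy; have fFq := fin_valued_comp F fq.
rewrite /simple_integral.
transitivity (\sum_(x \in (F \o q) @` D) \sum_(y \in q @` D)
   if F y == x then (fine (mu (D `&` q @^-1` [set y])))%:C *: F y else 0).
  apply: eq_fsbigr => x _.
  rewrite fsbig_finite; last by case: fq.
  (* Fibres on which [F] vanishes may have infinite measure, but their terms are 0; the others lie
     in the support of [F \o q]. *)
  have [->|x0] := eqVneq x 0.
    by rewrite scaler0 big1// => y _; case: ifPn => // /eqP ->; rewrite scaler0.
  rewrite -big_mkcond/=.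
  under eq_bigr => y /eqP -> do [].
  rewrite -scaler_suml -rmorph_sum/=; congr (_%:C *: _).
  have fin y : F y == x -> mu (D `&` q @^-1` [set y]) \is a fin_num.
    move=> /eqP Fyx; rewrite ge0_fin_numE//; apply: le_lt_trans Fy; apply: le_measure; rewrite ?inE.
    - exact: fin_valued_preimage.
    - exact: fin_valued_preimage.
    - by move=> t /= [Dt ->]; split => //; rewrite Fyx; exact/eqP.
  rewrite sum_fine//; congr fine.
  have -> : D `&` (F \o q) @^-1` [set x] = \bigcup_(y in q @` D `&` F @^-1` [set x]) (D `&` q @^-1` [set y]).
    apply/seteqP; split => [t [Dt Bt]|t [y [_ By]] [Dt /= ty]].
      by exists (q t) => //; split => //; exists t.
    by split => //=; rewrite ty.
  rewrite measure_fin_bigcup//; last 3 first.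
  - by apply: finite_setIl; case: fq.
  - by apply: trivIset_setIl; exact: trivIset_preimage1.
  - by move=> y _; case: fq.
  rewrite fsbig_mkcondr fsbig_finite/=; last by case: fq.
  rewrite [RHS]big_mkcond/=; apply: eq_bigr => y _.
  congr (if _ then _ else _); apply/idP/idP => [/set_mem/eqP//|/eqP/mem_set//].
rewrite exchange_fsbig//; [|by case: fFq|by case: fq].
apply: eq_fsbigr => y /set_mem[t Dt qty].
rewrite (fsbigD1 (F y)); [|by case: fFq|by exists t => //=; rewrite qty].
rewrite eqxx fsbig1/=; first by rewrite addr0.
by move=> x /= [_ /eqP]; rewrite eq_sym => /negPf ->.
Qed.

Lemma simple_integralD D s s' : simple_on mu D s -> simple_on mu D s' ->
  simple_integral mu D (s \+ s') = simple_integral mu D s + simple_integral mu D s'.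
Proof.
move=> ss ss'.
have /simple_onP[fs sy] := ss; have /simple_onP[fs' sy'] := ss'.
have /simple_onP[_ sy2] := simple_on_add ss ss'.
have fq := fin_valued_pair fs fs'.
have := simple_integral_partition (F := fun x : X * X => x.1 + x.2) fq sy2.
rewrite /comp/= => ->.
have := simple_integral_partition (F := fun x : X * X => x.1) fq sy.
rewrite /comp/= => ->.
have := simple_integral_partition (F := fun x : X * X => x.2) fq sy'.
rewrite /comp/= => ->.
rewrite -fsbig_split/=; last by case: fq.
by apply: eq_fsbigr => y _; rewrite scalerDr.
Qed.

Lemma simple_integral_linear (f : {linear X -> X}) D s : simple_on mu D s ->
  simple_on mu D (f \o s) /\ simple_integral mu D (f \o s) = f (simple_integral mu D s).
Proof.
move=> ss; have /simple_onP[fs sy] := ss.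
have sfs : simple_on mu D (f \o s).
  by apply: (simple_on_comp fs ss) => t _ ->; rewrite linear0.
split => //; have /simple_onP[_ sy'] := sfs.
rewrite (simple_integral_partition fs sy') /simple_integral.
rewrite !fsbig_finite; [|by case: fs..].
by rewrite linear_sum; apply: eq_bigr => x _; rewrite linearZ.
Qed.

Lemma simple_integralB D s s' : simple_on mu D s -> simple_on mu D s' ->
  simple_integral mu D (s \- s') = simple_integral mu D s - simple_integral mu D s'.
Proof.
move=> ss ss'; rewrite simple_integralD//; last exact: simple_on_opp.
by have [_ <-] := simple_integral_linear (-%R : {linear X -> X}) ss'.
Qed.

Lemma simple_integral_widen D (F : set X) s : finite_set F -> s @` D `<=` F ->
  simple_integral mu D s = \sum_(x \in F) (fine (mu (D `&` s @^-1` [set x])))%:C *: x.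
Proof.
move=> fF sF; apply: fsbig_widen => // x [_ /= sx].
rewrite (_ : _ `&` _ = set0) ?measure0 ?scale0r//.
by apply/seteqP; split => t //= [Dt sxt]; apply: sx; exists t.
Qed.

Lemma simple_integralU A B s : measurable A -> measurable B -> A `&` B = set0 ->
  simple_on mu (A `|` B) s ->
  simple_integral mu (A `|` B) s = simple_integral mu A s + simple_integral mu B s.
Proof.
move=> mA mB AB ss; have [fs ms sy] := ss.
have [_ mAs sAy] := simple_on_subset mA (@subsetUl _ A B) ss.
have [_ mBs sBy] := simple_on_subset mB (@subsetUr _ A B) ss.
rewrite (simple_integral_widen (D := A) fs); last exact/image_subset/subsetUl.
rewrite (simple_integral_widen (D := B) fs); last exact/image_subset/subsetUr.
rewrite -fsbig_split//=; apply: eq_fsbigr => x _.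
have [->|x0] := eqVneq x 0; first by rewrite !scaler0 addr0.
rewrite -scalerDl -rmorphD/= setIUl measureU//; last first.
  by rewrite setIACA AB set0I.
by rewrite fineD// ge0_fin_numE//; [exact: sAy|exact: sBy].
Qed.

Lemma simple_integral_cst D (x : X) : measurable D -> (mu D < +oo)%E ->
  simple_integral mu D (cst x) = (fine (mu D))%:C *: x.
Proof.
move=> mD Dy; rewrite (simple_integral_widen (F := [set x])) //.
  by rewrite fsbig_set1 preimage_cst ifT ?inE// setIT.
by move=> _ [? _ <-].
Qed.

Lemma measurable_vnorm_simple D s : simple_on mu D s ->
  measurable_fun D (fun t => vnorm (s t)).
Proof.
move=> /simple_onP[fs _].
exact: fin_valued_measurable (fin_valued_comp (fun x : X => vnorm x) fs).
Qed.

Lemma integral_vnorm_simple D s : measurable D -> simple_on mu D s ->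
  (\int[mu]_(t in D) (vnorm (s t))%:E =
   \sum_(x \in s @` D) (vnorm x)%:E * mu (D `&` s @^-1` [set x]))%E.
Proof.
move=> mD [fs ms sy].
transitivity (\int[mu]_(t in D) \sum_(x \in s @` D) ((vnorm x)%:E * (\1_(D `&` s @^-1` [set x]) t)%:E))%E.
  apply: eq_integral => t /set_mem Dt.
  rewrite (fsbigD1 (s t))//=; last by exists t.
  rewrite indicE mem_set//= mule1 fsbig1 ?adde0//.
  move=> x /= [_ xs]; rewrite indicE memNset ?mule0//.
  by move=> [_ /= /esym].
rewrite ge0_integral_fsum//; last 2 first.
- move=> x; apply: measurable_funeM; apply/measurable_EFinP.
  apply: measurable_funTS; exact: measurable_indic.
- by move=> x t _; rewrite mule_ge0// lee_fin vnorm_ge0.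
apply: eq_fsbigr => x _.
rewrite ge0_integralZl_EFin ?vnorm_ge0//; last first.
  by apply/measurable_EFinP; apply: measurable_funTS; exact: measurable_indic.
by rewrite integral_indic// setIC setIA setIid.
Qed.

Lemma le_vnorm_simple_integral D s : measurable D -> simple_on mu D s ->
  ((vnorm (simple_integral mu D s))%:E <= \int[mu]_(t in D) (vnorm (s t))%:E)%E.
Proof.
move=> mD ss; rewrite integral_vnorm_simple//; have [fs ms sy] := ss.
rewrite /simple_integral !fsbig_finite//.
apply: (@le_trans _ _ (\sum_(x <- finmap.enum_fset (fset_set (s @` D)))
   vnorm ((fine (mu (D `&` s @^-1` [set x])))%:C *: x))%:E).
  by rewrite lee_fin vnorm_sum.
rewrite -sumEFin; apply: lee_sum => x _.
have [->|x0] := eqVneq x 0; first by rewrite scaler0 vnorm0 mul0e.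
rewrite vnormZr ger0_norm ?fine_ge0// EFinM muleC fineK//.
by rewrite ge0_fin_numE// sy.
Qed.

End SimpleFunctions.

Section Bochner.
Context d (T : measurableType d) (R : realType).
Variables (mu : {measure set T -> \bar R}) (X : completeNormedModType R[i]).
Implicit Types (D : set T) (s : T -> X).

(** Convergence at every point of [D]: the measure need not be complete, so the norm of an almost
    everywhere limit may fail to be measurable. *)
Definition approximable D (f : T -> X) := exists s : nat -> T -> X,
  (forall n, simple_on mu D (s n)) /\ forall t, D t -> s n t @[n --> \oo] --> f t.

Lemma approximable_simple D s : simple_on mu D s -> approximable D s.
Proof. by move=> ss; exists (fun=> s); split => // t _; exact: cvg_cst. Qed.

Lemma approximableB D (f g : T -> X) : approximable D f -> approximable D g ->
  approximable D (fun t => f t - g t).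
Proof.
move=> [s [ss sf]] [s' [ss' sg]]; exists (fun n => s n \- s' n); split.
  by move=> n; exact: simple_on_sub.
by move=> t Dt; apply: cvgB; [exact: sf|exact: sg].
Qed.

Lemma approximable_measurable_dist D (f : T -> X) x : approximable D f ->
  measurable_fun D (fun t => vnorm (f t - x)).
Proof.
move=> [s [ss sf]].
apply: (@measurable_fun_cvg _ _ _ _ (fun n t => vnorm (s n t - x))) => [n|t Dt].
  have /simple_onP[fs _] := ss n.
  exact: fin_valued_measurable (fin_valued_comp (fun y : X => vnorm (y - x)) fs).
apply: cvg_vnorm; apply: cvgB; [exact: sf|exact: cvg_cst].
Qed.

Lemma approximable_measurable D (f : T -> X) : approximable D f ->
  measurable_fun D (fun t => vnorm (f t)).
Proof.
move=> /(approximable_measurable_dist 0).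
by apply: eq_measurable_fun => t _; rewrite subr0.
Qed.

(** The exceptional set is contained in a measurable null set; replacing the function and its
    approximants by 0 there keeps the approximants simple. *)
Lemma strongly_measurable_approximable D (f : T -> X) : measurable D ->
  strongly_measurable mu D f ->
  exists2 g, approximable D g & {ae mu, forall t, D t -> f t = g t}.
Proof.
move=> mD [s [ss [N [mN N0 sN]]]].
exists (fun t => if `[< N t >] then 0 else f t); last first.
  exists N; split => // t /= H; apply: contrapT => Nt; apply: H.
  by case: asboolP.
exists (fun n t => if `[< N t >] then 0 else s n t); split=> [n|t Dt].
  have /simple_onP[fs _] := ss n.
  have fN := fin_valued_in mD (measurableI _ _ mD mN).
  have := simple_on_comp (F := fun z : bool * X => if z.1 then 0 else z.2) (fin_valued_pair fN fs) (ss n).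
  by apply => t _ /= ->; case: ifP.
case: asboolP => Nt; first exact: cvg_cst.
by have := contra_not (@sN t) Nt; move=> /notP; apply.
Qed.

Lemma approximable_strongly_measurable D (f : T -> X) : approximable D f ->
  strongly_measurable mu D f.
Proof. by move=> [s [ss sf]]; exists s; split => //; exact: aeW. Qed.

Lemma ae_strongly_measurable D (f g : T -> X) : {ae mu, forall t, D t -> f t = g t} ->
  strongly_measurable mu D f -> strongly_measurable mu D g.
Proof.
move=> fg [s [ss sf]]; exists s; split => //.
by apply: filterS2 fg sf => t fg sf Dt; rewrite -fg//; exact: sf.
Qed.

Lemma strongly_measurable_subset D D' (f : T -> X) : measurable D' -> D' `<=` D ->
  strongly_measurable mu D f -> strongly_measurable mu D' f.
Proof.
move=> mD' D'D [s [ss sf]]; exists s; split => [n|].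
  exact: simple_on_subset (ss n).
by apply: filterS sf => t sf /D'D/sf.
Qed.

Import HBNNSimple.

(* No measurability is assumed: for a nonmeasurable nonnegative function the
   integral is the supremum of the integrals of the simple functions below it. *)
Lemma ae_ge0_le_integral D (f g : T -> \bar R) : measurable D ->
  (forall t, D t -> 0 <= f t)%E -> (forall t, D t -> 0 <= g t)%E ->
  {ae mu, forall t, D t -> (f t <= g t)%E} ->
  (\int[mu]_(t in D) f t <= \int[mu]_(t in D) g t)%E.
Proof.
move=> mD f0 g0 [N [mN N0 fgN]].
rewrite ge0_integralE// [leRHS]ge0_integralE//.
apply: ge_ereal_sup => _ [h hf <-].
(* Cutting [h] to 0 on the null set preserves its integral and makes it a simple function below the
   restriction of [g]. *)
pose h' := proj_nnsfun h (measurableC mN).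
apply: (@le_trans _ _ (sintegral mu h')); last first.
  apply: ereal_sup_ubound; exists h' => // t /=.
  have := hf t; rewrite /patch /= /indic; case: ifPn => tD ht.
    rewrite mindicE; have [tN|tN] := boolP (t \in ~` N).
      rewrite mulr1; apply: (le_trans ht).
      have := contra_not (@fgN t) (set_mem tN).
      by move=> /notP; apply; exact: set_mem.
    by rewrite mulr0; apply: g0; exact: set_mem.
  have : (h t <= 0)%R by rewrite -lee_fin.
  rewrite lee_fin; move=> h0; rewrite mulr_le0_ge0//.
rewrite -!integralT_nnsfun.
rewrite le_eqVlt; apply/orP; left; apply/eqP.
apply: ge0_ae_eq_integral => //.
- exact/measurable_EFinP.
- by apply/measurable_EFinP.
- by move=> t _; rewrite lee_fin.
- by move=> t _; rewrite lee_fin.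
exists N; split => // t /= H; apply: contrapT => Nt; apply: H => _.
by rewrite mindicE mem_set ?mulr1.
Qed.

Lemma ae_ge0_eq_integral D (f g : T -> \bar R) : measurable D ->
  (forall t, D t -> 0 <= f t)%E -> (forall t, D t -> 0 <= g t)%E ->
  {ae mu, forall t, D t -> f t = g t} ->
  (\int[mu]_(t in D) f t = \int[mu]_(t in D) g t)%E.
Proof.
move=> mD f0 g0 fg; apply/eqP; rewrite eq_le; apply/andP; split.
  by apply: ae_ge0_le_integral => //; apply: filterS fg => t fg /fg ->.
by apply: ae_ge0_le_integral => //; apply: filterS fg => t fg /fg ->.
Qed.

Lemma ae_ge0_le_integral_subset D D' (f g : T -> \bar R) : measurable D -> measurable D' ->
  D `<=` D' -> (forall t, D t -> 0 <= f t)%E -> (forall t, D' t -> 0 <= g t)%E ->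
  {ae mu, forall t, D t -> (f t <= g t)%E} ->
  (\int[mu]_(t in D) f t <= \int[mu]_(t in D') g t)%E.
Proof.
move=> mD mD' DD' f0 g0 fg; rewrite [leLHS]integral_mkcond [leRHS]integral_mkcond.
apply: ae_ge0_le_integral => //; [by move=> t _; exact: erestrict_ge0..|].
apply: filterS fg => t fg _; rewrite /patch; case: ifPn => [/set_mem Dt|_].
  by rewrite mem_set; [exact: fg|exact: DD'].
by case: ifPn => // /set_mem D't; exact: g0.
Qed.

Lemma integral_vnorm_ge0 D (f : T -> X) : (0 <= \int[mu]_(t in D) (vnorm (f t))%:E)%E.
Proof. by apply: integral_ge0 => t _; rewrite lee_fin vnorm_ge0. Qed.

Lemma le_simple_integral_dist D (f : T -> X) s s' : measurable D ->
  strongly_measurable mu D f -> simple_on mu D s -> simple_on mu D s' ->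
  ((vnorm (simple_integral mu D s - simple_integral mu D s'))%:E <=
  \int[mu]_(t in D) (vnorm (f t - s t))%:E + \int[mu]_(t in D) (vnorm (f t - s' t))%:E)%E.
Proof.
(* Additivity of the integral needs measurable integrands, hence the passage from [f] to the
   representative [g]. *)
move=> mD /(strongly_measurable_approximable mD)[g gap fg] ss ss'.
have E s1 : (\int[mu]_(t in D) (vnorm (f t - s1 t))%:E = \int[mu]_(t in D) (vnorm (g t - s1 t))%:E)%E.
  apply: ae_ge0_eq_integral => //; try by move=> *; rewrite lee_fin vnorm_ge0.
  by apply: filterS fg => t fg /fg ->.
rewrite !E -simple_integralB//.
apply: (le_trans (le_vnorm_simple_integral mD (simple_on_sub ss ss'))).
have m s1 : simple_on mu D s1 -> measurable_fun D (fun t => (vnorm (g t - s1 t))%:E).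
  move=> ss1; apply/measurable_EFinP; apply: approximable_measurable.
  by apply: approximableB => //; exact: approximable_simple.
rewrite -ge0_integralD//; try exact: m; try by move=> *; rewrite lee_fin vnorm_ge0.
apply: ge0_le_integral => //.
- by move=> *; rewrite lee_fin vnorm_ge0.
- by apply/measurable_EFinP; exact: measurable_vnorm_simple (simple_on_sub ss ss').
- by apply: emeasurable_funD; exact: m.
- move=> t _; rewrite -EFinD lee_fin /= [vnorm (g t - s t)]vnormB.
  exact: ler_vdist.
Qed.

Lemma strongly_measurable_L1_approx D (f : T -> X) : measurable D ->
  strongly_measurable mu D f -> (\int[mu]_(t in D) (vnorm (f t))%:E < +oo)%E ->
  exists s : nat -> T -> X, (forall n, simple_on mu D (s n)) /\
    (\int[mu]_(t in D) (vnorm (f t - s n t))%:E)%E @[n --> \oo] --> 0%E.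
Proof.
move=> mD smf fy.
have [g gap fg] := strongly_measurable_approximable mD smf.
have E (F : X -> R) : (forall x, 0 <= F x) -> (\int[mu]_(t in D) (F (f t))%:E = \int[mu]_(t in D) (F (g t))%:E)%E.
  move=> F0; apply: ae_ge0_eq_integral => //; try by move=> *; rewrite lee_fin.
  by apply: filterS fg => t fg /fg ->.
have [s [ss sg]] := gap.
have mg := approximable_measurable gap.
(* Approximants larger than twice the limit are replaced by 0. Where [g] is nonzero this eventually
   changes nothing, where [g] vanishes it leaves the value 0; in both cases the error is dominated
   by [3 * vnorm (g t)]. *)
pose A n := [set t | vnorm (s n t) <= 2 * vnorm (g t)].
pose s' n t := if `[< A n t >] then s n t else 0.
have ss' n : simple_on mu D (s' n).
  have /simple_onP[fs _] := ss n.
  have mA : measurable (D `&` A n).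
    have mh : measurable_fun D (fun t => 2 * vnorm (g t) - vnorm (s n t)).
      apply: measurable_funB; first exact: measurable_funM.
      exact: measurable_vnorm_simple.
    have := mh mD `[0, +oo[%classic (measurable_itv _).
    congr (measurable (_ `&` _)); apply/seteqP; split => t /=;
    by rewrite in_itv/= andbT subr_ge0.
  have fA := fin_valued_in mD mA.
  have := simple_on_comp (F := fun z : bool * X => if z.1 then z.2 else 0) (fin_valued_pair fA fs) (ss n).
  by apply => t _ /= ->; case: ifP.
exists s'; split => //.
have dc : (fun n => \int[mu]_(t in D) (vnorm (g t - s' n t))%:E)%E @ \oo --> (\int[mu]_(t in D) (cst 0%E) t)%E.
  have p3 (P Q S : Prop) : [/\ P, Q & S] -> S by case.
  apply: (p3 _ _ _ (dominated_convergence (f_ := fun n t => (vnorm (g t - s' n t))%:E) (f := cst 0%E) (g := fun t => (3 * vnorm (g t))%:E) mD _ _ _ _ _)) => //.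
  - move=> n; apply/measurable_EFinP; apply: approximable_measurable.
    by apply: approximableB => //; exact: approximable_simple.
  - apply: aeW => t Dt /=.
    apply/cvg_EFin; first exact: nearW.
    rewrite /comp/=; have [g0|g0] := eqVneq (vnorm (g t)) 0.
      apply: (@cvg_trans _ (cst 0 n @[n --> \oo])); last exact: cvg_cst.
      apply: near_eq_cvg; apply: nearW => n /=; rewrite /s'; case: asboolP.
        rewrite /A/= g0 mulr0 => s0.
        have : vnorm (s n t) == 0 by rewrite eq_le s0 vnorm_ge0.
        by rewrite vnorm_eq0 => /eqP ->; rewrite subr0 g0.
      by rewrite subr0 g0.
    have sgt := sg _ Dt.
    have : vnorm (g t - s n t) @[n --> \oo] --> 0.
      by move/vnorm_cvgP : sgt; under eq_fun do rewrite vnormB.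
    apply: cvg_trans; apply: near_eq_cvg.
    have H0 : vnorm (s n t) @[n --> \oo] --> vnorm (g t) by exact: cvg_vnorm.
    move/cvgrPdist_lt/(_ (vnorm (g t))) : H0.
    have -> : 0 < vnorm (g t) by rewrite lt_neqAle eq_sym g0 vnorm_ge0.
    move=> /(_ isT); apply: filterS => n H.
    rewrite /s'; case: asboolP => // /negP; rewrite /A/= -ltNge => H2.
    by move: H; rewrite ltr_distlC => /andP[_]; rewrite -mulr2n -mulr_natl ltNge ltW.
  - apply/integrableP; split.
      by apply/measurable_EFinP; exact: measurable_funM.
    under eq_integral => t _ do rewrite abse_EFin ger0_norm ?mulr_ge0 ?vnorm_ge0// EFinM.
    rewrite ge0_integralZl_EFin//; [|by move=> *; rewrite lee_fin vnorm_ge0|exact/measurable_EFinP].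
    by rewrite lte_mul_pinfty// -(E (@vnorm R X))//; exact: vnorm_ge0.
  - apply: aeW => t n Dt; rewrite abse_EFin lee_fin ger0_norm ?vnorm_ge0//.
    apply: (le_trans (ler_vnormB _ _)); rewrite -[3]/(1 + 2) mulrDl mul1r lerD2l.
    rewrite /s'; case: asboolP => //; rewrite vnorm0 mulr_ge0 ?vnorm_ge0//.
rewrite integral0 in dc; apply: cvg_trans dc; apply: near_eq_cvg.
apply: nearW => n /=; apply: ae_ge0_eq_integral => //; try by move=> *; rewrite lee_fin vnorm_ge0.
by apply: filterS fg => t fg /fg ->.
Qed.

(** By [le_simple_integral_dist] the integrals of an L1-approximating sequence are Cauchy, and [X]
    is complete. *)
Lemma bochner_integral_exists D (f : T -> X) : measurable D ->
  strongly_measurable mu D f -> (\int[mu]_(t in D) (vnorm (f t))%:E < +oo)%E ->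
  exists v, is_bochner_integral mu D f v.
Proof.
move=> mD smf fy; have [s [ss sf]] := strongly_measurable_L1_approx mD smf fy.
suff [v sv] : exists v : X, simple_integral mu D (s n) @[n --> \oo] --> v.
  by exists v; split => //; exists s.
suff /cauchy_cvgP/cvg_ex : cauchy (simple_integral mu D (s n) @[n --> \oo]) by [].
apply/cauchyP => -[e e'] /[!ltcE]/= /andP[/eqP -> e0].
have e20 : 0 < e / 2 by rewrite divr_gt0.
have sfe : \forall n \near \oo, (\int[mu]_(t in D) (vnorm (f t - s n t))%:E < (e / 2)%:E)%E.
  move/fine_cvgP : sf => [fin /cvgrPdist_lt/(_ _ e20)].
  apply: filterS2 fin => n fin.
  rewrite sub0r normrN ger0_norm ?fine_ge0 ?integral_vnorm_ge0// => H.
  by rewrite -(fineK fin) lte_fin.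
have [N _ HN] := sfe.
exists (simple_integral mu D (s N)); exists N => // n /= Nn.
rewrite -ball_normE/= norm_vnorm ltcR -lte_fin.
apply: (le_lt_trans (le_simple_integral_dist mD smf (ss N) (ss n))).
by rewrite [e]splitr EFinD; apply: lteD; [exact: (HN N (leqnn N))|exact: (HN n Nn)].
Qed.

(** The integrals of two approximating sequences differ by at most the sum of their L1 errors. Hence
    [v] is unique and the choice made by [xget] in [bochner_integral] is harmless. *)
Lemma is_bochner_integral_cvg D (f : T -> X) v (s : nat -> T -> X) : measurable D ->
  is_bochner_integral mu D f v -> (forall n, simple_on mu D (s n)) ->
  (\int[mu]_(t in D) (vnorm (f t - s n t))%:E)%E @[n --> \oo] --> 0%E ->
  simple_integral mu D (s n) @[n --> \oo] --> v.
Proof.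
move=> mD [smf [s' [ss' sf' s'v]]] ss sf.
apply/vnorm_cvgP.
have /fine_cvgP[fin cvg0] : ((\int[mu]_(t in D) (vnorm (f t - s n t))%:E + \int[mu]_(t in D) (vnorm (f t - s' n t))%:E)
  @[n --> \oo] --> 0)%E by rewrite -[X in _ --> X](adde0 0%E); apply: cvgeD.
apply/cvgrPdist_le => e e0.
have e20 : 0 < e / 2 by rewrite divr_gt0.
move/vnorm_cvgP/cvgrPdist_le/(_ _ e20) : s'v.
move/cvgrPdist_le/(_ _ e20) : cvg0; apply: filterS3 fin => n fin.
rewrite !sub0r !normrN => H1 H2.
rewrite ger0_norm ?vnorm_ge0// in H2; rewrite ger0_norm ?vnorm_ge0//.
apply: (le_trans (ler_vdist _ (simple_integral mu D (s' n)) _)).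
rewrite [e]splitr; apply: lerD => //; apply: le_trans H1; apply: le_trans (ler_norm _).
by rewrite -lee_fin fineK//; exact: le_simple_integral_dist.
Qed.

Lemma is_bochner_integral_unique D (f : T -> X) v w : measurable D ->
  is_bochner_integral mu D f v -> is_bochner_integral mu D f w -> v = w.
Proof.
move=> mD fv [_ [s [ss sf sw]]].
have sv := is_bochner_integral_cvg mD fv ss sf.
exact: (cvg_unique _ sv sw).
Qed.

Lemma bochner_integralE D (f : T -> X) v : measurable D ->
  is_bochner_integral mu D f v -> bochner_integral mu D f = v.
Proof.
move=> mD fv; apply: is_bochner_integral_unique (fv) => //.
by rewrite /bochner_integral; case: xgetP => // /(_ v).
Qed.

Lemma ae_is_bochner_integral D (f g : T -> X) v : measurable D ->
  {ae mu, forall t, D t -> f t = g t} ->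
  is_bochner_integral mu D f v -> is_bochner_integral mu D g v.
Proof.
move=> mD fg [smf [s [ss sf sv]]]; split; first exact: ae_strongly_measurable smf.
exists s; split => //; apply: cvg_trans sf; apply: near_eq_cvg; apply: nearW => n.
apply: ae_ge0_eq_integral => //; try by move=> *; rewrite lee_fin vnorm_ge0.
by apply: filterS fg => t fg /fg ->.
Qed.

Lemma simple_on0 D : measurable D -> simple_on mu D (cst 0 : T -> X).
Proof.
move=> mD; apply/simple_onP; split; last first.
  rewrite [X in mu X](_ : _ = set0) ?measure0//.
  by apply/seteqP; split => // t [_ /=].
split => [|y]; first by apply: (@sub_finite_set _ _ [set 0]) => // _ [? _ <-].
by rewrite preimage_cst; case: ifPn; rewrite ?setIT ?setI0.
Qed.

(** Common source of two estimates: with [s = 0] it bounds the norm of an integral, with [s]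
    constant it compares an average with a given vector. *)
Lemma le_vnorm_bochner_integral_dist D (f : T -> X) v s : measurable D ->
  is_bochner_integral mu D f v -> simple_on mu D s ->
  ((vnorm (v - simple_integral mu D s))%:E <= \int[mu]_(t in D) (vnorm (f t - s t))%:E)%E.
Proof.
move=> mD [smf [s' [ss' sf' s'v]]] ss.
apply/lee_addgt0Pr => e e0.
have e20 : 0 < e / 2 by rewrite divr_gt0.
have /fine_cvgP[fin /cvgrPdist_le/(_ _ e20) H1] := sf'.
move/vnorm_cvgP/cvgrPdist_le/(_ _ e20) : s'v => H2.
have [n _ /(_ n (leqnn n))[[fn H1n] H2n]] := filterI (filterI fin H1) H2.
rewrite sub0r normrN ger0_norm ?vnorm_ge0// vnormB in H2n.
have {}H1n : (\int[mu]_(t in D) (vnorm (f t - s' n t))%:E <= (e / 2)%:E)%E.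
  rewrite -(fineK fn) lee_fin; apply: le_trans H1n.
  by rewrite sub0r normrN ler_norm.
apply: (@le_trans _ _ ((vnorm (v - simple_integral mu D (s' n)))%:E +
   (vnorm (simple_integral mu D (s' n) - simple_integral mu D s))%:E)%E).
  by rewrite -EFinD lee_fin; exact: ler_vdist.
rewrite [e]splitr EFinD addeCA; apply: leeD; first by rewrite lee_fin.
apply: (le_trans (le_simple_integral_dist mD smf (ss' n) ss)).
by rewrite addeC; apply: leeD.
Qed.

Lemma le_vnorm_bochner_integral D (f : T -> X) v : measurable D ->
  is_bochner_integral mu D f v ->
  ((vnorm v)%:E <= \int[mu]_(t in D) (vnorm (f t))%:E)%E.
Proof.
move=> mD fv; have := le_vnorm_bochner_integral_dist mD fv (simple_on0 mD).
rewrite [simple_integral _ _ _](simple_integral_widen _ (F := [set 0])) //; last first.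
  by move=> _ [? _ <-].
rewrite fsbig_set1 scaler0 subr0 => /le_trans; apply.
by under eq_integral do rewrite subr0.
Qed.

Lemma le_vnorm_bochner_integral_cst D (f : T -> X) v x : measurable D -> (mu D < +oo)%E ->
  is_bochner_integral mu D f v ->
  ((vnorm (v - (fine (mu D))%:C *: x))%:E <= \int[mu]_(t in D) (vnorm (f t - x))%:E)%E.
Proof.
move=> mD Dy fv; have := le_vnorm_bochner_integral_dist mD fv (simple_on_cst x mD Dy).
by rewrite simple_integral_cst.
Qed.

Lemma is_bochner_integral_linear (L : {linear X -> X}) (C : R) D (f : T -> X) v : measurable D ->
  (forall x, vnorm (L x) <= C * vnorm x) ->
  is_bochner_integral mu D f v -> is_bochner_integral mu D (fun t => L (f t)) (L v).
Proof.
move=> mD LC [smf [s [ss sf sv]]].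
(* A bound with negative [C] is possible when [X] is trivial; below, [C] multiplies integrals and
   must be nonnegative. *)
wlog C0 : C LC / 0 <= C.
  move=> /(_ (Num.max C 0)); apply; last by rewrite le_max lexx orbT.
  move=> x; apply: (le_trans (LC x)); rewrite ler_wpM2r ?vnorm_ge0//.
  by rewrite le_max lexx.
have Lcvg (u : nat -> X) l : u n @[n --> \oo] --> l -> L (u n) @[n --> \oo] --> L l.
  move=> /vnorm_cvgP ul.
  apply: (@cvg_squeeze_vnorm _ _ _ _ _ _ _ (fun n => C * vnorm (u n - l))).
    by apply: nearW => n; rewrite -linearB; exact: LC.
  by rewrite -(mulr0 C); apply: cvgM => //; exact: cvg_cst.
split.
  have [s' [ss' s'f]] := smf; exists (fun n => L \o s' n); split.
    by move=> n; exact: (simple_integral_linear L (ss' n)).1.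
  by apply: filterS s'f => t H Dt; apply: Lcvg; exact: H.
exists (fun n => L \o s n); split.
- by move=> n; exact: (simple_integral_linear L (ss n)).1.
- have [g gap fg] := strongly_measurable_approximable mD smf.
  apply: (@squeeze_cvge _ _ _ _ (cst 0%E) _ (fun n => C%:E * \int[mu]_(t in D) (vnorm (f t - s n t))%:E)%E).
  + apply: nearW => n /=; rewrite integral_vnorm_ge0/=.
    rewrite (@ae_ge0_eq_integral _ (fun t => (vnorm (f t - s n t))%:E) (fun t => (vnorm (g t - s n t))%:E))//;
      try by move=> *; rewrite lee_fin vnorm_ge0.
      rewrite -ge0_integralZl_EFin//.
      - apply: ae_ge0_le_integral => //; try by move=> *; rewrite lee_fin ?mulr_ge0 ?vnorm_ge0.
        by apply: filterS fg => t fg Dt; rewrite -fg// -linearB lee_fin; exact: LC.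
      - by move=> *; rewrite lee_fin vnorm_ge0.
      - apply/measurable_EFinP; apply: approximable_measurable; apply: approximableB => //.
        exact: approximable_simple.
    by apply: filterS fg => t fg /fg ->.
  + exact: cvg_cst.
  + by rewrite -(mule0 C%:E); apply: cvgeZl.
- have E n : simple_integral mu D (L \o s n) = L (simple_integral mu D (s n)).
    exact: (simple_integral_linear L (ss n)).2.
  by under eq_fun do rewrite E; exact: Lcvg.
Qed.

(** A sequence that approximates [f] on the union also does so on each part, so additivity passes
    from simple functions to the limit. *)
Lemma is_bochner_integralU A B (f : T -> X) v a b : measurable A -> measurable B ->
  A `&` B = set0 -> is_bochner_integral mu (A `|` B) f v ->
  is_bochner_integral mu A f a -> is_bochner_integral mu B f b -> v = a + b.
Proof.
move=> mA mB AB [smf [s [ss sf sv]]] fa fb.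
have mAB : measurable (A `|` B) by exact: measurableU.
have H C c : measurable C -> C `<=` A `|` B -> is_bochner_integral mu C f c ->
    simple_integral mu C (s n) @[n --> \oo] --> c.
  move=> mC CAB fc; apply: is_bochner_integral_cvg fc _ _ => // [n|].
    exact: simple_on_subset (ss n).
  apply: (@squeeze_cvge _ _ _ _ (cst 0%E) _ (fun n => \int[mu]_(t in A `|` B) (vnorm (f t - s n t))%:E)%E) => //.
    apply: nearW => n /=; rewrite integral_vnorm_ge0/=.
    by apply: ae_ge0_le_integral_subset => //; [by move=> t _; rewrite lee_fin vnorm_ge0..|exact: aeW].
  exact: cvg_cst.
apply: (cvg_unique _ sv) => //.
have E n : simple_integral mu (A `|` B) (s n) = simple_integral mu A (s n) + simple_integral mu B (s n).
  exact: simple_integralU.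
rewrite /=; under eq_fun do rewrite E; apply: cvgD; apply: H => //.
Qed.

End Bochner.

(** * Strong measurability on the half-line *)

Section Shift.
Context (R : realType).
Local Notation mu := (@lebesgue_measure R).

Definition shift_fun (h : R) : measurableTypeR R -> measurableTypeR R := fun t => t - h.

Lemma measurable_shift_fun (h : R) : measurable_fun setT (shift_fun h).
Proof. by apply: measurable_funB => //; exact: measurable_cst. Qed.

Lemma measurable_shift (h : R) (A : set R) : measurable A ->
  measurable (shift_fun h @^-1` A).
Proof. by move=> mA; rewrite -[X in measurable X]setTI; exact: measurable_shift_fun. Qed.

(** The pushforward by a translation gives every half-open interval its length, which characterizes
    Lebesgue measure. *)
Lemma lebesgue_measure_shift (h : R) (A : set R) : measurable A ->
  mu (shift_fun h @^-1` A) = mu A.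
Proof.
move=> mA.
pose m := @measurable_shift_fun h.
pose mphi_mixin := isMeasurableFun.Build _ _ _ _ _ m.
pose mphi : {mfun _ >-> _} := HB.pack (shift_fun h) mphi_mixin.
apply/esym.
rewrite -[RHS]/(pushforward mu mphi A).
apply: lebesgue_measure_unique => //= _ [[a b]] _ <-.
rewrite /pushforward.
have -> : mphi @^-1` (`]a, b]%classic) = `]a + h, b + h]%classic.
  by apply/seteqP; split => t; rewrite /= !in_itv/= /shift_fun ltrBrDr lerBlDr.
rewrite !lebesgue_measure_itv/= !lte_fin ltrD2r -!EFinB (_ : b + h - (a + h) = b - a)//.
by rewrite opprD addrACA subrr addr0.
Qed.

Lemma ge0_integral_shift (h : R) (D : set R) (f : R -> \bar R) : measurable D ->
  measurable_fun D f -> (forall t, D t -> 0 <= f t)%E ->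
  (\int[mu]_(t in shift_fun h @^-1` D) f (t - h)%R = \int[mu]_(t in D) f t)%E.
Proof.
move=> mD mf f0.
rewrite -[LHS](ge0_integral_pushforward (@measurable_shift_fun h) mu mD mf); last first.
  by move=> t /set_mem; exact: f0.
apply: eq_measure_integral => [|mT A mA AS]; first exact: measurable_shift_fun.
exact: lebesgue_measure_shift.
Qed.

End Shift.

Section StrongMeasurability.
Context (R : realType) (X : completeNormedModType R[i]).
Local Notation mu := (@lebesgue_measure R).
Implicit Types (D : set R) (f : R -> X).

Lemma strongly_measurableD D f g : strongly_measurable mu D f ->
  strongly_measurable mu D g -> strongly_measurable mu D (fun t => f t + g t).
Proof.
move=> [s [ss sf]] [s' [ss' sg]]; exists (fun n => s n \+ s' n); split.
  by move=> n; exact: simple_on_add.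
apply: filterS2 sf sg => t sf sg Dt; apply: cvgD; [exact: sf|exact: sg].
Qed.

(** Index of the cell of mesh [1 / (n + 1)] that contains [t]. The cut at [n] leaves finitely many
    cells, of finite total measure. *)
Let cell (n : nat) (t : R) : option nat :=
  if t < n%:R then Some (Num.truncn (n.+1%:R * t)) else None.

Let grid (n : nat) (t : R) : R := (Num.truncn (n.+1%:R * t)).+1%:R / n.+1%:R.

Let fin_valued_cell D n : measurable D -> D `<=` `[0, +oo[ -> fin_valued D (cell n).
Proof.
move=> mD D0; split.
  apply: (@sub_finite_set _ _ ([set None] `|` (@Some nat) @` `I_(n * n.+1).+1)); last first.
    by rewrite finite_setU; split => //; apply: finite_image; exact: finite_II.
  move=> _ [t Dt <-]; rewrite /cell; case: ifPn => tn; last by left.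
  have t0 : 0 <= t by have := D0 _ Dt; rewrite /= in_itv/= andbT.
  right; exists (Num.truncn (n.+1%:R * t)) => //=.
  rewrite ltnS -(ler_nat R); apply: (@le_trans _ _ (n.+1%:R * t)).
    by have /andP[] := truncn_itv (mulr_ge0 (ler0n R n.+1) t0).
  by rewrite natrM mulrC ler_wpM2r// ltW.
move=> [k|].
  have -> : D `&` cell n @^-1` [set Some k] =
     D `&` (`]-oo, n%:R[ `&` `[k%:R / n.+1%:R, k.+1%:R / n.+1%:R[).
    apply/seteqP; split => t /= [Dt].
      rewrite /cell; case: ifPn => // tn [kt]; split => //; split; first by rewrite in_itv.
      have t0 : 0 <= t by have := D0 _ Dt; rewrite /= in_itv/= andbT.
      rewrite in_itv/= ler_pdivrMr// ltr_pdivlMr// mulrC -kt.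
      exact: truncn_itv (mulr_ge0 (ler0n R n.+1) t0).
    move=> [+]; rewrite !in_itv/= => tn; rewrite ler_pdivrMr// ltr_pdivlMr// mulrC => kt.
    by split => //; rewrite /cell tn; congr Some; exact: truncn_def.
  by apply: measurableI => //; apply: measurableI.
have -> : D `&` cell n @^-1` [set None] = D `&` `[n%:R, +oo[.
  apply/seteqP; split => t /= [Dt]; rewrite in_itv/= andbT /cell; case: ltP => //.
exact: measurableI.
Qed.

Let grid_gt n t : 0 <= t -> t < grid n t.
Proof.
move=> t0; rewrite ltr_pdivlMr// mulrC.
by have /andP[] := truncn_itv (mulr_ge0 (ler0n R n.+1) t0).
Qed.

Let cvg_grid t : 0 <= t -> grid n t @[n --> \oo] --> t.
Proof.
move=> t0; apply/cvgrPdist_le => e e0.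
near=> n; have gt := ltW (grid_gt n t0).
rewrite distrC ger0_norm ?subr_ge0//.
rewrite lerBlDr ler_pdivrMr// mulrDl -natr1.
have /andP[H _] := truncn_itv (mulr_ge0 (ler0n R n.+1) t0).
rewrite addrC; apply: lerD; last by rewrite (mulrC t).
rewrite mulrC -ler_pdivrMr// mul1r.
apply: (@le_trans _ _ n%:R); last by rewrite ler_nat.
by near: n; exact: nbhs_infty_ger.
Unshelve. all: by end_near. Qed.

(* [K] may jump, but only from the left: sampling it on grid points to the
   right of the argument keeps the approximants simple. *)
Lemma strongly_measurable_comp (K : R -> X -> X) (C : R) D f : measurable D ->
  D `<=` `[0, +oo[ ->
  (forall t x y, 0 <= t -> vnorm (K t x - K t y) <= C * vnorm (x - y)) ->
  (forall t x, D t -> K u x @[u --> t^'+] --> K t x) ->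
  strongly_measurable mu D f -> strongly_measurable mu D (fun t => K t (f t)).
Proof.
move=> mD D0 KC Kr [s [ss sf]].
exists (fun n t => if cell n t is Some k then K (k.+1%:R / n.+1%:R) (s n t) else 0).
split=> [n|].
  have /simple_onP[fs _] := ss n.
  have fq := fin_valued_pair (fin_valued_cell n mD D0) fs.
  pose F (z : option nat * X) := if z.1 is Some k then K (k.+1%:R / n.+1%:R) z.2 else 0.
  apply/simple_onP; split; first exact: fin_valued_comp F fq.
  apply: (@le_lt_trans _ _ (mu `[0, n%:R]%classic)); last first.
    by rewrite lebesgue_measure_itv/=; case: ifPn; rewrite // -EFinB ltry.
  apply: le_measure; rewrite ?inE.
  - exact: (fin_valued_preimage fq (F @^-1` [set~ 0])).
  - exact: measurable_itv.
  - move=> t /= [Dt]; rewrite /cell; case: ifPn => // tn _.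
    by have := D0 _ Dt; rewrite /= !in_itv/= andbT => ->; rewrite ltW.
apply: filterS sf => t /[swap] Dt /(_ Dt) sft.
have t0 : 0 <= t by have := D0 _ Dt; rewrite /= in_itv/= andbT.
(* The error made in the vector is absorbed by the Lipschitz bound, the one made in the time by
   right continuity, since [grid n t] tends to [t] from the right. *)
apply: (@cvg_squeeze_vnorm _ _ _ _ _ _ _ (fun n => C * vnorm (s n t - f t) +
   vnorm (K (grid n t) (f t) - K t (f t)))).
  near=> n; rewrite /cell ifT; last first.
    by near: n; exact: nbhs_infty_gtr.
  rewrite -/(grid n t); apply: (le_trans (ler_vdist _ (K (grid n t) (f t)) _)).
  by rewrite lerD2r; apply: KC; exact: (le_trans t0 (ltW (grid_gt n t0))).
rewrite -(addr0 0) -[X in X + 0](mulr0 C); apply: cvgD.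
  by apply: cvgM; [exact: cvg_cst|exact/vnorm_cvgP].
have /vnorm_cvgP/cvg_at_rightP := Kr t (f t) Dt; apply; split; last exact: cvg_grid.
by move=> n; exact: grid_gt.
Unshelve. all: by end_near. Qed.

(** Case of a kernel that ignores its vector argument, applied to the zero function. *)
Lemma right_continuous_strongly_measurable D f : measurable D -> D `<=` `[0, +oo[ ->
  (forall t, D t -> f u @[u --> t^'+] --> f t) -> strongly_measurable mu D f.
Proof.
move=> mD D0 fr.
apply: (@strongly_measurable_comp (fun t _ => f t) 0 D (cst 0)) => //.
- by move=> t x y _; rewrite subrr vnorm0 mul0r.
- by move=> t _; exact: fr.
- by apply: approximable_strongly_measurable; apply: approximable_simple; exact: simple_on0.
Qed.

Lemma strongly_measurable_shift (h : R) f : 0 <= h ->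
  strongly_measurable mu `[0, +oo[ f ->
  strongly_measurable mu `[0, +oo[ (fun t => if h <= t then f (t - h) else 0).
Proof.
move=> h0 [s [ss sf]].
have mD : measurable (`[0, +oo[%classic : set R) by exact: measurable_itv.
exists (fun n t => if h <= t then s n (t - h) else 0); split => [n|].
  have [fs sy] := (simple_onP _ _ _).1 (ss n).
  have mh : measurable (`[0, +oo[ `&` [set t | h <= t] : set R).
    rewrite (_ : [set t | h <= t] = `[h, +oo[%classic); first exact: measurableI.
    by apply/seteqP; split => t /=; rewrite in_itv/= andbT.
  (* The layer [[0, h[] carries only the value 0, so the support is merely translated and keeps its
     measure. *)
  have E (B : set X) : `[0, +oo[ `&` (fun t => if h <= t then s n (t - h) else 0) @^-1` B =
     shift_fun h @^-1` (`[0, +oo[ `&` s n @^-1` B) `|` (if 0 \in B then `[0, h[%classic else set0).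
    apply/seteqP; split => t /=; rewrite /shift_fun !in_itv/= !andbT.
      move=> [t0]; case: ifPn => [ht Bs|]; first by left; rewrite subr_ge0.
      by rewrite -ltNge => th B0; right; rewrite mem_set//= in_itv/= t0.
    move=> [[]|].
      by rewrite subr_ge0 => ht Bs; rewrite ht (le_trans h0 ht).
    case: ifPn => //= B0; rewrite in_itv/= => /andP[t0 th].
    by rewrite t0 leNgt th/=; split => //; exact: set_mem.
  apply/simple_onP; split; last first.
    rewrite E ifF; last by rewrite memNset//= => /(_ erefl).
    rewrite setU0; apply: le_lt_trans sy; rewrite le_eqVlt; apply/orP; left; apply/eqP.
    by apply: lebesgue_measure_shift; exact: fin_valued_preimage.
  split; last first.
    move=> x; rewrite E; apply: measurableU; last by case: ifP => // _; exact: measurable_itv.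
    by apply: measurable_shift; exact: fin_valued_preimage.
  apply: (@sub_finite_set _ _ ([set 0] `|` s n @` `[0, +oo[)); last first.
    by rewrite finite_setU; split => //; case: fs.
  move=> _ [t t0 <-]; case: ifPn => ht; last by left.
  by right; exists (t - h) => //=; rewrite in_itv/= andbT subr_ge0.
have [N [mN N0 sN]] := sf.
exists (shift_fun h @^-1` N); split.
- exact: measurable_shift.
- exact: (etrans (lebesgue_measure_shift h mN) N0).
- move=> t /= H; apply: sN => /= H2; apply: H => t0.
  case: ifPn => ht; last exact: cvg_cst.
  by apply: H2; rewrite in_itv/= andbT subr_ge0.
Qed.

End StrongMeasurability.

Section WithinContinuous.
Context (R : realType) (X : completeNormedModType R[i]).

Lemma within_continuous_vnormP (S : pseudoMetricType R) (A : set S) (f : S -> X) :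
  {within A, continuous f} <->
  forall s, A s -> forall e, 0 < e ->
    exists2 d, 0 < d & forall s', A s' -> ball s d s' -> vnorm (f s' - f s) < e.
Proof.
split=> [/subspace_continuousP cf s As e e0|cf].
  have /vnorm_cvgP/cvgrPdist_lt/(_ _ e0) := cf s As.
  rewrite near_withinE => /nbhs_ballP[d /= d0 H]; exists d => // s' As' ss'.
  by have := H _ ss' As'; rewrite sub0r normrN ger0_norm// vnorm_ge0.
apply/subspace_continuousP => s As; apply/vnorm_cvgP/cvgrPdist_lt => e e0.
have [d d0 H] := cf s As e e0; rewrite near_withinE; apply/nbhs_ballP; exists d => //=.
by move=> s' ss' As'; rewrite sub0r normrN ger0_norm ?vnorm_ge0//; exact: H.
Qed.

End WithinContinuous.

Section AlmostEverywhere.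
Context (R : realType).
Local Notation mu := (@lebesgue_measure R).

(* [measurableTypeR R] is only convertible to [R]; stating these for
   predicates on [R] spares the unification of the two. *)
Lemma aeS (P Q : R -> Prop) : (forall t, P t -> Q t) ->
  {ae mu, forall t, P t} -> {ae mu, forall t, Q t}.
Proof. by move=> PQ [N [mN N0 PN]]; exists N; split => // t /= nQ; apply: PN => /= /PQ. Qed.

Lemma aeS2 (P Q S : R -> Prop) : (forall t, P t -> Q t -> S t) ->
  {ae mu, forall t, P t} -> {ae mu, forall t, Q t} -> {ae mu, forall t, S t}.
Proof.
move=> PQS H K; apply: (aeS (P := fun t => P t /\ Q t)) => [t [? ?]|]; first exact: PQS.
exact: (@filterI _ _ (ae_filter_ringOfSetsType mu) _ _ H K).
Qed.

End AlmostEverywhere.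

Section NormRepresentative.
Context (R : realType) (X : completeNormedModType R[i]).
Local Notation mu := (@lebesgue_measure R).

(** The norm of [f] itself need not be measurable; the scalar inequalities are applied to [g]. Its
    vanishing on the negatives turns integrals over the half-line into integrals over the line. *)
Lemma ae_vnorm_measurable (f : R -> X) : strongly_measurable mu `[0, +oo[ f ->
  exists g : R -> R, [/\ measurable_fun setT g, forall t, 0 <= g t, forall t, t < 0 -> g t = 0 &
    {ae mu, forall t, 0 <= t -> vnorm (f t) = g t}].
Proof.
have mD : measurable (`[0, +oo[%classic : set (measurableTypeR R)) by exact: measurable_itv.
move=> smf; have [f' f'ap ff'] := strongly_measurable_approximable (mu := mu) mD smf.
exists ((fun t => vnorm (f' t)) \_ `[0, +oo[); split.
- have m := approximable_measurable f'ap.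
  exact: ((measurable_restrictT _ mD).1 m).
- by move=> t; rewrite /patch; case: ifP => // _; exact: vnorm_ge0.
- move=> t t0; rewrite /patch ifF//; apply/negbTE; rewrite notin_setE/= in_itv/= andbT.
  by apply/negP; rewrite -ltNge.
- apply: filterS ff' => t ff' t0; rewrite /patch ifT.
    by rewrite ff'//= in_itv/= t0.
  by rewrite inE/= in_itv/= t0.
Qed.

End NormRepresentative.

(** * The operator G *)

Section EvolutionFamily.
Context (R : realType) (X : completeNormedModType R[i]).
Variables (U : R -> R -> {linear X -> X}).
Hypothesis U_evol : evolution_family U.
Variables (M omega : R).
Hypotheses (M1 : 1 <= M) (UM : growth_bound U M omega).
Local Notation mu := (@lebesgue_measure R).
Implicit Types (f : R -> X) (t T : R) (D : set (measurableTypeR R)).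

Let M0 : 0 <= M. Proof. exact: le_trans M1. Qed.

Lemma evolution_cocycle t s tau x : 0 <= tau -> tau <= s -> s <= t ->
  U t tau x = U t s (U s tau x).
Proof. by case: U_evol => _ H _ _ t0 ts st; exact: H. Qed.

Lemma evolution_id t x : 0 <= t -> U t t x = x.
Proof. by case: U_evol => _ _ H _ t0; exact: H. Qed.

Lemma evolution_continuous x t tau e : 0 <= tau <= t -> 0 < e ->
  exists2 d, 0 < d & forall t' tau', 0 <= tau' <= t' -> `|t' - t| < d -> `|tau' - tau| < d ->
    vnorm (U t' tau' x - U t tau x) < e.
Proof.
case: U_evol => _ _ _ /(_ x)/within_continuous_vnormP /(_ (t, tau)) H ttau e0.
have [d d0 Hd] := H ttau e e0; exists d => // t' tau' tt' td taud.
apply: (Hd (t', tau')) => //; split => /=; by rewrite /ball/= distrC.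
Qed.

Lemma expR_growth_le s t L : s <= t -> t - s <= L -> expR (omega * (t - s)) <= expR (`|omega| * L).
Proof.
move=> st tL; rewrite ler_expR; apply: (@le_trans _ _ (`|omega| * (t - s))); last by rewrite ler_wpM2l.
by rewrite ler_wpM2r ?subr_ge0// ler_norm.
Qed.

Lemma growth_bound_itv t s L x : 0 <= s -> s <= t -> t - s <= L ->
  vnorm (U t s x) <= M * expR (`|omega| * L) * vnorm x.
Proof.
move=> s0 st tsL; have sst : 0 <= s <= t by rewrite s0.
by apply: (le_trans (UM sst x)); rewrite ler_wpM2r ?vnorm_ge0// ler_wpM2l// expR_growth_le.
Qed.

Lemma growth_bound_le t tau T x : 0 <= tau <= t -> t <= T ->
  vnorm (U t tau x) <= M * expR (`|omega| * T) * vnorm x.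
Proof.
move=> /andP[tau0 taut] tT; apply: growth_bound_itv => //.
by rewrite (le_trans _ tT)// lerBlDr lerDl.
Qed.

Let integrand_measurable f t D : 0 <= t -> measurable D -> D `<=` `[0, t] ->
  strongly_measurable mu `[0, +oo[ f ->
  strongly_measurable mu D (fun tau => U t tau (f tau)).
Proof.
move=> t0 mD Dt smf.
have D0 : D `<=` `[0, +oo[.
  by move=> s /Dt /=; rewrite !in_itv/= andbT => /andP[].
have smD := strongly_measurable_subset mD D0 smf.
pose C := M * expR (`|omega| * t).
(* [U t s] is meaningful only for [s <= t]; freezing [s] at [t] gives a kernel with a uniform bound
   for all [s >= 0] that is right continuous at [t] too. *)
have := @strongly_measurable_comp _ _ (fun s x => U t (Num.min s t) x) C D f mD D0 _ _ smD.
move=> H; apply: (ae_strongly_measurable _ (H _ _)).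
- apply: aeW => s /Dt/=; rewrite in_itv/= => /andP[_ st].
  by rewrite min_l.
- move=> s x y s0; rewrite -linearB; apply: growth_bound_le => //.
  by rewrite le_min s0 t0/= ge_min lexx orbT.
move=> s x /Dt/=; rewrite in_itv/= => /andP[s0 st].
apply/vnorm_cvgP/cvgrPdist_lt => e e0.
have [|d d0 Hd] := @evolution_continuous x t s e _ e0; first by rewrite s0.
near=> u; rewrite sub0r normrN ger0_norm ?vnorm_ge0// (min_l st).
have su : s < u by near: u; exact: nbhs_right_gt.
have ud : u < s + d by near: u; apply: nbhs_right_lt; rewrite ltrDl.
apply: Hd; rewrite ?subrr ?normr0//.
  rewrite le_min t0 (le_trans s0 (ltW su))/= ge_min lexx orbT//.
rewrite ger0_norm ?subr_ge0 ?le_min ?st ?(ltW su)//.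
by rewrite ltrBlDl gt_min ud.
Unshelve. all: by end_near. Qed.

(** What makes [green U f t] a true integral for every [t >= 0]; it covers L^p and C_00 at once. *)
Definition locally_bochner f := strongly_measurable mu `[0, +oo[ f /\
  forall T, 0 <= T -> (\int[mu]_(t in `[0%R, T]%classic) (vnorm (f t))%:E < +oo)%E.

Lemma le_integral_integrand f (g : R -> R) t D : 0 <= t -> measurable D -> D `<=` `[0, t] ->
  (forall s, 0 <= g s) ->
  {ae mu, forall s, 0 <= s -> vnorm (f s) = g s} ->
  (\int[mu]_(s in D) (vnorm (U t s (f s)))%:E <=
   \int[mu]_(s in D) (M * expR (omega * (t - s)) * g s)%:E)%E.
Proof.
move=> t0 mD Dt g0 fg; apply: (ae_ge0_le_integral (mu := mu)) => //.
- by move=> s _; rewrite lee_fin vnorm_ge0.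
- by move=> s _; rewrite lee_fin mulr_ge0// mulr_ge0// expR_ge0.
- apply: (aeS _ fg) => s fgs Ds; have := Dt _ Ds; rewrite /= in_itv/= => /andP[s0 st].
  by rewrite -fgs// lee_fin; apply: UM; rewrite s0.
Qed.

Lemma locally_bochner_norm f (g : R -> R) : locally_bochner f ->
  (forall t, 0 <= g t) -> {ae mu, forall t, 0 <= t -> vnorm (f t) = g t} ->
  forall T, 0 <= T -> (\int[mu]_(t in `[0%R, T]%classic) (g t)%:E < +oo)%E.
Proof.
move=> [smf fy] g0 fg T T0; apply: le_lt_trans (fy T T0).
apply: (ae_ge0_le_integral (mu := mu)) => //.
- by move=> s _; rewrite lee_fin.
- by move=> s _; rewrite lee_fin vnorm_ge0.
- apply: (aeS _ fg) => s fgs; rewrite /= in_itv/= => /andP[s0 st].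
  by rewrite fgs.
Qed.

Lemma integrand_bochner f t D : 0 <= t -> measurable D -> D `<=` `[0, t] ->
  locally_bochner f -> exists v, is_bochner_integral mu D (fun tau => U t tau (f tau)) v.
Proof.
move=> t0 mD Dt lbf; have [smf fy] := lbf.
have [g [mg g0 gn fg]] := ae_vnorm_measurable smf.
have gy := locally_bochner_norm lbf g0 fg.
apply: bochner_integral_exists => //; first exact: integrand_measurable.
apply: le_lt_trans (le_integral_integrand t0 mD Dt g0 fg) _.
pose C := M * expR (`|omega| * t).
have mg' : measurable_fun D (EFin \o g).
  by apply/measurable_EFinP; exact: measurable_funTS.
apply: (@le_lt_trans _ _ (\int[mu]_(s in D) (C%:E * (g s)%:E))%E).
  apply: (ae_ge0_le_integral (mu := mu)) => //.
  - by move=> s _; rewrite lee_fin mulr_ge0// mulr_ge0// expR_ge0.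
  - by move=> s _; rewrite lee_fin mulr_ge0// mulr_ge0// expR_ge0.
  apply: aeW => s /Dt/=; rewrite in_itv/= => /andP[s0 st].
  by rewrite lee_fin ler_wpM2r// ler_wpM2l// expR_growth_le// lerBlDr lerDl.
rewrite ge0_integralZl_EFin//; last 2 first.
- by move=> s _; rewrite lee_fin.
- by rewrite mulr_ge0// expR_ge0.
apply: lte_mul_pinfty; rewrite ?lee_fin ?mulr_ge0 ?expR_ge0//.
apply: le_lt_trans (gy t t0); apply: ge0_subset_integral => //.
- by apply/measurable_EFinP; exact: measurable_funTS.
- by move=> s _; rewrite lee_fin.
Qed.

(** The increments of [green] are integrals of this kind over a short interval ending at [t]. *)
Definition green_on D f t : X := bochner_integral mu D (fun tau => U t tau (f tau)).

Lemma green_onP f t D : 0 <= t -> measurable D -> D `<=` `[0, t] ->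
  locally_bochner f ->
  is_bochner_integral mu D (fun tau => U t tau (f tau)) (green_on D f t).
Proof.
move=> t0 mD Dt lbf; have [v vP] := integrand_bochner t0 mD Dt lbf.
by rewrite /green_on (bochner_integralE mD vP).
Qed.

Lemma le_vnorm_green_on f (g : R -> R) t D : 0 <= t -> measurable D -> D `<=` `[0, t] ->
  locally_bochner f -> (forall s, 0 <= g s) ->
  {ae mu, forall s, 0 <= s -> vnorm (f s) = g s} ->
  ((vnorm (green_on D f t))%:E <= \int[mu]_(s in D) (M * expR (omega * (t - s)) * g s)%:E)%E.
Proof.
move=> t0 mD Dt lbf g0 fg.
apply: le_trans (le_vnorm_bochner_integral mD (green_onP t0 mD Dt lbf)) _.
exact: le_integral_integrand.
Qed.

Lemma le_vnorm_green_on_cst f (g : R -> R) t D T : 0 <= t <= T -> measurable D -> D `<=` `[0, t] ->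
  locally_bochner f -> measurable_fun setT g -> (forall s, 0 <= g s) ->
  {ae mu, forall s, 0 <= s -> vnorm (f s) = g s} ->
  ((vnorm (green_on D f t))%:E <= (M * expR (`|omega| * T))%:E * \int[mu]_(s in D) (g s)%:E)%E.
Proof.
move=> /andP[t0 tT] mD Dt lbf mg g0 fg.
apply: le_trans (le_vnorm_green_on t0 mD Dt lbf g0 fg) _.
rewrite -ge0_integralZl_EFin//; last 3 first.
- by move=> s _; rewrite lee_fin.
- by apply/measurable_EFinP; exact: measurable_funTS.
- by rewrite mulr_ge0// expR_ge0.
apply: (ae_ge0_le_integral (mu := mu)) => //.
- by move=> s _; rewrite lee_fin mulr_ge0// mulr_ge0// expR_ge0.
- by move=> s _; rewrite lee_fin mulr_ge0// mulr_ge0// expR_ge0.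
apply: aeW => s /Dt/=; rewrite in_itv/= => /andP[s0 st].
by rewrite lee_fin ler_wpM2r// ler_wpM2l// expR_growth_le// lerBlDr (le_trans tT)// lerDl.
Qed.

Lemma greenE f t : green U f t = green_on `[0, t] f t.
Proof. by []. Qed.

(** On [[0, a]] the cocycle law factors [U t s] through [U t a], and a bounded operator commutes
    with the integral. *)
Lemma green_split f a t : 0 <= a <= t -> locally_bochner f ->
  green U f t = U t a (green U f a) + green_on `]a, t] f t.
Proof.
move=> /andP[a0 at_] lbf; have t0 := le_trans a0 at_.
have mA : measurable (`[0, a]%classic : set (measurableTypeR R)) by exact: measurable_itv.
have mB : measurable (`]a, t]%classic : set (measurableTypeR R)) by exact: measurable_itv.
have E : `[0, a] `|` `]a, t] = `[0, t]%classic :> set R.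
  apply/seteqP; split => s /=; rewrite !in_itv/=.
    by move=> [/andP[-> sa]|/andP[/ltW a_s ->]]; rewrite ?(le_trans sa)//= (le_trans a0).
  by move=> /andP[-> ->]; rewrite andbT/=; have [sa|sa] := leP s a; [left|right].
have A0 : `[0, a]%classic `<=` (`[0, t]%classic : set R) by rewrite -E; exact: subsetUl.
have B0 : `]a, t]%classic `<=` (`[0, t]%classic : set R) by rewrite -E; exact: subsetUr.
have := green_onP t0 (measurable_itv _) (@subset_refl _ `[0, t]%classic) lbf.
rewrite -{1}E => /is_bochner_integralU H.
rewrite greenE; apply: H => //; last exact: green_onP.
  apply/seteqP; split => // s /=; rewrite !in_itv/= => -[/andP[_ sa] /andP[+ _]].
  by rewrite ltNge sa.
have aa : `[0, a]%classic `<=` (`[0, a]%classic : set R) by [].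
have fa := green_onP a0 mA aa lbf.
have bd x : vnorm (U t a x) <= (M * expR (omega * (t - a))) * vnorm x.
  by apply: UM; rewrite a0.
apply: ae_is_bochner_integral (is_bochner_integral_linear mA bd fa) => //.
apply: aeW => s /=; rewrite in_itv/= => /andP[s0 sa].
by rewrite -evolution_cocycle.
Qed.

(** Near [t0], the integral is split at one point [a] slightly to the left. The first term is
    [U t a] applied to a fixed vector, continuous in [t]; the integral over []a, t]] is small by
    absolute continuity of the integral. *)
Lemma green_continuous f : locally_bochner f -> {within `[0, +oo[, continuous (green U f)}.
Proof.
move=> lbf; have [smf fy] := lbf.
have [g [mg g0 gn fg]] := ae_vnorm_measurable smf.
have gy := locally_bochner_norm lbf g0 fg.
apply/within_continuous_vnormP => t0; rewrite /= in_itv/= andbT => t00 e e0.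
pose T := t0 + 1; have T0 : 0 <= T by rewrite addr_ge0.
pose C := M * expR (`|omega| * T).
have C0 : 0 < C by rewrite mulr_gt0 ?expR_gt0// (lt_le_trans _ M1).
have mT : measurable (`[0, T]%classic : set (measurableTypeR R)) by exact: measurable_itv.
have gi : mu.-integrable setT (EFin \o (g \_ `[0, T])).
  rewrite -restrict_EFin; apply/integrable_restrict => //=; rewrite setTI.
  apply/integrableP; split; first by apply/measurable_EFinP; exact: measurable_funTS.
  by under eq_integral do rewrite /= ger0_norm//; exact: gy.
have e3C : 0 < e / 3 / C by rewrite !divr_gt0.
have [d [d0 Hd]] := integral_normr_continuous gi e3C.
(* The bound [1] keeps [t] below [T]; [d / 3] makes []a, t]], of length at most [2 * eta], shorter
   than [d]. *)
pose eta := Num.min 1 (d / 3).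
have eta0 : 0 < eta by rewrite lt_min ltr01 divr_gt0.
have eta1 : eta <= 1 by rewrite ge_min lexx.
have etad : eta <= d / 3 by rewrite ge_min lexx orbT.
pose a := Num.max 0 (t0 - eta).
have a0 : 0 <= a by rewrite le_max lexx.
have at0 : a <= t0 by rewrite ge_max t00 gerBl ltW.
have small t : a <= t -> t <= t0 + eta -> vnorm (green_on `]a, t] f t) <= e / 3.
  move=> at_ tb; have tT : 0 <= t <= T.
    by rewrite (le_trans a0 at_)/= (le_trans tb)// lerD2l.
  have mD : measurable (`]a, t]%classic : set (measurableTypeR R)) by exact: measurable_itv.
  have Dt : `]a, t]%classic `<=` (`[0, t]%classic : set R).
    by move=> s /=; rewrite !in_itv/= => /andP[/ltW a_s ->]; rewrite (le_trans a0).
  rewrite -lee_fin; apply: (le_trans (le_vnorm_green_on_cst tT mD Dt lbf mg g0 fg)).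
  have /Hd : (mu `]a, t]%classic < d%:E)%E.
    rewrite lebesgue_measure_itv/=; case: ifPn => _; last by rewrite lte_fin.
    rewrite -EFinB lte_fin; apply: (@le_lt_trans _ _ (d / 3 + d / 3)); last by lra.
    rewrite lerBlDr (le_trans tb)//.
    have : t0 - eta <= a by rewrite le_max lexx orbT.
    by move: etad; lra.
  move=> /(_ mD); rewrite /Rintegral.
  under eq_integral => s /set_mem/Dt/=.
    rewrite in_itv/= => /andP[s0 st].
    rewrite ger0_norm; last by rewrite /patch; case: ifP.
    rewrite /patch ifT; last first.
      by rewrite inE/= in_itv/= s0 (le_trans st)//; case/andP : tT.
    over.
  move=> H; rewrite -(@fineK _ (\int[mu]_(s in `]a, t]%classic) (g s)%:E)%E).
    by rewrite -EFinM lee_fin -ler_pdivlMl// mulrC ltW.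
  rewrite ge0_fin_numE; last by apply: integral_ge0 => s _; rewrite lee_fin.
  have /andP[t0' _] := tT.
  apply: le_lt_trans (gy t t0'); apply: ge0_subset_integral => //.
    by apply/measurable_EFinP; exact: measurable_funTS.
  by move=> s _; rewrite lee_fin.
have a0t0 : 0 <= a <= t0 by rewrite a0.
have e30 : 0 < e / 3 by rewrite divr_gt0.
have [d2 d20 Hd2] := evolution_continuous (green U f a) a0t0 e30.
exists (Num.min eta d2); first by rewrite lt_min eta0.
move=> t /=; rewrite in_itv/= andbT => tge0; rewrite /ball/= distrC lt_min => /andP[teta td2].
move: (teta); rewrite ltr_distl => /andP[lo hi].
have at_ : a <= t by rewrite ge_max tge0 ltW.
rewrite (@green_split f a t) ?a0// (@green_split f a t0) ?a0// opprD addrACA.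
apply: (le_lt_trans (ler_vnormD _ _)).
have H1 := small t at_ (ltW hi).
have H2 : vnorm (green_on `]a, t0] f t0) <= e / 3 by apply: small => //; rewrite lerDl ltW.
have H3 : vnorm (U t a (green U f a) - U t0 a (green U f a)) < e / 3.
  by apply: Hd2 => //; rewrite ?a0// subrr normr0.
have e3 : e / 3 + (e / 3 + e / 3) = e by field.
rewrite -[ltRHS]e3.
exact: (ltr_leD H3 (le_trans (ler_vnormB _ _) (lerD H1 H2))).
Qed.

(** The semigroup term is the first term of [green_split] at [t - h]. *)
Lemma green_increment f h t : 0 < h -> h <= t -> locally_bochner f ->
  green U f t - evolution_semigroup U h (green U f) t = green_on `]t - h, t] f t.
Proof.
move=> h0 ht lbf; rewrite /evolution_semigroup (ltW h0) ht/=.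
by rewrite (@green_split f (t - h) t)//= ?subr_ge0 ?ht ?lerBlDr ?lerDl ?ltW// addrC addKr.
Qed.

(** The boundary layer: the semigroup term is 0 there, and the whole integral remains. *)
Lemma green_increment_lt f h t : t < h ->
  green U f t - evolution_semigroup U h (green U f) t = green_on `[0, t] f t.
Proof. by move=> th; rewrite /evolution_semigroup [h <= t]leNgt th andbF subr0. Qed.

Lemma green_quotient_dist f h t x : 0 < h -> h <= t -> locally_bochner f ->
  ((vnorm (h^-1%:C *: (green U f t - evolution_semigroup U h (green U f) t) - x))%:E <=
   (h^-1)%:E * \int[mu]_(s in `](t - h)%R, t]%classic) (vnorm (U t s (f s) - x))%:E)%E.
Proof.
move=> h0 ht lbf; rewrite green_increment//.
have mD : measurable (`]t - h, t]%classic : set (measurableTypeR R)) by exact: measurable_itv.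
have mE : mu `]t - h, t]%classic = h%:E.
  rewrite lebesgue_measure_itv/= lte_fin gtrBl h0 -EFinB.
  by rewrite opprB addrC subrK.
have Dt : `]t - h, t]%classic `<=` (`[0, t]%classic : set R).
  by move=> s /=; rewrite !in_itv/= => /andP[/ltW a_s ->]; rewrite (le_trans _ a_s)// subr_ge0.
have t0 : 0 <= t by exact: le_trans (ltW h0) ht.
have Dy : (mu `](t - h)%R, t]%classic < +oo)%E by rewrite mE ltry.
have H := le_vnorm_bochner_integral_cst x mD Dy (green_onP t0 mD Dt lbf).
rewrite [fine _](_ : _ = h) in H; last exact: (congr1 fine mE).
rewrite -[X in _ *: _ - X]scale1r (_ : 1 = (h^-1)%:C * h%:C); last first.
  by rewrite -rmorphM/= mulVf// gt_eqF.
rewrite -scalerA -scalerBr vnormZr ger0_norm ?invr_ge0 ?(ltW h0)// EFinM.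
by rewrite lee_wpmul2l// lee_fin invr_ge0 ltW.
Qed.

End EvolutionFamily.

(** * Convolution inequalities and dominated convergence *)

Lemma ge0_cvge0P (R : realType) (T : Type) (F : set_system T) (FF : Filter F) (f : T -> \bar R) :
  (forall x, 0 <= f x)%E ->
  (f @ F --> 0%E) <-> (forall e : R, 0 < e -> \forall x \near F, (f x <= e%:E)%E).
Proof.
move=> f0; split=> [/fine_cvgP[fin /cvgrPdist_le fe] e /fe|fe].
  apply: filterS2 fin => x fin; rewrite sub0r normrN ger0_norm ?fine_ge0// => H.
  by rewrite -(fineK fin) lee_fin.
apply/fine_cvgP; split.
  by apply: filterS (fe 1 ltr01) => x fx; rewrite ge0_fin_numE// (le_lt_trans fx)// ltry.
apply/cvgrPdist_le => e /[dup] e0 /fe; apply: filterS => x; have := f0 x.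
rewrite /= sub0r normrN; case: (f x) => //= r r0.
by rewrite lee_fin ger0_norm.
Qed.

Lemma le_poweR (R : realType) (x y : \bar R) (p : R) : 0 <= p -> (0 <= x)%E -> (x <= y)%E ->
  (x `^ p <= y `^ p)%E.
Proof.
move=> p0 x0 xy; apply: gt0_ler_poweR => //.
  by rewrite in_itv/= x0 leey.
by rewrite in_itv/= (le_trans x0)// leey.
Qed.

Section Convolution.
Context (R : realType).
Local Notation mu := (@lebesgue_measure R).
Implicit Types (k g : R -> R).

Lemma measurable_powR g (p : R) : measurable_fun setT g -> measurable_fun setT (fun t => g t `^ p).
Proof. by move=> mg; apply: (measurableT_comp (f := fun x => x `^ p)) => //; exact: measurable_powRr. Qed.

(** Hölder's inequality for the factors [k^(1/p) g] and [k^(1/q)], raised to the power [p]; note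
    [p / q = p - 1]. The case [p = 1], without a finite conjugate exponent, is direct. *)
Lemma jensen_powR k g (c p : R) : 1 <= p -> 0 < c ->
  measurable_fun setT k -> measurable_fun setT g ->
  (forall t, 0 <= k t) -> (forall t, 0 <= g t) ->
  (\int[mu]_t (k t)%:E <= c%:E)%E ->
  ((\int[mu]_t (k t * g t)%:E) `^ p <= (c `^ (p - 1))%:E * \int[mu]_t (k t * g t `^ p)%:E)%E.
Proof.
move=> p1 c0 mk mg k0 g0 kc.
have p0 : 0 < p by exact: lt_le_trans p1.
have I0 : (0 <= \int[mu]_t (k t * g t)%:E)%E.
  by apply: integral_ge0 => t _; rewrite lee_fin mulr_ge0.
have [->|pn1] := eqVneq p 1.
  rewrite subrr powRr0 mul1e poweRe1//.
  by under [leRHS]eq_integral do rewrite powRr1//.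
have {}p1 : 1 < p by rewrite lt_neqAle eq_sym pn1.
have p10 : 0 < p - 1 by rewrite subr_gt0.
pose q := p / (p - 1); have q0 : 0 < q by rewrite divr_gt0.
have pq : p^-1 + q^-1 = 1.
  by rewrite /q invf_div -[X in X + _]mul1r -mulrDl addrC subrK divff// gt_eqF.
pose f1 t := k t `^ p^-1 * g t; pose f2 t := k t `^ q^-1.
have mf1 : measurable_fun setT f1 by apply: measurable_funM => //; exact: measurable_powR.
have mf2 : measurable_fun setT f2 by exact: measurable_powR.
have := hoelder mu mf1 mf2 p0 q0 pq.
have -> : ('N[mu]_1[EFin \o (f1 \* f2)%R] = \int[mu]_t (k t * g t)%:E)%E.
  rewrite Lnorm1; apply: eq_integral => t _.
  rewrite /= ger0_norm ?mulr_ge0 ?powR_ge0// /f1 /f2 mulrAC -powRD; last first.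
    by rewrite pq oner_eq0.
  by rewrite pq powRr1.
have -> : ('N[mu]_p%:E[EFin \o f1] = (\int[mu]_t (k t * g t `^ p)%:E) `^ p^-1)%E.
  rewrite unlock; congr (_ `^ _)%E; apply: eq_integral => t _.
  rewrite /= ger0_norm ?mulr_ge0 ?powR_ge0// /f1 powRM ?powR_ge0// -powRrM.
  by rewrite mulVf ?gt_eqF// powRr1.
have -> : ('N[mu]_q%:E[EFin \o f2] = (\int[mu]_t (k t)%:E) `^ q^-1)%E.
  rewrite unlock; congr (_ `^ _)%E; apply: eq_integral => t _.
  by rewrite /= ger0_norm ?powR_ge0// /f2 -powRrM mulVf ?gt_eqF// powRr1.
move=> H.
have J0 : (0 <= \int[mu]_t (k t * g t `^ p)%:E)%E.
  by apply: integral_ge0 => t _; rewrite lee_fin mulr_ge0// powR_ge0.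
apply: (@le_trans _ _ (((\int[mu]_t (k t * g t `^ p)%:E) `^ p^-1 * (c%:E `^ q^-1)) `^ p)%E).
  apply: le_poweR (ltW p0) I0 _.
  apply: (le_trans H); apply: lee_wpmul2l; first exact: poweR_ge0.
  apply: le_poweR kc; first by rewrite invr_ge0 ltW.
  by apply: integral_ge0 => t _; rewrite lee_fin.
rewrite poweRM ?poweR_ge0// -!poweRrM mulVf ?gt_eqF// poweRe1// muleC poweR_EFin.
by rewrite (_ : q^-1 * p = p - 1)// /q invf_div mulfVK// gt_eqF.
Qed.

Definition conv k g (t : R) : \bar R := (\int[mu]_s (k (t - s) * g s)%:E)%E.

Lemma ge0_integral_reflect (f : R -> \bar R) : measurable_fun setT f -> (forall t, 0 <= f t)%E ->
  (\int[mu]_s f (- s)%R = \int[mu]_s f s)%E.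
Proof.
move=> mf f0.
have mN : measurable_fun setT (-%R : measurableTypeR R -> measurableTypeR R) by [].
have := @ge0_integral_pushforward _ _ _ _ R _ mN mu setT f measurableT mf (fun y _ => f0 y).
rewrite preimage_setT /comp => <-.
by apply: eq_measure_integral => //= A mA _; exact/lebesgue_measureN.
Qed.

Lemma ge0_integral_translate (f : R -> \bar R) h : measurable_fun setT f -> (forall t, 0 <= f t)%E ->
  (\int[mu]_s f (s - h)%R = \int[mu]_s f s)%E.
Proof.
move=> mf f0; have := @ge0_integral_shift R h setT f measurableT mf (fun y _ => f0 y).
by rewrite preimage_setT.
Qed.

Lemma integral_kernel_l k t : measurable_fun setT k -> (forall t, 0 <= k t) ->
  (\int[mu]_s (k (t - s))%:E = \int[mu]_s (k s)%:E)%E.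
Proof.
move=> mk k0.
have mf : measurable_fun setT (fun s : R => (k (- s))%:E).
  by apply/measurable_EFinP; apply: measurableT_comp => //; exact: measurable_oppr.
rewrite -(@ge0_integral_reflect (fun s => (k s)%:E)); [|exact/measurable_EFinP|by move=> s; rewrite lee_fin].
rewrite -[RHS](@ge0_integral_translate _ t)//; last by move=> s; rewrite lee_fin.
by apply: eq_integral => s _; rewrite opprB.
Qed.

Let kernel k g (z : measurableTypeR R * measurableTypeR R) := (k (z.1 - z.2) * g z.2)%:E.

Let measurable_kernel k g : measurable_fun setT k -> measurable_fun setT g ->
  measurable_fun setT (kernel k g).
Proof.
move=> mk mg; apply/measurable_EFinP; apply: measurable_funM.
  by apply: (measurableT_comp mk); apply: measurable_funB; [exact: measurable_fst|exact: measurable_snd].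
by apply: (measurableT_comp mg); exact: measurable_snd.
Qed.

Lemma conv_ge0 k g t : (forall t, 0 <= k t) -> (forall t, 0 <= g t) -> (0 <= conv k g t)%E.
Proof. by move=> k0 g0; apply: integral_ge0 => s _; rewrite lee_fin mulr_ge0. Qed.

Lemma measurable_conv k g : measurable_fun setT k -> measurable_fun setT g ->
  (forall t, 0 <= k t) -> (forall t, 0 <= g t) -> measurable_fun setT (conv k g).
Proof.
move=> mk mg k0 g0.
apply: (@measurable_fun_fubini_tonelli_F _ _ (measurableTypeR R) (measurableTypeR R) R mu (kernel k g)).
  exact: measurable_kernel.
by move=> z; rewrite lee_fin mulr_ge0.
Qed.

Lemma integral_conv k g : measurable_fun setT k -> measurable_fun setT g ->
  (forall t, 0 <= k t) -> (forall t, 0 <= g t) ->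
  (\int[mu]_t conv k g t = \int[mu]_t (k t)%:E * \int[mu]_t (g t)%:E)%E.
Proof.
move=> mk mg k0 g0.
have kg0 z : (0 <= kernel k g z)%E by rewrite lee_fin mulr_ge0.
have := @fubini_tonelli _ _ (measurableTypeR R) (measurableTypeR R) R mu mu _ (measurable_kernel mk mg) kg0.
rewrite /conv /kernel/= => ->.
under eq_integral => s _.
  rewrite /=; under eq_integral => t _ do rewrite EFinM muleC.
  rewrite ge0_integralZl_EFin//; last 2 first.
  - by move=> t _; rewrite lee_fin.
  - apply/measurable_EFinP; apply: measurableT_comp => //.
    exact: measurable_funB.
  rewrite (@ge0_integral_translate (fun t => (k t)%:E) s); [|exact/measurable_EFinP|by move=> t; rewrite lee_fin].
  rewrite muleC; over.
rewrite ge0_integralZl//; first exact/measurable_EFinP.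
- by move=> t _; rewrite lee_fin.
- by apply: integral_ge0 => t _; rewrite lee_fin.
Qed.

Lemma conv_powR k g c p t : 1 <= p -> 0 < c ->
  measurable_fun setT k -> measurable_fun setT g ->
  (forall t, 0 <= k t) -> (forall t, 0 <= g t) ->
  (\int[mu]_t (k t)%:E <= c%:E)%E ->
  (conv k g t `^ p <= (c `^ (p - 1))%:E * conv k (fun s => (g s `^ p)%R) t)%E.
Proof.
move=> p1 c0 mk mg k0 g0 kc; apply: jensen_powR => //.
- by apply: measurableT_comp => //; exact: measurable_funB.
- by rewrite integral_kernel_l.
Qed.

(** Young's inequality: [conv_powR] is integrated by Tonelli, and the two powers of [c] combine into
    [c^(p-1) c = c^p]. *)
Lemma young_powR k g c p : 1 <= p -> 0 < c ->
  measurable_fun setT k -> measurable_fun setT g ->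
  (forall t, 0 <= k t) -> (forall t, 0 <= g t) ->
  (\int[mu]_t (k t)%:E <= c%:E)%E ->
  (\int[mu]_t (conv k g t `^ p)%E <= (c `^ p)%:E * \int[mu]_t (g t `^ p)%:E)%E.
Proof.
move=> p1 c0 mk mg k0 g0 kc.
have mgp : measurable_fun setT (fun t => g t `^ p) by exact: measurable_powR.
have gp0 t : 0 <= g t `^ p by exact: powR_ge0.
apply: (@le_trans _ _ (\int[mu]_t ((c `^ (p - 1))%:E * conv k (fun s => (g s `^ p)%R) t))%E).
  apply: (ae_ge0_le_integral (mu := mu)) => //.
  - by move=> t _; exact: poweR_ge0.
  - move=> t _; apply: mule_ge0; first by rewrite lee_fin powR_ge0.
    exact: conv_ge0.
  - by apply: aeW => t _; exact: conv_powR.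
rewrite ge0_integralZl//; last 3 first.
- exact: measurable_conv.
- by move=> t _; exact: conv_ge0.
- by rewrite lee_fin powR_ge0.
rewrite integral_conv// muleA.
apply: lee_wpmul2r; first by apply: integral_ge0 => t _; rewrite lee_fin.
rewrite -(mulr_powRB1 (ltW c0) (lt_le_trans ltr01 p1)) EFinM muleC.
by apply: lee_wpmul2r; rewrite ?lee_fin ?powR_ge0.
Qed.

End Convolution.

Section GeneralizedDominatedConvergence.
Context d (T : measurableType d) (R : realType).
Variables (mu : {measure set T -> \bar R}) (D : set T) (mD : measurable D).

(* Fatou's lemma for [F_ n - f n], as in the usual proof of dominated
   convergence but with a dominating function that depends on [n]. *)
Lemma generalized_dominated_cvg0 (f F_ : nat -> T -> R) (F : T -> R) :
  (forall n, measurable_fun D (f n)) -> (forall n, measurable_fun D (F_ n)) ->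
  measurable_fun D F ->
  (forall n t, D t -> 0 <= f n t) ->
  (forall n t, D t -> f n t <= F_ n t) -> (forall t, D t -> 0 <= F t) ->
  {ae mu, forall t, D t -> f n t @[n --> \oo] --> (0 : R)} ->
  {ae mu, forall t, D t -> F_ n t @[n --> \oo] --> F t} ->
  (\int[mu]_(t in D) (F t)%:E < +oo)%E ->
  (forall n, \int[mu]_(t in D) (F_ n t)%:E <= \int[mu]_(t in D) (F t)%:E)%E ->
  (\int[mu]_(t in D) (f n t)%:E)%E @[n --> \oo] --> 0%E.
Proof.
move=> mf mF_ mF f0 fF F0 f_cvg F_cvg Fy F_F.
have mfF n : measurable_fun D (fun t => (F_ n t - f n t)%:E).
  by apply/measurable_EFinP; apply: measurable_funB.
have fF0 n t : D t -> (0 <= (F_ n t - f n t)%:E)%E by move=> Dt; rewrite lee_fin subr_ge0 fF.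
have einfE (u : (\bar R)^nat) : limn_einf u = ereal_sup (range (einfs u)).
  by rewrite limn_einf_lim; apply/cvg_lim => //; exact: cvg_einfs_sup.
have fin (h : T -> R) : (forall t, D t -> 0 <= h t) -> (\int[mu]_(t in D) (h t)%:E < +oo)%E ->
    (\int[mu]_(t in D) (h t)%:E)%E \is a fin_num.
  by move=> h0 hy; rewrite ge0_fin_numE//; apply: integral_ge0 => t Dt; rewrite lee_fin h0.
have F_0 n t : D t -> 0 <= F_ n t by move=> Dt; exact: le_trans (f0 n t Dt) (fF n t Dt).
have IFn n : (\int[mu]_(t in D) (F_ n t)%:E < +oo)%E by exact: le_lt_trans Fy.
have IFfin := fin _ F0 Fy.
have H : (\int[mu]_(t in D) (F t)%:E <=
    ereal_sup (range (einfs (fun n => \int[mu]_(t in D) (F_ n t - f n t)%:E))))%E.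
  rewrite -einfE; apply: le_trans (fatou mu mD mfF fF0).
  apply: (ae_ge0_le_integral (mu := mu)) => //.
  - move=> t Dt; rewrite einfE; apply: le_trans (ereal_sup_ubound _); last by exists 0%N.
    by apply: le_ereal_inf_tmp => _ [n _ <-]; exact: fF0.
  - apply: filterS2 f_cvg F_cvg => t ft Ft Dt.
    have : (F_ n t - f n t)%:E @[n --> \oo] --> (F t)%:E.
      apply/cvg_EFin; first exact: nearW.
      by rewrite /comp/= -[X in _ --> X]subr0; apply: cvgB; [exact: Ft|exact: ft].
    by move=> /cvg_limn_einf_sup[-> _].
(* The lower limit is a supremum of tail infima, so on some tail the integral of [F_ n - f n] is at
   least that of [F] minus [e]. As the integral of [F_ n] is at most that of [F], at most [e] is
   left for [f n]. *)
have e_small e : 0 < e -> \forall n \near \oo, (\int[mu]_(t in D) (f n t)%:E <= e%:E)%E.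
  move=> e0; have : (\int[mu]_(t in D) (F t)%:E - e%:E < \int[mu]_(t in D) (F t)%:E)%E.
    by rewrite lteBlDr// lteDl.
  move=> /lt_le_trans/(_ H)/ereal_sup_gt[_ [N _ <-]] HN.
  near=> n.
  have Nn : (N <= n)%N by near: n; exists N.
  have {}HN : (\int[mu]_(t in D) (F t)%:E - e%:E <= \int[mu]_(t in D) (F_ n t - f n t)%:E)%E.
    apply: (le_trans (ltW HN)); apply: ereal_inf_lbound; by exists n.
  have := F_F n.
  have -> : (\int[mu]_(t in D) (F_ n t)%:E = \int[mu]_(t in D) (F_ n t - f n t)%:E + \int[mu]_(t in D) (f n t)%:E)%E.
    rewrite -ge0_integralD//; last 3 first.
    - by move=> t Dt; exact: fF0.
    - by move=> t Dt; rewrite lee_fin f0.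
    - exact/measurable_EFinP.
    by apply: eq_integral => t _; rewrite -EFinD subrK.
  move=> H2.
  have If : (\int[mu]_(t in D) (f n t)%:E)%E \is a fin_num.
    apply: fin; first exact: f0.
    apply: le_lt_trans (IFn n); apply: (ae_ge0_le_integral (mu := mu)) => //.
    - by move=> t Dt; rewrite lee_fin f0.
    - by move=> t Dt; rewrite lee_fin F_0.
    - by apply: aeW => t Dt; rewrite lee_fin fF.
  have : (\int[mu]_(t in D) (F t)%:E - e%:E + \int[mu]_(t in D) (f n t)%:E <= \int[mu]_(t in D) (F t)%:E)%E.
    by apply: le_trans H2; exact: leeD2r.
  by rewrite -(fineK IFfin) -(fineK If) -EFinB -EFinD !lee_fin; lra.
apply/ge0_cvge0P; last exact: e_small.
by move=> n; apply: integral_ge0 => t Dt; rewrite lee_fin f0.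
Unshelve. all: by end_near. Qed.

End GeneralizedDominatedConvergence.

Lemma continuous_expRM (R : realType) (l : R) : continuous (fun t : R => expR (l * t)).
Proof.
move=> t; apply: continuous_comp; last exact: continuous_expR.
by apply: cvgM; [exact: cvg_cst|exact: cvg_id].
Qed.

Section WithinRight.
Context (R : realType) (X : completeNormedModType R[i]).
Local Notation mu := (@lebesgue_measure R).

Lemma within_continuous_right (f : R -> X) t : 0 <= t ->
  {within `[0, +oo[, continuous f} -> f u @[u --> t^'+] --> f t.
Proof.
move=> t0 /within_continuous_vnormP/(_ t) H.
apply/vnorm_cvgP/cvgrPdist_lt => e e0.
have [|d d0 Hd] := H _ e e0; first by rewrite /= in_itv/= t0.
near=> u; have tu : t < u by near: u; exact: nbhs_right_gt.
rewrite sub0r normrN ger0_norm ?vnorm_ge0//; apply: Hd.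
  by rewrite /= in_itv/= andbT (le_trans t0 (ltW tu)).
rewrite /ball/= distrC ger0_norm ?subr_ge0 ?(ltW tu)// ltrBlDl.
by near: u; apply: nbhs_right_lt; rewrite ltrDl.
Unshelve. all: by end_near. Qed.

Lemma within_continuous_strongly_measurable (f : R -> X) :
  {within `[0, +oo[, continuous f} -> strongly_measurable mu `[0, +oo[ f.
Proof.
move=> cf; apply: right_continuous_strongly_measurable => //.
by move=> t; rewrite /= in_itv/= andbT => t0; exact: within_continuous_right.
Qed.

Lemma strongly_measurable_weight (f : R -> X) (l : R) : 0 <= l ->
  strongly_measurable mu `[0, +oo[ f ->
  strongly_measurable mu `[0, +oo[ (fun t => (expR (- l * t))%:C *: f t).
Proof.
move=> l0 smf.
apply: (@strongly_measurable_comp _ _ (fun t x => (expR (- l * t))%:C *: x) 1 `[0, +oo[ f) => //.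
- move=> t x y t0; rewrite -scalerBr vnormZr mul1r ger0_norm ?expR_ge0//.
  rewrite ler_piMl ?vnorm_ge0// -expR0 ler_expR mulNr oppr_le0 mulr_ge0//.
- move=> t x _; apply/vnorm_cvgP.
  have H : expR (- l * u) @[u --> t^'+] --> expR (- l * t).
    by apply: cvg_at_right_filter; exact: continuous_expRM.
  have -> : (fun u => vnorm ((expR (- l * u))%:C *: x - (expR (- l * t))%:C *: x)) =
     (fun u => `|expR (- l * u) - expR (- l * t)| * vnorm x).
    by apply/funext => u; rewrite -scalerBl -rmorphB vnormZr.
  rewrite -(mul0r (vnorm x)); apply: cvgM; last exact: cvg_cst.
  rewrite -(@normr0 _ R); apply: cvg_norm.
  by rewrite -(subrr (expR (- l * t))); apply: cvgB => //; exact: cvg_cst.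
Qed.

(** A kernel applied to the translated function. The kernel jumps at [t = h] but is right continuous
    there, as [strongly_measurable_comp] demands. *)
Lemma strongly_measurable_evolution_semigroup (U : R -> R -> {linear X -> X}) (M omega h : R) (f : R -> X) :
  evolution_family U -> growth_bound U M omega -> 0 <= h ->
  strongly_measurable mu `[0, +oo[ f ->
  strongly_measurable mu `[0, +oo[ (evolution_semigroup U h f).
Proof.
move=> Uev UM h0 smf.
have := @strongly_measurable_comp _ _ (fun t x => if h <= t then U t (t - h) x else 0)
   (M * expR (omega * h)) `[0, +oo[ _ (measurable_itv _) (@subset_refl _ _) _ _ (strongly_measurable_shift h0 smf).
move=> H; apply: (ae_strongly_measurable _ (H _ _)).
- apply: aeW => t _; rewrite /evolution_semigroup h0 /=.
  by case: (h <= t).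
- move=> t x y t0; case: ifPn => ht; last first.
    have := UM h 0; rewrite lexx h0/= => /(_ isT (x - y)); rewrite subr0 subrr vnorm0.
    by apply: le_trans; exact: vnorm_ge0.
  rewrite -linearB; have := UM t (t - h) _ (x - y).
  by rewrite subr_ge0 ht lerBlDr lerDl h0/= subKr => /(_ isT).
move=> t x _; have [th|ht] := ltP t h.
  apply: cvg_near_cst; near=> u; rewrite ifF//; apply/negbTE; rewrite -ltNge.
  by near: u; exact: nbhs_right_lt.
apply/vnorm_cvgP/cvgrPdist_lt => e e0.
have [|d d0 Hd] := @evolution_continuous _ _ _ Uev x t (t - h) e _ e0.
  by rewrite subr_ge0 ht lerBlDr lerDl.
near=> u; have tu : t < u by near: u; exact: nbhs_right_gt.
have ud : u - t < d.
  by rewrite ltrBlDl; near: u; apply: nbhs_right_lt; rewrite ltrDl.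
rewrite sub0r normrN ger0_norm ?vnorm_ge0// (le_trans ht (ltW tu)).
apply: Hd.
- by rewrite subr_ge0 (le_trans ht (ltW tu)) lerBlDr lerDl.
- by rewrite ger0_norm// subr_ge0 ltW.
- by rewrite opprB addrA subrK ger0_norm// subr_ge0 ltW.
Unshelve. all: by end_near. Qed.

End WithinRight.

(* The properties of L^p and C_00 used in the abstract argument. [W] is a larger
   class of functions on which [fnorm] is an extended seminorm: [E^h f] and
   products with unbounded trajectories are only known to lie there. *)
Record well_behaved (R : realType) (X : completeNormedModType R[i])
    (E : function_space X) (W : set (R -> X)) := WellBehaved {
  wb_carrier : forall f, fcarrier E f -> W f /\ (fnorm E f < +oo)%E;
  wb_fnorm_ge0 : forall f, (0 <= fnorm E f)%E;
  wb_carrierD : forall f g, fcarrier E f -> fcarrier E g -> fcarrier E (fun t => f t + g t);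
  wb_carrierZ : forall (c : R[i]) f, fcarrier E f -> fcarrier E (fun t => c *: f t);
  wb_carrier_weight : forall (l : R) f, 0 <= l -> fcarrier E f ->
    fcarrier E (fun t => (expR (- l * t))%:C *: f t);
  wb_D : forall f g, W f -> W g -> W (fun t => f t + g t);
  wb_Z : forall (c : R[i]) f, W f -> W (fun t => c *: f t);
  wb_weight : forall (l : R) f, 0 <= l -> W f -> W (fun t => (expR (- l * t))%:C *: f t);
  wb_continuous : forall f : R -> X, {within `[0, +oo[, continuous f} -> W f;
  wb_fnorm_mono : forall f g, (forall t, 0 <= t -> vnorm (f t) <= vnorm (g t)) ->
    (fnorm E f <= fnorm E g)%E;
  wb_fnormD : forall f g, W f -> W g ->
    (fnorm E (fun t => (f t + g t)%R) <= fnorm E f + fnorm E g)%E;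
  wb_fnormZ : forall (c : R[i]) f, W f ->
    (fnorm E (fun t => (c *: f t)%R) <= (complex.Re `|c|)%:E * fnorm E f)%E;
  wb_weight0 : forall (l : R) f, W f ->
    fnorm E (fun t => (expR (- l * t))%:C *: f t) = 0%E -> fnorm E f = 0%E;
  wb_semigroup : forall (U : R -> R -> {linear X -> X}) (M omega h : R) f,
    evolution_family U -> 1 <= M -> growth_bound U M omega -> 0 <= h -> W f ->
    W (evolution_semigroup U h f) /\
    (fnorm E (evolution_semigroup U h f) <= (M * expR (omega * h))%:E * fnorm E f)%E;
  wb_green : forall (U : R -> R -> {linear X -> X}) (M omega : R),
    evolution_family U -> 1 <= M -> omega < 0 -> growth_bound U M omega ->
    exists C : R, forall f, fcarrier E f -> fcarrier E (green U f) /\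
      (fnorm E (green U f) <= C%:E * fnorm E f)%E;
  wb_green_quotient : forall (U : R -> R -> {linear X -> X}) (M omega : R) f,
    evolution_family U -> 1 <= M -> omega < 0 -> growth_bound U M omega ->
    fcarrier E f ->
    fnorm E (fun t => (h^-1)%:C *: (green U f t - evolution_semigroup U h (green U f) t) - f t)
      @[h --> 0^'+] --> 0%E;
  wb_bump : forall (f : R -> X) (a b c : R), 0 <= a -> 1 <= b - a -> 0 <= c ->
    {within `[0, +oo[, continuous f} -> (forall t, 0 <= t -> (t <= a) || (b <= t) -> f t = 0) ->
    (forall t, a <= t <= b -> vnorm (f t) <= c) ->
    fcarrier E f /\ (fnorm E f <= (c * (b - a))%:E)%E;
  wb_decay : forall (f : R -> X) (c nu : R), 0 <= c -> 0 < nu ->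
    {within `[0, +oo[, continuous f} -> f 0 = 0 ->
    (forall t, 0 <= t -> vnorm (f t) <= c * expR (- nu * t)) -> fcarrier E f;
  wb_lower : forall (f : R -> X) (a c : R), 0 <= a -> 0 <= c ->
    (forall t, a <= t <= a + 1 -> c <= vnorm (f t)) -> (c%:E <= fnorm E f)%E
}.

(** * The space L^p *)

Section ExponentialKernel.
Context (R : realType).
Local Notation mu := (@lebesgue_measure R).

Lemma continuous_mexp (M omega : R) : continuous (fun t : R => M * expR (omega * t)).
Proof. by move=> t; apply: cvgM; [exact: cvg_cst|exact: continuous_expRM]. Qed.

(** The growth bound as a kernel on the whole line: convolving it with the norm of [f] majorizes
    [green U f]. *)
Definition exp_kernel (M omega : R) (t : R) : R := if 0 <= t then M * expR (omega * t) else 0.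

Lemma exp_kernel_ge0 (M omega t : R) : 0 <= M -> 0 <= exp_kernel M omega t.
Proof. by move=> M0; rewrite /exp_kernel; case: ifP => // _; rewrite mulr_ge0// expR_ge0. Qed.

Let exp_kernelE (M omega : R) : exp_kernel M omega = (fun t => M * expR (omega * t)) \_ `[0%R, +oo[%classic.
Proof. by apply/funext => t; rewrite /exp_kernel /patch mem_setE in_itv/= andbT. Qed.

Lemma measurable_exp_kernel (M omega : R) : measurable_fun setT (exp_kernel M omega).
Proof.
rewrite exp_kernelE; apply: (measurable_restrictT _ _).1; first exact: measurable_itv.
by apply: measurable_funTS; apply: continuous_measurable_fun; exact: continuous_mexp.
Qed.

Lemma integral_exp_kernel (M omega : R) : 0 <= M -> omega < 0 ->
  (\int[mu]_t (exp_kernel M omega t)%:E = (M / - omega)%:E)%E.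
Proof.
move=> M0 w0.
have -> : (\int[mu]_t (exp_kernel M omega t)%:E = \int[mu]_(t in `[0%R, +oo[%classic) (M * expR (omega * t))%:E)%E.
  rewrite [RHS]integral_mkcond; apply: eq_integral => t _; rewrite exp_kernelE /patch.
  by case: ifP.
pose F (t : R) := M / omega * expR (omega * t).
have dF (t : R) : is_derive t (1 : R) F (M * expR (omega * t)).
  rewrite /F; apply: is_derive_eq.
  by rewrite /= -![_ *: _]/(_ * _); field; rewrite lt_eqF.
rewrite (@ge0_continuous_FTC2y _ (fun t => M * expR (omega * t)) F 0 0).
- by rewrite /F mulr0 expR0 mulr1 -EFinB sub0r invrN mulrN.
- by move=> t _; rewrite mulr_ge0// expR_ge0.
- by apply: continuous_subspaceT; exact: continuous_mexp.
- rewrite /F -(mulr0 (M / omega)); apply: cvgM; first exact: cvg_cst.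
  apply/cvgrPdist_lt => e e0; near=> t.
  rewrite sub0r normrN ger0_norm ?expR_ge0// -[e](@lnK R)// ltr_expR -ltr_ndivrMl//.
  by near: t; apply: nbhs_pinfty_gt; exact: num_real.
- by move=> t _; apply: ex_derive.
- by apply: cvg_at_right_filter; exact: continuous_mexp.
- by move=> t _; rewrite derive1E derive_val.
Unshelve. all: by end_near. Qed.

End ExponentialKernel.

Section LpSpace.
Context (R : realType) (X : completeNormedModType R[i]) (p : R).
Hypothesis p1 : 1 <= p.
Local Notation mu := (@lebesgue_measure R).
Local Notation D0 := (`[0%R, +oo[%classic : set (measurableTypeR R)).
Implicit Types (f : R -> X) (g : R -> R).

Let p0 : 0 < p. Proof. exact: lt_le_trans p1. Qed.
Let pn0 : p != 0. Proof. by rewrite gt_eqF. Qed.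
Let mD0 : measurable D0. Proof. exact: measurable_itv. Qed.

Let D0E t : D0 t = (0 <= t) :> Prop.
Proof. by rewrite /= in_itv/= andbT. Qed.

Lemma Lp_norm_integral f :
  Lp_norm p f = ((\int[mu]_(t in D0) (vnorm (f t) `^ p)%:E) `^ p^-1)%E.
Proof.
rewrite /Lp_norm unlock; congr (_ `^ _)%E; rewrite [RHS]integral_mkcond.
apply: eq_integral => t _; rewrite /patch; case: ifPn => tD.
  by rewrite abse_EFin ger0_norm ?vnorm_ge0// poweR_EFin.
by rewrite abse0 poweR0r.
Qed.

Lemma Lp_norm_fin f : (Lp_norm p f < +oo)%E ->
  (\int[mu]_(t in D0) (vnorm (f t) `^ p)%:E < +oo)%E.
Proof. by rewrite Lp_norm_integral => /lty_poweRy; apply; rewrite invr_neq0. Qed.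

Let pint f : \bar R := (\int[mu]_(t in D0) (vnorm (f t) `^ p)%:E)%E.

Let pint_ge0 f : (0 <= pint f)%E.
Proof. by apply: integral_ge0 => t _; rewrite lee_fin powR_ge0. Qed.

Let Lp_normE f : Lp_norm p f = (pint f `^ p^-1)%E.
Proof. exact: Lp_norm_integral. Qed.

Let powR_half c (I : \bar R) : 0 <= c -> (0 <= I)%E -> (((c `^ p)%:E * I) `^ p^-1 = c%:E * I `^ p^-1)%E.
Proof.
move=> c0 I0; rewrite poweRM// ?lee_fin ?powR_ge0// poweR_EFin -powRrM divff// powRr1//.
Qed.

Let le_pint f (h : R -> R) : (forall t, 0 <= h t) ->
  {ae mu, forall t, 0 <= t -> vnorm (f t) <= h t} ->
  (pint f <= \int[mu]_(t in D0) (h t `^ p)%:E)%E.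
Proof.
move=> h0 fh; apply: (ae_ge0_le_integral (mu := mu)) => //.
- by move=> t _; rewrite lee_fin powR_ge0.
- by move=> t _; rewrite lee_fin powR_ge0.
apply: (aeS _ fh) => t fht; rewrite D0E => t0; rewrite lee_fin.
by apply: ge0_ler_powR; rewrite ?(ltW p0) ?nnegrE ?vnorm_ge0 ?h0// fht.
Qed.

Lemma Lp_integral_rep f g : (forall t, 0 <= g t) -> {ae mu, forall t, 0 <= t -> vnorm (f t) = g t} ->
  (\int[mu]_(t in D0) (vnorm (f t) `^ p)%:E = \int[mu]_(t in D0) (g t `^ p)%:E)%E.
Proof.
move=> g0 fg; apply: (ae_ge0_eq_integral (mu := mu)) => //.
- by move=> t _; rewrite lee_fin powR_ge0.
- by move=> t _; rewrite lee_fin powR_ge0.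
by apply: (aeS _ fg) => t fgt; rewrite D0E => t0; rewrite fgt.
Qed.

Let pintE f g (g0 : forall t, 0 <= g t) (fg : {ae mu, forall t, 0 <= t -> vnorm (f t) = g t}) :
  pint f = (\int[mu]_(t in D0) (g t `^ p)%:E)%E := Lp_integral_rep g0 fg.

Lemma integral_powR_right g : (forall t, t < 0 -> g t = 0) ->
  (\int[mu]_(t in D0) (g t `^ p)%:E = \int[mu]_t (g t `^ p)%:E)%E.
Proof.
move=> gn; rewrite [LHS]integral_mkcond; apply: eq_integral => t _; rewrite /patch.
case: ifPn => // /negP tD; rewrite gn ?powR0//.
by rewrite ltNge; apply/negP => t0; apply: tD; rewrite inE D0E.
Qed.

Let le_Lp_norm_pint (c : R) f (I : \bar R) : 0 <= c -> (0 <= I)%E ->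
  (pint f <= (c `^ p)%:E * I)%E -> (Lp_norm p f <= c%:E * I `^ p^-1)%E.
Proof.
move=> c0 I0 fI; rewrite Lp_normE -powR_half//.
by apply: le_poweR => //; rewrite invr_ge0 ltW.
Qed.

Lemma le_Lp_norm (c : R) f1 f2 : 0 <= c -> strongly_measurable mu D0 f2 ->
  {ae mu, forall t, 0 <= t -> vnorm (f1 t) <= c * vnorm (f2 t)} ->
  (Lp_norm p f1 <= c%:E * Lp_norm p f2)%E.
Proof.
move=> c0 sm2 f12; rewrite [Lp_norm p f2]Lp_normE; apply: le_Lp_norm_pint => //.
have [g [mg g0 gn fg]] := ae_vnorm_measurable sm2.
rewrite (pintE g0 fg).
apply: (le_trans (le_pint (h := fun t => c * g t) _ _)).
- by move=> t; rewrite mulr_ge0.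
- by apply: (aeS2 _ f12 fg) => t H1 H2 t0; rewrite -H2// H1.
under eq_integral do rewrite powRM// EFinM.
rewrite ge0_integralZl_EFin ?powR_ge0//.
- by move=> t _; rewrite lee_fin powR_ge0.
- by apply/measurable_EFinP; apply: measurable_funTS; exact: measurable_powR.
Qed.

Lemma Lp_norm_mono f1 f2 : {ae mu, forall t, 0 <= t -> vnorm (f1 t) <= vnorm (f2 t)} ->
  (Lp_norm p f1 <= Lp_norm p f2)%E.
Proof.
move=> f12; rewrite !Lp_normE; apply: le_poweR => //; first by rewrite invr_ge0 ltW.
by apply: le_pint => // t; exact: vnorm_ge0.
Qed.

Let Lnorm_rep f g : (forall t, 0 <= g t) -> (forall t, t < 0 -> g t = 0) ->
  {ae mu, forall t, 0 <= t -> vnorm (f t) = g t} ->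
  'N[mu]_p%:E[EFin \o g]%E = Lp_norm p f.
Proof.
move=> g0 gn fg; rewrite (Lp_normE f) (pintE g0 fg) (integral_powR_right gn).
have -> : 'N[mu]_p%:E[EFin \o g]%E = ((\int[mu]_t `|(EFin \o g) t| `^ p) `^ p^-1)%E by rewrite unlock.
congr (_ `^ _)%E; apply: eq_integral => t _.
by rewrite /= ger0_norm.
Qed.

Lemma Lp_normD f1 f2 : strongly_measurable mu D0 f1 -> strongly_measurable mu D0 f2 ->
  (Lp_norm p (fun t => (f1 t + f2 t)%R) <= Lp_norm p f1 + Lp_norm p f2)%E.
Proof.
move=> sm1 sm2.
have [g1 [mg1 g10 g1n fg1]] := ae_vnorm_measurable sm1.
have [g2 [mg2 g20 g2n fg2]] := ae_vnorm_measurable sm2.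
have := minkowski_EFin mu mg1 mg2 p1.
rewrite (Lnorm_rep g10 g1n fg1) (Lnorm_rep g20 g2n fg2); apply: le_trans.
have g0 t : 0 <= (g1 \+ g2)%R t by rewrite /= addr_ge0.
have gn t : t < 0 -> (g1 \+ g2)%R t = 0 by move=> t0; rewrite /= g1n// g2n// addr0.
have -> : 'N[mu]_p%:E[EFin \o (g1 \+ g2)%R]%E = ((\int[mu]_(t in D0) ((g1 \+ g2)%R t `^ p)%:E) `^ p^-1)%E.
  rewrite (integral_powR_right gn).
  have -> : 'N[mu]_p%:E[EFin \o (g1 \+ g2)%R]%E = ((\int[mu]_t `|(EFin \o (g1 \+ g2)%R) t| `^ p) `^ p^-1)%E by rewrite unlock.
  congr (_ `^ _)%E; apply: eq_integral => t _.
  by have := g0 t; rewrite /= => g0t; rewrite ger0_norm.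
rewrite Lp_normE; apply: le_poweR => //; first by rewrite invr_ge0 ltW.
apply: le_pint => //.
apply: (aeS2 _ fg1 fg2) => t H1 H2 t0 /=; rewrite -H1// -H2//; exact: ler_vnormD.
Qed.

Lemma ae_shift (P : R -> Prop) (h : R) : {ae mu, forall t, P t} -> {ae mu, forall t, P (t - h)}.
Proof.
move=> [N [mN N0 PN]]; exists (shift_fun h @^-1` N); split.
- exact: measurable_shift.
- exact: (etrans (lebesgue_measure_shift h mN) N0).
- by move=> t /= nP; exact: PN.
Qed.

Lemma Lp_norm_evolution_semigroup (U : R -> R -> {linear X -> X}) (M omega h : R) f :
  1 <= M -> growth_bound U M omega -> 0 <= h ->
  strongly_measurable mu D0 f ->
  (Lp_norm p (evolution_semigroup U h f) <= (M * expR (omega * h))%:E * Lp_norm p f)%E.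
Proof.
move=> M1 UM h0 smf.
have M0 : 0 <= M by exact: le_trans M1.
have C0 : 0 <= M * expR (omega * h) by rewrite mulr_ge0// expR_ge0.
rewrite [Lp_norm p f]Lp_normE; apply: le_Lp_norm_pint => //.
have [g [mg g0 gn fg]] := ae_vnorm_measurable smf.
rewrite (pintE g0 fg) integral_powR_right//.
apply: (le_trans (le_pint (h := fun t => M * expR (omega * h) * g (t - h)) _ _)).
- by move=> t; rewrite mulr_ge0.
- apply: (aeS _ (ae_shift h fg)) => t H t0; rewrite /evolution_semigroup h0/=.
  case: ifPn => ht; last by rewrite vnorm0 mulr_ge0.
  have th : 0 <= t - h by rewrite subr_ge0.
  rewrite -H//; have := UM t (t - h) _ (f (t - h)).
  by rewrite th lerBlDr lerDl h0/= subKr => /(_ isT).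
under eq_integral do rewrite powRM// EFinM.
have mgp : measurable_fun setT (fun t : R => (g (t - h) `^ p)%:E).
  apply/measurable_EFinP; apply: (measurableT_comp (f := fun t => g t `^ p)); first exact: measurable_powR.
  exact: measurable_shift_fun.
rewrite ge0_integralZl_EFin ?powR_ge0//; last 2 first.
- by move=> t _; rewrite lee_fin powR_ge0.
- exact: measurable_funTS.
apply: lee_wpmul2l; first by rewrite lee_fin powR_ge0.
rewrite -(@ge0_integral_translate _ (fun t => (g t `^ p)%:E) h); last 2 first.
- by apply/measurable_EFinP; exact: measurable_powR.
- by move=> t; rewrite lee_fin powR_ge0.
apply: ge0_subset_integral => //.
by move=> t _; rewrite lee_fin powR_ge0.
Qed.

Let mem_itv0T (T : R) : measurable (`[0%R, T]%classic : set (measurableTypeR R)).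
Proof. exact: measurable_itv. Qed.

(** Local integrability from [jensen_powR] with the indicator of [[0, T]] as [k]. *)
Lemma Lp_locally_bochner f : fcarrier (Lp_space X p) f -> locally_bochner f.
Proof.
move=> [smf /Lp_norm_fin fy]; split => // T T0.
have [g [mg g0 gn fg]] := ae_vnorm_measurable smf.
pose k : R -> R := \1_(`[0%R, T]%classic : set (measurableTypeR R)).
have mk : measurable_fun setT k by exact: measurable_indic.
have k0 t : 0 <= k t by rewrite /k indicE.
(* [T + 1], because the constant has to be positive and [T] may be 0. *)
have kT : (\int[mu]_t (k t)%:E <= (T + 1)%:E)%E.
  rewrite integral_indic//= setIT lebesgue_measure_itv/= lte_fin; case: ifPn => _.
    by rewrite -EFinB lee_fin subr0 lerDl.
  by rewrite lee_fin addr_ge0.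
have T10 : 0 < T + 1 by rewrite ltr_wpDl.
have := jensen_powR p1 T10 mk mg k0 g0 kT.
have E : (\int[mu]_(t in `[0%R, T]%classic) (vnorm (f t))%:E = \int[mu]_t (k t * g t)%:E)%E.
  rewrite [LHS]integral_mkcond; apply: (ae_ge0_eq_integral (mu := mu)) => //.
  - by move=> t _; rewrite erestrict_ge0// => s _; rewrite lee_fin vnorm_ge0.
  - by move=> t _; rewrite lee_fin mulr_ge0.
  apply: (aeS _ fg) => t fgt _; rewrite /patch /k indicE; case: ifPn => tT.
    by rewrite mul1r fgt//; move: tT; rewrite inE/= in_itv/= => /andP[].
  by rewrite mul0r.
rewrite -E => H; apply: (@lty_poweRy _ _ p) => //; apply: le_lt_trans H _.
rewrite lte_mul_pinfty ?lee_fin ?powR_ge0//.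
apply: le_lt_trans fy; rewrite -/(pint f) (pintE g0 fg) integral_powR_right//.
apply: (ae_ge0_le_integral (mu := mu)) => //.
- by move=> t _; rewrite lee_fin mulr_ge0// powR_ge0.
- by move=> t _; rewrite lee_fin powR_ge0.
apply: aeW => t _; rewrite lee_fin ler_piMl ?powR_ge0// /k indicE.
by case: (_ \in _).
Qed.

(** Young's inequality with [exp_kernel], whose total mass is [M / - omega]. *)
Lemma Lp_green (U : R -> R -> {linear X -> X}) (M omega : R) f :
  evolution_family U -> 1 <= M -> omega < 0 -> growth_bound U M omega ->
  fcarrier (Lp_space X p) f -> fcarrier (Lp_space X p) (green U f) /\
  (Lp_norm p (green U f) <= (M / - omega)%:E * Lp_norm p f)%E.
Proof.
move=> Uev M1 w0 UM cf; have lbf := Lp_locally_bochner cf; have [smf fy] := cf.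
suff H : (Lp_norm p (green U f) <= (M / - omega)%:E * Lp_norm p f)%E.
  split => //; split; last first.
    apply: (le_lt_trans H); rewrite lte_mul_pinfty// lee_fin divr_ge0 ?(le_trans ler01 M1)//.
    by rewrite oppr_ge0 ltW.
  by apply: within_continuous_strongly_measurable; exact: (green_continuous Uev M1 UM).
have [g [mg g0 gn fg]] := ae_vnorm_measurable smf.
have M0 : 0 < M by exact: lt_le_trans M1.
have c0 : 0 < M / - omega by rewrite divr_gt0// oppr_gt0.
rewrite [Lp_norm p f]Lp_normE; apply: le_Lp_norm_pint => //; first exact: ltW.
rewrite (pintE g0 fg) integral_powR_right//.
have mk := measurable_exp_kernel M omega.
have k0 t := exp_kernel_ge0 omega t (ltW M0).
have kc : (\int[mu]_t (exp_kernel M omega t)%:E <= (M / - omega)%:E)%E.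
  by rewrite integral_exp_kernel// ltW.
apply: le_trans (young_powR p1 c0 mk mg k0 g0 kc).
apply: (ae_ge0_le_integral_subset (mu := mu)) => //.
- by move=> t _; rewrite lee_fin powR_ge0.
- by move=> t _; exact: poweR_ge0.
apply: aeW => t; rewrite D0E => t0.
rewrite -poweR_EFin; apply: le_poweR; rewrite ?(ltW p0) ?lee_fin ?vnorm_ge0//.
have tt : `[0%R, t]%classic `<=` (`[0%R, t]%classic : set (measurableTypeR R)) by [].
apply: le_trans (le_vnorm_green_on Uev M1 UM t0 (mem_itv0T t) tt lbf g0 fg) _.
apply: (ae_ge0_le_integral_subset (mu := mu)) => //.
- by move=> s _; rewrite lee_fin !mulr_ge0 ?expR_ge0// ltW.
- by move=> s _; rewrite lee_fin mulr_ge0.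
apply: aeW => s /=; rewrite in_itv/= => /andP[s0 st].
by rewrite /exp_kernel subr_ge0 st.
Qed.

(** Since [1 <= b - a], the factor [(b - a)^(1/p)] is at most [b - a]; this gives one bound for all
    [p], valid for the sup norm as well. *)
Lemma Lp_bump f (a b c : R) : 0 <= a -> 1 <= b - a -> 0 <= c ->
  {within `[0, +oo[, continuous f} -> (forall t, 0 <= t -> (t <= a) || (b <= t) -> f t = 0) ->
  (forall t, a <= t <= b -> vnorm (f t) <= c) ->
  fcarrier (Lp_space X p) f /\ (Lp_norm p f <= (c * (b - a))%:E)%E.
Proof.
move=> a0 ab c0 cf f0 fc.
have smf := within_continuous_strongly_measurable cf.
suff H : (Lp_norm p f <= (c * (b - a))%:E)%E.
  by split => //; split => //; rewrite (le_lt_trans H)// ltry.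
have mab : measurable (`[a, b]%classic : set (measurableTypeR R)) by exact: measurable_itv.
have muab : mu `[a, b]%classic = (b - a)%:E.
  by rewrite lebesgue_measure_itv/= lte_fin -subr_gt0 (lt_le_trans ltr01 ab) -EFinB.
apply: (@le_trans _ _ (c%:E * (b - a)%:E `^ p^-1)%E).
  apply: le_Lp_norm_pint => //; first by rewrite lee_fin (le_trans ler01).
  rewrite -muab -integral_cst// /pint [leLHS]integral_mkcond [leRHS]integral_mkcond.
  apply: (ae_ge0_le_integral (mu := mu)) => //.
  - by move=> t _; rewrite erestrict_ge0// => s _; rewrite lee_fin powR_ge0.
  - by move=> t _; rewrite erestrict_ge0// => s _; rewrite lee_fin powR_ge0.
  apply: aeW => t _; rewrite /patch; case: ifPn => [|_]; last first.
    by case: ifP => // _; rewrite lee_fin powR_ge0.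
  rewrite inE D0E => t0; case: ifPn => [|]; rewrite mem_setE in_itv/=.
    move=> tab; rewrite lee_fin; apply: ge0_ler_powR; rewrite ?(ltW p0) ?nnegrE ?vnorm_ge0//.
    exact: fc.
  rewrite negb_and -!ltNge => tab; rewrite f0 ?vnorm0 ?powR0//.
  by case/orP : tab => /ltW ->; rewrite ?orbT.
rewrite poweR_EFin -EFinM lee_fin ler_wpM2l//.
by apply: ler1_powR => //; rewrite invf_le1.
Qed.

Lemma Lp_decay f (c nu : R) : 0 <= c -> 0 < nu ->
  {within `[0, +oo[, continuous f} ->
  (forall t, 0 <= t -> vnorm (f t) <= c * expR (- nu * t)) -> fcarrier (Lp_space X p) f.
Proof.
move=> c0 nu0 cf fc; split; first exact: within_continuous_strongly_measurable.
rewrite Lp_normE; apply: poweR_lty.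
have ce t : 0 <= c * expR (- nu * t) by rewrite mulr_ge0 ?expR_ge0.
apply: (le_lt_trans (le_pint ce _)); first exact: aeW.
have nup : - (nu * p) < 0 by rewrite oppr_lt0 mulr_gt0.
apply: (@le_lt_trans _ _ (\int[mu]_t (exp_kernel (c `^ p) (- (nu * p)) t)%:E)%E); last first.
  by rewrite integral_exp_kernel ?powR_ge0// ltry.
apply: (ae_ge0_le_integral_subset (mu := mu)) => //.
- by move=> t _; rewrite lee_fin powR_ge0.
- by move=> t _; rewrite lee_fin exp_kernel_ge0// powR_ge0.
apply: aeW => t; rewrite D0E => t0; rewrite lee_fin /exp_kernel t0 powRM ?expR_ge0// -expRM.
by rewrite mulrAC mulNr.
Qed.

Lemma Lp_lower f (a c : R) : 0 <= a -> 0 <= c ->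
  (forall t, a <= t <= a + 1 -> c <= vnorm (f t)) -> (c%:E <= Lp_norm p f)%E.
Proof.
move=> a0 c0 fc.
have mab : measurable (`[a, a + 1]%classic : set (measurableTypeR R)) by exact: measurable_itv.
have muab : mu `[a, a + 1]%classic = 1%E.
  by rewrite lebesgue_measure_itv/= lte_fin ltrDl ltr01 -EFinB addrC addKr.
rewrite -[c](@powRr1 R)// -(divff pn0) powRrM -poweR_EFin Lp_normE.
apply: le_poweR; rewrite ?invr_ge0 ?(ltW p0) ?lee_fin ?powR_ge0//.
rewrite -[leLHS]mule1 -muab -integral_cst// .
apply: (ae_ge0_le_integral_subset (mu := mu)) => //.
- by move=> t /=; rewrite !in_itv/= andbT => /andP[at_ _]; exact: le_trans at_.
- by move=> t _; rewrite lee_fin powR_ge0.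
- by move=> t _; rewrite lee_fin powR_ge0.
apply: aeW => t /=; rewrite in_itv/= => tab.
by rewrite lee_fin; apply: ge0_ler_powR; rewrite ?(ltW p0) ?nnegrE ?vnorm_ge0// fc.
Qed.

Lemma Lp_weight0 (l : R) f : strongly_measurable mu D0 f ->
  Lp_norm p (fun t => (expR (- l * t))%:C *: f t) = 0%E -> Lp_norm p f = 0%E.
Proof.
move=> smf; have [g [mg g0 gn fg]] := ae_vnorm_measurable smf.
rewrite !Lp_normE => H.
have H0 : pint (fun t => (expR (- l * t))%:C *: f t) = 0%E.
  by apply: (poweR_eq0_eq0 _ H).
move: H0; rewrite (pintE (g := fun t => expR (- l * t) * g t)); last 2 first.
- by move=> t; rewrite mulr_ge0// expR_ge0.
- by apply: (aeS _ fg) => t fgt t0; rewrite vnormZr fgt// ger0_norm// expR_ge0.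
have mh : measurable_fun D0 (fun t => ((expR (- l * t) * g t) `^ p)%:E).
  apply/measurable_EFinP; apply: measurable_funTS; apply: measurable_powR; apply: measurable_funM => //.
  by apply: continuous_measurable_fun; exact: continuous_expRM.
move=> H0.
have : (\int[mu]_(t in D0) `| ((expR (- l * t) * g t) `^ p)%:E | = 0)%E.
  by rewrite -[RHS]H0; apply: eq_integral => t _; rewrite abse_EFin ger0_norm// powR_ge0.
move=> /(ae_eq_integral_abs mu mD0 mh) h0.
have -> : pint f = 0%E.
  rewrite -(integral0 mu D0); apply: (ae_ge0_eq_integral (mu := mu)) => //.
    by move=> t _; rewrite lee_fin powR_ge0.
  apply: (aeS2 _ h0 fg) => t ht fgt tD; have t0 : 0 <= t by move: tD; rewrite D0E.
  have [] := ht tD => /powR_eq0_eq0/eqP; rewrite mulf_eq0 expR_eq0/= => /eqP gt0.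
  by rewrite fgt// gt0 powR0.
by rewrite poweR0r// invr_neq0.
Qed.

End LpSpace.

(** * Lebesgue points and the difference quotient in L^p *)

Section LeftAverages.
Context (R : realType).
Local Notation mu := (@lebesgue_measure R).
Variable h : nat -> R.
Hypotheses (h_gt0 : forall n, 0 < h n) (h_cvg0 : h n @[n --> \oo] --> (0 : R)).

Lemma lebesgue_pt_left_average (phi : R -> R) t : locally_integrable setT phi ->
  lebesgue_pt phi t ->
  ((h n)^-1%:E * \int[mu]_(s in `](t - h n)%R, t]%classic) (phi s)%:E)%E @[n --> \oo] --> (phi t)%:E.
Proof.
move=> lphi tphi; pose E (x : R) n : set R := `](x - h n), x]%classic.
have muE x n : mu (E x n) = (h n)%:E.
  rewrite lebesgue_measure_itv/= lte_fin gtrBl h_gt0 -EFinB.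
  by rewrite opprB addrC subrK.
have nE x : nicely_shrinking x (E x).
  split=> [n|]; first exact: measurable_itv.
  have h20 n : 0 < 2 * h n by rewrite mulr_gt0.
  (* The interval lies in the ball of radius [2 * h n], which has 4 times its measure. *)
  exists (4, fun n => PosNum (h20 n)); split => //=.
  - by rewrite -(mulr0 2); apply: cvgM => //; exact: cvg_cst.
  - move=> n s; rewrite /E/= in_itv/= => /andP[xs sx]; rewrite /ball/= ger0_norm ?subr_ge0//.
    by have := h_gt0 n; lra.
  - by move=> n; rewrite muE lebesgue_measure_ball ?(ltW (h20 n))// lee_fin; have := h_gt0 n; lra.
have := nice_lebesgue_differentiation nE lphi tphi.
apply: cvg_trans; apply: near_eq_cvg; apply: nearW => n /=.
by rewrite muE inver gt_eqF.
Qed.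

End LeftAverages.

Section LebesguePoints.
Context (R : realType) (X : completeNormedModType R[i]).
Local Notation mu := (@lebesgue_measure R).
Local Notation D0 := (`[0%R, +oo[%classic : set (measurableTypeR R)).

(** A countable family of vectors that comes close to the values of a measurable function: it lets
    one null set serve for all the scalar functions [vnorm (f t - y n k)]. *)
Lemma simple_values_countable (s : nat -> R -> X) : (forall n, simple_on mu D0 (s n)) ->
  exists y : nat -> nat -> X, forall n t, D0 t -> exists k, s n t = y n k.
Proof.
move=> ss.
have /choice[l lP] n : exists l : seq X, s n @` D0 = [set` l].
  by apply/finite_seqP; have [] := ss n.
exists (fun n => nth 0 (l n)) => n t Dt; exists (index (s n t) (l n)); rewrite nth_index//.
suff: [set` l n] (s n t) by [].
by rewrite -lP; exists t.
Qed.

Lemma locally_integrable_dist (f : R -> X) y : approximable mu D0 f -> locally_bochner f ->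
  locally_integrable setT ((fun t => vnorm (f t - y)) \_ D0).
Proof.
move=> fap [smf fy].
have mD0 : measurable D0 by exact: measurable_itv.
split; last 2 first; first exact: openT.
- move=> K _ cK.
  have [M [_ /(_ (Num.max M 0 + 1))]] := compact_bounded cK.
  rewrite ltr_pwDr// ?le_max ?lexx// => /(_ isT) KM.
  set T := Num.max M 0 + 1 in KM.
  have T0 : 0 <= T by rewrite addr_ge0// le_max lexx orbT.
  have mT : measurable (`[0%R, T]%classic : set (measurableTypeR R)) by exact: measurable_itv.
  have muT : mu `[0%R, T]%classic = T%:E.
    rewrite lebesgue_measure_itv/= lte_fin; case: ltgtP T0 => // [T0 _|<- _]//.
    by rewrite -EFinB subr0.
  apply: (@le_lt_trans _ _ (\int[mu]_(t in `[0%R, T]%classic) (vnorm (f t))%:E +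
      \int[mu]_(t in `[0%R, T]%classic) (vnorm y)%:E)%E); last first.
    by rewrite lte_add_pinfty// ?fy// integral_cst//= muT -EFinM ltry.
  rewrite -ge0_integralD//; last 3 first.
  + by move=> t _; rewrite lee_fin vnorm_ge0.
  + apply/measurable_EFinP; apply: measurable_funS (approximable_measurable fap) => //.
    by move=> t /=; rewrite !in_itv/= => /andP[->].
  + by move=> t _; rewrite lee_fin vnorm_ge0.
  rewrite [leRHS]integral_mkcond [leLHS]integral_mkcond; apply: (ae_ge0_le_integral (mu := mu)) => //.
  + by move=> t _; rewrite erestrict_ge0// => s _; rewrite lee_fin.
  + by move=> t _; rewrite erestrict_ge0// => s _; rewrite adde_ge0// lee_fin vnorm_ge0.
  apply: aeW => t _; rewrite /patch; case: ifPn => [|_]; last first.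
    by case: ifP => // _; rewrite adde_ge0// lee_fin vnorm_ge0.
  rewrite inE => /KM tT; case: ifPn => [tD|tD]; last first.
    rewrite normr0; case: ifP => // _; by rewrite adde_ge0// lee_fin vnorm_ge0.
  move: tD; rewrite inE/= in_itv/= andbT => t0.
  rewrite ifT; last by rewrite inE/= in_itv/= t0/= (le_trans (ler_norm t)).
  by rewrite ger0_norm ?vnorm_ge0// -EFinD lee_fin ler_vnormB.
- apply: (measurable_restrictT (fun t : measurableTypeR R => vnorm (f t - y)) mD0).1.
  exact: approximable_measurable_dist fap.
Qed.

(** Vector-valued Lebesgue points by reduction to scalars: almost every [t] is a Lebesgue point of
    [vnorm (f' - y n k)] for all [n] and [k], and some [y n k] is as close to [f' t] as desired. *)
Lemma green_quotient_ae_cvg (U : R -> R -> {linear X -> X}) (M omega : R) (f : R -> X) (h : nat -> R) :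
  evolution_family U -> 1 <= M -> growth_bound U M omega -> locally_bochner f ->
  (forall n, 0 < h n) -> h n @[n --> \oo] --> (0 : R) ->
  {ae mu, forall t, 0 < t ->
    vnorm ((h n)^-1%:C *: (green U f t - evolution_semigroup U (h n) (green U f) t) - f t)
      @[n --> \oo] --> (0 : R)}.
Proof.
move=> Uev M1 UM lbf h0 hcvg; have [smf _] := lbf.
have mD0 : measurable D0 by exact: measurable_itv.
have [f' fap ff'] := strongly_measurable_approximable (mu := mu) mD0 smf.
have lbf' : locally_bochner f'.
  split; first exact: approximable_strongly_measurable.
  move=> T T0; apply: le_lt_trans (lbf.2 T T0).
  apply: (ae_ge0_le_integral (mu := mu)) => //; try by move=> t _; rewrite lee_fin vnorm_ge0.
  by apply: (aeS _ ff') => t ft /=; rewrite in_itv/= => /andP[t0 _]; rewrite ft// /= in_itv/= t0.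
have [s [ss sf]] := fap; have [y yP] := simple_values_countable ss.
pose phi x := (fun t => vnorm (f' t - x)) \_ D0.
have lphi x : locally_integrable setT (phi x) by exact: locally_integrable_dist.
have : {ae mu, forall t, forall n k, lebesgue_pt (phi (y n k)) t}.
  apply: ae_foralln => n; apply: ae_foralln => k.
  exact: lebesgue_differentiation.
move=> Lpt; apply: (aeS2 _ ff' Lpt) => t ft {}Lpt t0.
have D0t : D0 t by rewrite /= in_itv/= andbT ltW.
have {}ft := ft D0t.
pose C := M * expR (`|omega| * t).
have C0 : 0 < C by rewrite mulr_gt0 ?expR_gt0// (lt_le_trans ltr01).
apply/cvgrPdist_le => e e0.
(* The integrand is at most [C * phi x u + (C * d + d)] and the average of [phi x] at most [2 * d],
   for a total of [(3 * C + 1) * d]. *)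
pose d := e / (3 * C + 1).
have C1 : 0 < 3 * C + 1 by rewrite ltr_wpDl// mulr_ge0// ltW.
have d0 : 0 < d by rewrite divr_gt0.
have [n nd] : exists n, vnorm (f' t - s n t) <= d.
  have /vnorm_cvgP/cvgrPdist_le/(_ d d0) := sf t D0t.
  case=> N _ /(_ N (leqnn N)); rewrite sub0r normrN ger0_norm ?vnorm_ge0// => H.
  by exists N; rewrite -vnormN opprB.
have [k snk] := yP n t D0t; set x := y n k in snk.
have phi0 u : 0 <= phi x u by rewrite /phi /patch; case: ifP => // _; exact: vnorm_ge0.
have Cd0 : 0 <= C * d + d by exact: addr_ge0 (mulr_ge0 (ltW C0) (ltW d0)) (ltW d0).
have := lebesgue_pt_left_average h0 hcvg (lphi x) (Lpt n k).
move=> /fine_cvgP[avfin /cvgrPdist_le/(_ d d0) av].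
have [d1 d10 Hd1] : exists2 d1, 0 < d1 & forall u, 0 <= u <= t -> `|u - t| < d1 -> vnorm (U t u (f t) - f t) < d.
  have := @evolution_continuous _ _ _ Uev (f t) t t d _ d0.
  rewrite lexx (ltW t0) => /(_ isT) [d1 d10 Hd1]; exists d1 => // u ut ud.
  have := Hd1 t u ut; rewrite subrr normr0 => /(_ d10 ud).
  by rewrite (evolution_id Uev _ (ltW t0)).
near=> m.
have hm0 := h0 m.
have hmt : h m <= t.
  near: m; exact: (cvgr_le _ hcvg).
have hmd : h m < d1.
  near: m; exact: (cvgr_lt _ hcvg).
rewrite sub0r normrN ger0_norm ?vnorm_ge0//.
have mA : measurable (`](t - h m)%R, t]%classic : set (measurableTypeR R)) by exact: measurable_itv.
have A0 : `](t - h m)%R, t]%classic `<=` D0.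
  move=> u /=; rewrite !in_itv/= andbT => /andP[/ltW tu _]; apply: le_trans tu.
  by rewrite subr_ge0.
have muA : mu `](t - h m)%R, t]%classic = (h m)%:E.
  rewrite lebesgue_measure_itv/= lte_fin gtrBl hm0 -EFinB.
  by rewrite opprB addrC subrK.
have avm : (\int[mu]_(u in `](t - h m)%R, t]%classic) (phi x u)%:E <= (h m * (2 * d))%:E)%E.
  rewrite EFinM -lee_pdivrMl//.
  have fin : ((h m)^-1%:E * \int[mu]_(u in `](t - h m)%R, t]%classic) (phi x u)%:E)%E \is a fin_num.
    by near: m.
  rewrite -(fineK fin) lee_fin.
  have : `|phi x t - fine ((h m)^-1%:E * \int[mu]_(u in `](t - h m)%R, t]%classic) (phi x u)%:E)%E| <= d.
    by near: m.
  rewrite ler_norml => /andP[H _].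
  have : phi x t <= d by rewrite /phi /patch mem_set// -snk.
  by move: H; set z := fine _; lra.
rewrite -lee_fin; apply: (le_trans (green_quotient_dist Uev M1 UM (f t) hm0 hmt lbf)).
apply: (@le_trans _ _ ((h m)^-1%:E * \int[mu]_(u in `](t - h m)%R, t]%classic) (C%:E * (phi x u)%:E + (C * d + d)%:E))%E).
  apply: lee_wpmul2l; first by rewrite lee_fin invr_ge0 ltW.
  apply: (ae_ge0_le_integral (mu := mu)) => //.
  - by move=> u _; rewrite lee_fin vnorm_ge0.
  - by move=> u _; rewrite -EFinM -EFinD lee_fin; exact: addr_ge0 (mulr_ge0 (ltW C0) (phi0 _)) Cd0.
  apply: (aeS _ ff') => u fu uA; have Du := A0 u uA.
  rewrite -EFinM -EFinD lee_fin /phi /patch mem_set// fu//.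
  have /andP[u1 u2] : t - h m < u <= t by move: uA; rewrite /= in_itv.
  have u0 : 0 <= u by move: Du; rewrite /= in_itv/= andbT.
  have H1 : vnorm (U t u (f' u - f t)) <= C * vnorm (f' u - f t).
    by apply: (growth_bound_le M1 UM); rewrite ?u0.
  have H2 : vnorm (U t u (f t) - f t) <= d.
    apply/ltW/Hd1; first by rewrite u0.
    by rewrite distrC ger0_norm ?subr_ge0//; move: u1 hmd; lra.
  have H3 : vnorm (f' u - f t) <= vnorm (f' u - x) + d.
    have -> : f' u - f t = (f' u - x) + (x - f' t) by rewrite ft addrA subrK.
    by apply: (le_trans (ler_vnormD _ _)); rewrite lerD2l -snk -vnormN opprB.
  have -> : U t u (f' u) - f t = U t u (f' u - f t) + (U t u (f t) - f t).
    by rewrite linearB addrA subrK.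
  apply: (le_trans (ler_vnormD _ _)); rewrite addrA lerD//.
  by apply: (le_trans H1); rewrite -mulrDr ler_wpM2l// ltW.
rewrite ge0_integralD//; last 2 first.
- by move=> u _; rewrite -EFinM lee_fin; exact: mulr_ge0 (ltW C0) (phi0 _).
- apply/measurable_EFinP; apply: measurable_funM => //.
  by apply: measurable_funTS; have [] := lphi x.
rewrite ge0_integralZl_EFin ?(ltW C0)//; last 2 first.
- by move=> u _; rewrite lee_fin.
- by apply/measurable_EFinP; apply: measurable_funTS; have [] := lphi x.
have -> : (\int[mu]_(u in `](t - h m)%R, t]%classic) (C * d + d)%:E = ((C * d + d) * h m)%:E)%E.
  by rewrite integral_cst// EFinM; congr (_ * _)%E.
rewrite lee_pdivrMl//.
apply: (@le_trans _ _ (C%:E * (h m * (2 * d))%:E + ((C * d + d) * h m)%:E)%E).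
  by rewrite leeD2r// lee_wpmul2l// lee_fin ltW.
rewrite -!EFinM -EFinD lee_fin.
have -> : e = d * (3 * C + 1) by rewrite /d mulfVK// gt_eqF.
by rewrite le_eqVlt; apply/orP; left; apply/eqP; ring.
Unshelve. all: by end_near. Qed.

End LebesguePoints.

Section LpQuotient.
Context (R : realType) (X : completeNormedModType R[i]) (p : R).
Hypothesis p1 : 1 <= p.
Local Notation mu := (@lebesgue_measure R).
Local Notation D0 := (`[0%R, +oo[%classic : set (measurableTypeR R)).

Let p0 : 0 < p. Proof. exact: lt_le_trans p1. Qed.
Let mD0 : measurable D0. Proof. exact: measurable_itv. Qed.

Lemma strongly_measurableZ (c : R[i]) (f : R -> X) : strongly_measurable mu D0 f ->
  strongly_measurable mu D0 (fun t => c *: f t).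
Proof.
move=> smf; apply: (@strongly_measurable_comp _ _ (fun _ x => c *: x) (complex.Re `|c|)) => //.
- by move=> t x y _; rewrite -scalerBr vnormZ.
- by move=> t x _; exact: cvg_cst.
Qed.

(** Convolution with it is the average over []t - h, t]]; hence the side on which the interval is
    open. *)
Definition box_kernel (h t : R) : R := h^-1 * \1_`[0%R, h[%classic t.

Lemma box_kernel_ge0 h t : 0 < h -> 0 <= box_kernel h t.
Proof. by move=> h0; rewrite mulr_ge0 ?invr_ge0 ?(ltW h0). Qed.

Lemma measurable_box_kernel h : measurable_fun setT (box_kernel h).
Proof. by apply: measurable_funM => //; apply: measurable_indic; exact: measurable_itv. Qed.

Lemma integral_box_kernel h : 0 < h -> (\int[mu]_t (box_kernel h t)%:E = 1)%E.
Proof.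
move=> h0; under eq_integral do rewrite EFinM.
rewrite ge0_integralZl_EFin ?invr_ge0 ?(ltW h0)//; last first.
  by apply/measurable_EFinP; apply: measurable_indic; exact: measurable_itv.
rewrite integral_indic//= setIT; have := lebesgue_measure_itv `[0%R, h[; rewrite /= lte_fin h0 => ->.
by rewrite oppr0 adde0 -EFinM mulVf// gt_eqF.
Qed.

Let box_reflect (h t s : R) : (t - s \in `[0%R, h[%classic) = (s \in `](t - h)%R, t]%classic).
Proof. by rewrite !mem_setE !in_itv/= subr_ge0 ltrBlDr -ltrBlDl andbC. Qed.

Lemma conv_box_kernel h (g : R -> R) t : 0 < h -> measurable_fun setT g -> (forall s, 0 <= g s) ->
  (conv (box_kernel h) g t = (h^-1)%:E * \int[mu]_(s in `](t - h)%R, t]%classic) (g s)%:E)%E.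
Proof.
move=> h0 mg g0; rewrite /conv -ge0_integralZl_EFin ?invr_ge0 ?(ltW h0)//; last 2 first.
- by move=> s _; rewrite lee_fin.
- by apply/measurable_EFinP; exact: measurable_funTS.
rewrite [RHS]integral_mkcond; apply: eq_integral => s _.
rewrite /box_kernel indicE /patch box_reflect; case: ifPn => _.
  by rewrite mulr1 EFinM.
by rewrite mulr0 mul0r.
Qed.

Lemma powR_add_le (a b : R) : 0 <= a -> 0 <= b -> (a + b) `^ p <= 2 `^ p * (a `^ p + b `^ p).
Proof.
wlog ab : a b / a <= b => [H a0 b0|a0 b0].
  have [ab|/ltW ba] := leP a b; first exact: H.
  by rewrite addrC [a `^ p + _]addrC; exact: H.
apply: (@le_trans _ _ ((2 * b) `^ p)).
  by apply: ge0_ler_powR; rewrite ?(ltW p0) ?nnegrE ?addr_ge0 ?mulr_ge0//; lra.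
by rewrite powRM// ler_wpM2l ?powR_ge0// lerDr powR_ge0.
Qed.

(** Inside the boundary layer too, the integral runs over a subset of []t - h, t]]; the exponential
    factor is at most 1 because [omega < 0]. *)
Let le_green_quotient (U : R -> R -> {linear X -> X}) (M omega : R) (f : R -> X) (g : R -> R) h t :
  evolution_family U -> 1 <= M -> omega < 0 -> growth_bound U M omega -> locally_bochner f ->
  measurable_fun setT g -> (forall t, 0 <= g t) ->
  {ae mu, forall t, 0 <= t -> vnorm (f t) = g t} ->
  0 < h -> 0 <= t ->
  ((vnorm (h^-1%:C *: (green U f t - evolution_semigroup U h (green U f) t)))%:E
    <= M%:E * conv (box_kernel h) g t)%E.
Proof.
move=> Uev M1 w0 UM lbf mg g0 fg h0 t0.
have M0 : 0 < M by exact: lt_le_trans M1.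
have [D [mD Dt Dh ->]] : exists D : set (measurableTypeR R), [/\ measurable D, D `<=` `[0, t],
    D `<=` `](t - h), t] &
    green U f t - evolution_semigroup U h (green U f) t = green_on U D f t].
  have [ht|th] := leP h t.
    exists `](t - h), t]%classic; split => //.
    - move=> s /=; rewrite !in_itv/= => /andP[/ltW ts ->]; rewrite andbT; apply: le_trans ts.
      by rewrite subr_ge0.
    - exact: (green_increment Uev M1 UM h0 ht lbf).
  exists `[0, t]%classic; split => //.
  - move=> s /=; rewrite !in_itv/= => /andP[s0 ->]; rewrite andbT.
    by apply: lt_le_trans s0; rewrite subr_lt0.
  - exact: green_increment_lt.
rewrite vnormZr ger0_norm ?invr_ge0 ?(ltW h0)// EFinM conv_box_kernel// muleCA.
apply: lee_wpmul2l; first by rewrite lee_fin invr_ge0 ltW.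
apply: (le_trans (le_vnorm_green_on Uev M1 UM t0 mD Dt lbf g0 fg)).
rewrite -ge0_integralZl_EFin ?(ltW M0)//; last 2 first.
- by move=> s _; rewrite lee_fin.
- by apply/measurable_EFinP; exact: measurable_funTS.
apply: (ae_ge0_le_integral_subset (mu := mu)) => //.
- by move=> s _; rewrite lee_fin !mulr_ge0 ?expR_ge0// ltW.
- by move=> s _; rewrite -EFinM lee_fin mulr_ge0// ltW.
apply: aeW => s Ds.
rewrite -EFinM lee_fin ler_wpM2r// ler_piMr// ?(ltW M0)// -expR0 ler_expR.
have := Dt _ Ds; rewrite /= in_itv/= => /andP[_ st].
by rewrite nmulr_rle0// subr_ge0.
Qed.

Lemma Lp_green_quotient (U : R -> R -> {linear X -> X}) (M omega : R) (f : R -> X) :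
  evolution_family U -> 1 <= M -> omega < 0 -> growth_bound U M omega ->
  fcarrier (Lp_space X p) f ->
  Lp_norm p (fun t => (h^-1)%:C *: (green U f t - evolution_semigroup U h (green U f) t) - f t)
      @[h --> 0^'+] --> 0%E.
Proof.
move=> Uev M1 w0 UM cf; have lbf := Lp_locally_bochner p1 cf; have [smf /(Lp_norm_fin p1) fy] := cf.
have M0 : 0 < M by exact: lt_le_trans M1.
apply/cvge_at_rightP => h [h0 hcvg].
pose Q n t := ((h n)^-1)%:C *: (green U f t - evolution_semigroup U (h n) (green U f) t) - f t.
have smQ n : strongly_measurable mu D0 (Q n).
  have smG : strongly_measurable mu D0 (green U f).
    by apply: within_continuous_strongly_measurable; exact: (green_continuous Uev M1 UM).
  rewrite [Q n](_ : _ = fun t => ((h n)^-1)%:C *: (green U f t + (-1) *: evolution_semigroup U (h n) (green U f) t) + (-1) *: f t); last first.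
    by apply/funext => t; rewrite !scaleN1r.
  apply: strongly_measurableD; last exact: strongly_measurableZ.
  apply: strongly_measurableZ; apply: strongly_measurableD => //.
  apply: strongly_measurableZ; apply: strongly_measurable_evolution_semigroup Uev UM _ smG.
  exact: ltW.
have [g [mg g0 gn fg]] := ae_vnorm_measurable smf.
have /choice[q qP] n : exists q : R -> R, [/\ measurable_fun setT q, forall t, 0 <= q t,
    forall t, t < 0 -> q t = 0 & {ae mu, forall t, 0 <= t -> vnorm (Q n t) = q t}].
  exact: ae_vnorm_measurable (smQ n).
pose gp t := g t `^ p.
have gp0 t : 0 <= gp t by exact: powR_ge0.
have mgp : measurable_fun setT gp by exact: measurable_powR.
have gpy : (\int[mu]_t (gp t)%:E < +oo)%E.
  apply: le_lt_trans fy; rewrite (Lp_integral_rep p g0 fg) (integral_powR_right p1 gn)//.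
pose K n := box_kernel (h n).
have K0 n t : 0 <= K n t by exact: box_kernel_ge0.
have mK n : measurable_fun setT (K n) by exact: measurable_box_kernel.
have lgp : locally_integrable setT gp.
  apply: open_integrable_locally; first exact: openT.
  apply/integrableP; split; first exact/measurable_EFinP.
  by under eq_integral do rewrite /= ger0_norm//.
have convy n t : conv (K n) gp t \is a fin_num.
  rewrite ge0_fin_numE ?conv_ge0// conv_box_kernel//.
  apply: lte_mul_pinfty; [by rewrite lee_fin invr_ge0 ltW|by []|].
  apply: le_lt_trans gpy; apply: ge0_subset_integral => //.
  - exact/measurable_EFinP.
  - by move=> s _; rewrite lee_fin.
(* Majorant of the [p]-th power of [vnorm (Q n t)], by [le_green_quotient] and [conv_powR]. It
   depends on [n], but it tends to [F] at the Lebesgue points of [gp] and has the integral of [F],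
   because the box kernel has mass 1. *)
pose Fn n t := 2 `^ p * (M `^ p * fine (conv (K n) gp t) + gp t).
pose F t := 2 `^ p * (M `^ p * gp t + gp t).
have Mp0 : 0 <= M `^ p by exact: powR_ge0.
have twop0 : 0 <= 2 `^ p :> R by exact: powR_ge0.
have convf0 n t : 0 <= fine (conv (K n) gp t) by rewrite fine_ge0// conv_ge0.
have Fn0 n t : 0 <= Fn n t by rewrite /Fn mulr_ge0// addr_ge0// mulr_ge0.
have F0 t : 0 <= F t by rewrite /F mulr_ge0// addr_ge0// mulr_ge0.
have mconv n : measurable_fun setT (fun t => fine (conv (K n) gp t)).
  by apply: measurableT_comp => //; exact: measurable_conv.
(* The minimum is measurable and below [Fn] everywhere, and agrees almost everywhere on the
   half-line with the power of [vnorm (Q n t)]. *)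
pose fn n t := Num.min (q n t `^ p) (Fn n t).
have intF (a : R -> R) : measurable_fun setT a -> (forall t, 0 <= a t) ->
    (\int[mu]_t (2 `^ p * (M `^ p * a t + gp t))%:E =
     (2 `^ p)%:E * ((M `^ p)%:E * \int[mu]_t (a t)%:E + \int[mu]_t (gp t)%:E))%E.
  move=> ma a0; have Ma0 t : 0 <= M `^ p * a t by rewrite mulr_ge0.
  have mMa : measurable_fun setT (fun t => M `^ p * a t) by exact: measurable_funM.
  under eq_integral do rewrite EFinM.
  rewrite ge0_integralZl_EFin//; last 2 first.
  - by move=> t _; rewrite lee_fin addr_ge0.
  - by apply/measurable_EFinP; exact: measurable_funD.
  under eq_integral do rewrite EFinD.
  rewrite ge0_integralD//; last 4 first.
  - by move=> t _; rewrite lee_fin.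
  - exact/measurable_EFinP.
  - by move=> t _; rewrite lee_fin.
  - exact/measurable_EFinP.
  under eq_integral do rewrite EFinM.
  rewrite ge0_integralZl_EFin//.
  - by move=> t _; rewrite lee_fin.
  - exact/measurable_EFinP.
have QF n : {ae mu, forall t, 0 <= t -> vnorm (Q n t) `^ p = fn n t}.
  have [mq q0 qn Qq] := qP n.
  apply: (aeS2 _ Qq fg) => t Qt ft t0; rewrite /fn -Qt//; apply/esym/min_idPl.
  have H := le_green_quotient Uev M1 w0 UM lbf mg g0 fg (h0 n) t0.
  set a := vnorm _ in H.
  apply: (@le_trans _ _ ((a + g t) `^ p)).
    apply: ge0_ler_powR; rewrite ?(ltW p0) ?nnegrE ?vnorm_ge0 ?addr_ge0 ?vnorm_ge0//.
    by rewrite -ft//; exact: ler_vnormB.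
  apply: (le_trans (powR_add_le (vnorm_ge0 _) (g0 t))).
  rewrite ler_wpM2l// lerD2r -lee_fin EFinM fineK// -poweR_EFin.
  apply: (@le_trans _ _ ((M%:E * conv (K n) g t) `^ p)%E).
    by apply: le_poweR; rewrite ?(ltW p0) ?lee_fin ?vnorm_ge0.
  rewrite poweRM ?lee_fin ?(ltW M0) ?conv_ge0// poweR_EFin lee_wpmul2l ?lee_fin//.
  have k1 : (\int[mu]_t (K n t)%:E <= 1%:E)%E by rewrite integral_box_kernel.
  apply: (le_trans (conv_powR t p1 ltr01 (mK n) mg (K0 n) g0 k1)).
  by rewrite powR1 mul1e.
(* The pointwise convergence is only available for [t > 0]. *)
have neq0 : {ae mu, forall t : R, t != 0}.
  exists [set 0]; split; [exact: measurable_set1|exact: lebesgue_measure_set1|].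
  by move=> t /= /negP; rewrite negbK => /eqP.
have fn_cvg : {ae mu, forall t, setT t -> fn n t @[n --> \oo] --> (0 : R)}.
  have H1 := green_quotient_ae_cvg Uev M1 UM lbf h0 hcvg.
  have H2 : {ae mu, forall t, forall n, 0 <= t -> vnorm (Q n t) `^ p = fn n t}.
    by apply: ae_foralln => n; exact: QF.
  have H3 := aeS2 (fun t => @conj _ _) neq0 H1.
  apply: (aeS2 _ H2 H3) => t {}H2 [tn0 {}H1] _.
  have [t0|t0] := ltP t 0.
    apply: cvg_near_cst; apply: nearW => n; have [_ _ qn _] := qP n.
    by rewrite /fn qn// powR0 ?gt_eqF//; apply/min_idPl.
  have {}H1 := H1 _; rewrite lt_def tn0 t0 in H1.
  apply/cvgrPdist_le => e e0.
  have ep : 0 < e `^ p^-1 by exact: powR_gt0.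
  have /cvgrPdist_le/(_ _ ep) := H1 isT; apply: filterS => n.
  rewrite !sub0r !normrN -H2// ger0_norm ?vnorm_ge0// ger0_norm ?powR_ge0// => Qe.
  rewrite -[leRHS](@powRr1 R)// ?(ltW e0)// -(@mulVf _ p) ?gt_eqF// powRrM.
  by apply: ge0_ler_powR; rewrite ?(ltW p0) ?nnegrE ?vnorm_ge0 ?powR_ge0.
have Fn_cvg : {ae mu, forall t, setT t -> Fn n t @[n --> \oo] --> F t}.
  apply: (aeS _ (lebesgue_differentiation lgp)) => t Lt _.
  have H := lebesgue_pt_left_average h0 hcvg lgp Lt.
  apply: cvgM; first exact: cvg_cst.
  apply: cvgD; last exact: cvg_cst.
  apply: cvgM; first exact: cvg_cst.
  apply: fine_cvg; apply: cvg_trans H; apply: near_eq_cvg; apply: nearW => n.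
  by rewrite conv_box_kernel.
have fn0 n t : 0 <= fn n t by rewrite /fn le_min powR_ge0 Fn0.
have mfn n : measurable_fun setT (fn n).
  apply: measurable_minr; first by apply: measurable_powR; have [] := qP n.
  apply: measurable_funM => //; apply: measurable_funD => //.
  exact: measurable_funM.
have mFn n : measurable_fun setT (Fn n).
  by apply: measurable_funM => //; apply: measurable_funD => //; exact: measurable_funM.
have mF : measurable_fun setT F.
  by apply: measurable_funM => //; apply: measurable_funD => //; exact: measurable_funM.
have H : (\int[mu]_(t in setT) (fn n t)%:E)%E @[n --> \oo] --> 0%E.
  apply: (@generalized_dominated_cvg0 _ (measurableTypeR R) R mu setT measurableT fn Fn F mfn mFn mF) => //.
  - by move=> n t _; rewrite /fn ge_min lexx orbT.
  - rewrite intF// lte_mul_pinfty ?lee_fin// lte_add_pinfty// lte_mul_pinfty ?lee_fin//.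
  move=> n; rewrite /Fn /F !intF//.
  have -> : (\int[mu]_t (fine (conv (K n) gp t))%:E = \int[mu]_t (gp t)%:E)%E.
    under eq_integral do rewrite fineK//.
    by rewrite integral_conv// integral_box_kernel// mul1e.
  by [].
apply/ge0_cvge0P => [n|e e0].
  by rewrite Lp_norm_integral//; exact: poweR_ge0.
have ep : 0 < e `^ p by exact: powR_gt0.
have I0 n : (0 <= \int[mu]_(t in setT) (fn n t)%:E)%E.
  by apply: integral_ge0 => t _; rewrite lee_fin; exact: fn0.
have : \forall n \near \oo, (\int[mu]_(t in setT) (fn n t)%:E <= (e `^ p)%:E)%E.
  exact: (@ge0_cvge0P _ _ \oo _ _ I0).1 H _ ep.
apply: filterS => n Hn.
rewrite Lp_norm_integral//.
have -> : e%:E = ((e `^ p)%:E `^ p^-1)%E.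
  by rewrite poweR_EFin -powRrM divff ?gt_eqF// powRr1// ltW.
apply: le_poweR; first by rewrite invr_ge0 ltW.
  by apply: integral_ge0 => t _; rewrite lee_fin powR_ge0.
apply: le_trans Hn; apply: (ae_ge0_le_integral_subset (mu := mu)) => //.
- by move=> t _; rewrite lee_fin powR_ge0.
- by move=> t _; rewrite lee_fin; exact: fn0.
by apply: (aeS _ (QF n)) => t Qt; rewrite /= in_itv/= andbT => t0; rewrite lee_fin -Qt.
Qed.

End LpQuotient.

Lemma Lp_well_behaved (R : realType) (X : completeNormedModType R[i]) (p : R) : 1 <= p ->
  well_behaved (Lp_space X p) (strongly_measurable (@lebesgue_measure R) `[0, +oo[).
Proof.
move=> p1.
have re_ge0 := @Re_normc_ge0 R.
have norm_ge0 (f : R -> X) : (0 <= Lp_norm p f)%E.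
  by rewrite Lp_norm_integral//; exact: poweR_ge0.
have normZ (c : R[i]) (f : R -> X) : strongly_measurable lebesgue_measure `[0, +oo[ f ->
    (Lp_norm p (fun t => (c *: f t)%R) <= (complex.Re `|c|)%:E * Lp_norm p f)%E.
  by move=> smf; apply: le_Lp_norm => //; apply: aeW => t _; rewrite vnormZ.
split => //=.
- move=> f g [smf fy] [smg gy]; split; first exact: strongly_measurableD.
  by rewrite (le_lt_trans (Lp_normD p1 smf smg))// lte_add_pinfty.
- move=> c f [smf fy]; split; first exact: strongly_measurableZ.
  by rewrite (le_lt_trans (normZ c f smf))// lte_mul_pinfty// lee_fin.
- move=> l f l0 [smf fy]; split; first exact: strongly_measurable_weight.
  apply: le_lt_trans fy; apply: Lp_norm_mono => //; apply: aeW => t t0.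
  rewrite vnormZr ger0_norm ?expR_ge0// ler_piMl ?vnorm_ge0// -expR0 ler_expR.
  by rewrite mulNr oppr_le0 mulr_ge0.
- by move=> f g; exact: strongly_measurableD.
- by move=> c f; exact: strongly_measurableZ.
- by move=> l f; exact: strongly_measurable_weight.
- by move=> f; exact: within_continuous_strongly_measurable.
- by move=> f g fg; apply: Lp_norm_mono => //; exact: aeW.
- by move=> f g; exact: Lp_normD.
- by move=> l f; exact: Lp_weight0.
- move=> U M omega h f Uev M1 UM h0 smf; split; last exact: Lp_norm_evolution_semigroup.
  exact: strongly_measurable_evolution_semigroup Uev UM h0 smf.
- by move=> U M omega Uev M1 w0 UM; exists (M / - omega) => f; exact: Lp_green.
- by move=> U M omega f; exact: Lp_green_quotient.
- by move=> f a b c; exact: Lp_bump.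
- by move=> f c nu c0 nu0 cf _; exact: Lp_decay.
- by move=> f a c; exact: Lp_lower.
Qed.

(** * The space C_00 *)

Section VanishingFunctions.
Context (R : realType) (X : completeNormedModType R[i]).
Local Notation mu := (@lebesgue_measure R).
Local Notation D0 := (`[0%R, +oo[%classic : set (measurableTypeR R)).
Implicit Types (f : R -> X).

Let D0E t : D0 t = (0 <= t) :> Prop.
Proof. by rewrite /= in_itv/= andbT. Qed.

Lemma within_continuousZ (S : topologicalType) (A : set S) (phi : S -> R[i]) (f : S -> X) :
  (forall t, A t -> complex.Re `|phi u - phi t| @[u --> within A (nbhs t)] --> (0 : R)) ->
  {within A, continuous f} -> {within A, continuous (fun t => phi t *: f t)}.
Proof.
move=> cphi /subspace_continuousP cf; apply/subspace_continuousP => t At.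
have /vnorm_cvgP ft := cf t At; have pt := cphi t At.
apply: (@cvg_squeeze_vnorm _ _ _ _ _ _ _ (fun u => (complex.Re `|phi t| + complex.Re `|phi u - phi t|) *
    vnorm (f u - f t) + complex.Re `|phi u - phi t| * vnorm (f t))).
  apply: nearW => u.
  have -> : phi u *: f u - phi t *: f t = phi u *: (f u - f t) + (phi u - phi t) *: f t.
    by rewrite scalerBr scalerBl addrA subrK.
  rewrite (le_trans (ler_vnormD _ _))// !vnormZ lerD2r ler_wpM2r ?vnorm_ge0//.
  have := @ler_vnormD R (R[i])^o (phi t) (phi u - phi t).
  by rewrite addrC subrK.
rewrite -[X in _ --> X](addr0 0); apply: cvgD.
  rewrite -[X in _ --> X](mulr0 (complex.Re `|phi t| + 0)); apply: cvgM => //.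
  by apply: cvgD => //; exact: cvg_cst.
by rewrite -[X in _ --> X](mul0r (vnorm (f t))); apply: cvgM; [exact: pt|exact: cvg_cst].
Qed.

Lemma within_continuousZr (A : set R) (phi : R -> R) f : continuous phi ->
  {within A, continuous f} -> {within A, continuous (fun t => (phi t)%:C *: f t)}.
Proof.
move=> cphi; apply: within_continuousZ => t _.
rewrite [X in X @ _ --> _](_ : _ = fun u => `|phi u - phi t|); last first.
  by apply/funext => u; rewrite -rmorphB Re_normc_real.
rewrite -[X in _ --> X](@normr0 _ R); apply: cvg_norm.
rewrite -[X in _ --> X](subrr (phi t)); apply: cvgB; last exact: cvg_cst.
by apply: cvg_within_filter; exact: cphi.
Qed.

Local Notation E := (C00_space X).

Let fnorm_ub f t : 0 <= t -> ((vnorm (f t))%:E <= fnorm E f)%E.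
Proof. by move=> t0; apply: ereal_sup_ubound; exists t => //; rewrite D0E. Qed.

Let fnorm_le f (c : \bar R) : (forall t, 0 <= t -> ((vnorm (f t))%:E <= c)%E) -> (fnorm E f <= c)%E.
Proof.
by move=> H; apply: ge_ereal_sup => _ [t + <-]; rewrite D0E => t0; exact: H.
Qed.

Let fnorm_ge0 f : (0 <= fnorm E f)%E.
Proof. by apply: (le_trans _ (fnorm_ub f (lexx 0))); rewrite lee_fin vnorm_ge0. Qed.

Lemma C00_vnorm_cvg f e : fcarrier E f -> 0 < e -> \forall t \near +oo, vnorm (f t) < e.
Proof.
move=> [_ /vnorm_cvgP/cvgrPdist_lt fy _] /fy; apply: filterS => t.
by rewrite subr0 sub0r normrN ger0_norm// vnorm_ge0.
Qed.

Lemma C00_small f e : fcarrier E f -> 0 < e ->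
  exists2 T, 0 <= T & forall t, T <= t -> vnorm (f t) <= e.
Proof.
move=> cf e0; have [M [_ HM]] := C00_vnorm_cvg cf e0.
exists (Num.max 0 (M + 1)) => [|t]; first by rewrite le_max lexx.
by rewrite ge_max => /andP[_ Mt]; apply/ltW/HM; rewrite (lt_le_trans _ Mt)// ltrDl.
Qed.

Lemma C00_bounded f : fcarrier E f ->
  exists2 S, 0 <= S & forall t, 0 <= t -> vnorm (f t) <= S.
Proof.
move=> cf; have [cont _ _] := cf; have [T T0 HT] := C00_small cf ltr01.
suff [S HS] : exists S, forall t, 0 <= t <= T -> vnorm (f t) <= S.
  exists (Num.max 1 S) => [|t t0]; first by rewrite le_max ler01.
  have [tT|Tt] := leP t T; first by rewrite le_max HS ?orbT// t0.
  by rewrite le_max HT// ltW.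
(* Compactness in covering form: a bound valid near each point for all large [S] is valid on the
   segment for all large [S]. *)
have /compact_near_coveringP/(_ R +oo (fun S t => 0 <= t -> vnorm (f t) <= S) _) := @segment_compact R 0 T.
case=> [t _|M [_ HM]].
  have [t0|t0] := leP 0 t; last first.
    near=> u S => u0; exfalso.
    suff : u < 0 by rewrite ltNge u0.
    by near: u; exact: lt_nbhsl.
  move/within_continuous_vnormP : cont => /(_ t _ 1 ltr01)[|d d0 Hd]; first by rewrite D0E.
  near=> u S => u0.
  have H : vnorm (f u - f t) < 1.
    apply: Hd; first by rewrite D0E.
    by near: u; exact: nbhsx_ballx.
  apply: (@le_trans _ _ (vnorm (f t) + 1)).
    by rewrite -[f u](subrK (f t)) addrC (le_trans (ler_vnormD _ _))// lerD2l ltW.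
  rewrite /=; near: S; apply: nbhs_pinfty_ge; exact: num_real.
exists (M + 1) => t tT; apply: (HM (M + 1)); rewrite ?ltrDl//.
by case/andP : tT.
Unshelve. all: by end_near. Qed.

Lemma C00_locally_bochner f : fcarrier E f -> locally_bochner f.
Proof.
move=> cf; split; first by apply: within_continuous_strongly_measurable; have [] := cf.
move=> T T0; have [S S0 HS] := C00_bounded cf.
have mT : measurable (`[0%R, T]%classic : set (measurableTypeR R)) by exact: measurable_itv.
apply: (@le_lt_trans _ _ (\int[mu]_(t in `[0%R, T]%classic) S%:E)%E).
  apply: (ae_ge0_le_integral (mu := mu)) => //.
    by move=> t _; rewrite lee_fin vnorm_ge0.
  by apply: aeW => t /=; rewrite in_itv/= lee_fin => /andP[t0 _]; exact: HS.
rewrite integral_cst//= lte_mul_pinfty ?lee_fin//.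
have := lebesgue_measure_itv `[0%R, T]; rewrite /= lte_fin => ->.
by case: ifP => // _; rewrite -EFinB ltry.
Qed.

Section Green.
Variables (U : R -> R -> {linear X -> X}) (M omega : R).
Hypotheses (Uev : evolution_family U) (M1 : 1 <= M) (w0 : omega < 0) (UM : growth_bound U M omega).

Let M0 : 0 < M. Proof. exact: lt_le_trans M1. Qed.

(** Whatever [D] is, the exponential kernel integrates to at most [M / - omega]. Only the values of
    [f] on [D] matter, which is used for the tail of [green] at infinity. *)
Lemma le_vnorm_green_on_sup f t S (D : set (measurableTypeR R)) : 0 <= t -> measurable D -> D `<=` `[0, t] ->
  locally_bochner f -> 0 <= S -> (forall s, D s -> vnorm (f s) <= S) ->
  vnorm (green_on U D f t) <= M / - omega * S.
Proof.
move=> t0 mD Dt lbf S0 fS; have [smf _] := lbf.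
have [g [mg g0 gn fg]] := ae_vnorm_measurable smf.
rewrite -lee_fin; apply: (le_trans (le_vnorm_green_on Uev M1 UM t0 mD Dt lbf g0 fg)).
have mk := measurable_exp_kernel M omega.
have k0 s := exp_kernel_ge0 omega s (ltW M0).
rewrite EFinM -(integral_exp_kernel (ltW M0) w0) -(@integral_kernel_l _ _ t mk k0) muleC.
rewrite -ge0_integralZl_EFin//; last 2 first.
- by move=> s _; rewrite lee_fin.
- apply/measurable_EFinP; apply: (measurableT_comp mk).
  by apply: measurable_funB => //; exact: measurable_cst.
apply: (ae_ge0_le_integral_subset (mu := mu)) => //.
- by move=> s _; rewrite lee_fin !mulr_ge0 ?expR_ge0// ltW.
- by move=> s _; rewrite -EFinM lee_fin mulr_ge0.
apply: (aeS _ fg) => s fs Ds; have := Dt _ Ds; rewrite /= in_itv/= => /andP[s0 st].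
rewrite -EFinM lee_fin mulrC /exp_kernel subr_ge0 st -fs// ler_wpM2r ?fS//.
by rewrite mulr_ge0 ?expR_ge0// ltW.
Qed.

Lemma C00_green f : fcarrier E f -> fcarrier E (green U f) /\
  (fnorm E (green U f) <= (M / - omega)%:E * fnorm E f)%E.
Proof.
move=> cf; have lbf := C00_locally_bochner cf; have [S S0 HS] := C00_bounded cf.
have c0 : 0 < M / - omega by rewrite divr_gt0// oppr_gt0.
have mI (a b : R) : measurable (`[a, b]%classic : set (measurableTypeR R)) by exact: measurable_itv.
have GS t S' : 0 <= t -> 0 <= S' -> (forall s, 0 <= s <= t -> vnorm (f s) <= S') ->
    vnorm (green U f t) <= M / - omega * S'.
  move=> t0 S'0 H; rewrite greenE; exact: le_vnorm_green_on_sup.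
split; last first.
  apply: fnorm_le => t t0.
  have ffin : fnorm E f \is a fin_num.
    rewrite ge0_fin_numE//; apply: (@le_lt_trans _ _ S%:E); last exact: ltry.
    by apply: fnorm_le => s s0; rewrite lee_fin HS.
  rewrite -(fineK ffin) -EFinM lee_fin; apply: GS => //; first exact: fine_ge0.
  by move=> s /andP[s0 _]; rewrite -lee_fin fineK//; exact: fnorm_ub.
split.
- exact: (green_continuous Uev M1 UM).
- apply/vnorm_cvgP/cvgrPdist_le => e e0.
  have e2 : 0 < e / 2 / (M / - omega) by rewrite divr_gt0// divr_gt0.
  have [a a0 Ha] := C00_small cf e2.
  (* Beyond [a] the function [f] is small. [K] bounds [M] times the norm of [green U f a], with 1
     added to make it positive; this contribution is then killed by the decay of [U t a]. *)
  pose K := M * (M / - omega * S) + 1.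
  have K0 : 0 < K by rewrite ltr_wpDl// !mulr_ge0 ?invr_ge0 ?oppr_ge0// ltW.
  have Ke : 0 < e / 2 / K by rewrite divr_gt0// divr_gt0.
  near=> t; have at_ : a <= t by near: t; apply: nbhs_pinfty_ge; exact: num_real.
  rewrite sub0r normrN subr0 ger0_norm ?vnorm_ge0//.
  have aat : 0 <= a <= t by rewrite a0.
  rewrite (green_split Uev M1 UM aat lbf); apply: (le_trans (ler_vnormD _ _)).
  have H1 : vnorm (U t a (green U f a)) <= e / 2.
    apply: (le_trans (UM aat (green U f a))).
    have ex : expR (omega * (t - a)) <= e / 2 / K.
      rewrite -[leRHS](@lnK R)// ler_expR -ler_ndivrMl// lerBrDr.
      by near: t; apply: nbhs_pinfty_ge; exact: num_real.
    apply: (@le_trans _ _ (e / 2 / K * K)); last by rewrite mulfVK// gt_eqF.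
    rewrite mulrAC [M * _ * _]mulrC.
    apply: ler_pM => //; rewrite ?expR_ge0 ?mulr_ge0 ?vnorm_ge0 ?(ltW M0)//.
    apply: (@le_trans _ _ (M * (M / - omega * S))); last by rewrite lerDl.
    by rewrite ler_wpM2l ?(ltW M0)//; apply: GS => // s /andP[s0 _]; exact: HS.
  have H2 : vnorm (green_on U `]a, t] f t) <= e / 2.
    rewrite -[leRHS](@divfK _ (M / - omega)) ?gt_eqF// mulrC.
    apply: le_vnorm_green_on_sup => //.
    - by move=> s /=; rewrite !in_itv/= => /andP[/ltW as_ ->]; rewrite (le_trans a0).
    - exact: ltW.
    - by move=> s /=; rewrite in_itv/= => /andP[/ltW as_ _]; exact: Ha.
  by have := lerD H1 H2; rewrite -splitr.
- apply/eqP; rewrite -vnorm_eq0 eq_le vnorm_ge0 andbT.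
  have := GS 0 0; rewrite mulr0; apply => // s; rewrite andbC -eq_le => /eqP ->.
  by have [_ _ ->] := cf; rewrite vnorm0.
Unshelve. all: by end_near. Qed.

Let stable_contraction t s x : 0 <= s -> s <= t -> vnorm (U t s x) <= M * vnorm x.
Proof.
move=> s0 st; have sst : 0 <= s <= t by rewrite s0.
apply: (le_trans (UM sst x)); rewrite ler_wpM2r ?vnorm_ge0// ler_piMr ?(ltW M0)//.
by rewrite -expR0 ler_expR nmulr_rle0// subr_ge0.
Qed.

(** On [[0, T + 1]] strong continuity on the diagonal is made uniform by compactness. For
    [t > T + 1] and [t - s <= 1] both [f s] and [f t] are already small. *)
Lemma C00_evolution_uniform f e : fcarrier E f -> 0 < e ->
  \forall d \near 0^'+, forall t s, 0 <= s -> s <= t -> t - s <= d -> vnorm (U t s (f s) - f t) <= e.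
Proof.
move=> cf e0; have [cont _ _] := cf.
pose eta := e / (M + 2); have M2 : 0 < M + 2 by rewrite addr_gt0.
have eta0 : 0 < eta by rewrite divr_gt0.
have etaE : M * eta + eta + eta = e.
  have -> : M * eta + eta + eta = eta * (M + 2) by ring.
  by rewrite /eta mulfVK// gt_eqF.
have [T T0 HT] := C00_small cf eta0.
have /compact_near_coveringP/(_ R 0^'+ (fun d t => forall s, 0 <= s -> s <= t -> t - s <= d ->
   vnorm (U t s (f s) - f t) <= e) _) := @segment_compact R 0 (T + 1).
case=> [t0 /=|d /= d0 Hd].
  rewrite in_itv/= => /andP[t00 _].
  move/within_continuous_vnormP : cont => /(_ t0 _ eta eta0)[|d1 d10 Hd1]; first by rewrite D0E.
  have [|d2 d20 Hd2] := @evolution_continuous _ _ _ Uev (f t0) t0 t0 eta _ eta0.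
    by rewrite t00 lexx.
  pose d := Num.min d1 d2; have d0 : 0 < d by rewrite lt_min d10.
  have d2' : 0 < d / 2 by rewrite divr_gt0.
  near=> t r => s s0 /= st str.
  have tt0 : `|t - t0| < d / 2.
    by near: t; rewrite near_simpl; have := @nbhsx_ballx _ _ t0 _ d2'; apply: filterS => u; rewrite /ball/= distrC.
  have rd : r < d / 2 by near: r; exact: nbhs_right_lt.
  have st0 : `|s - t0| < d.
    move: str rd tt0 => /=; rewrite !ltr_norml => str rd /andP[ta tb]; apply/andP; split; lra.
  have {}tt0 : `|t - t0| < d by lra.
  have [s1 s2] : `|s - t0| < d1 /\ `|s - t0| < d2.
    by move: st0; rewrite lt_min => /andP[].
  have [t1 t2] : `|t - t0| < d1 /\ `|t - t0| < d2.
    by move: tt0; rewrite lt_min => /andP[].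
  have t_0 : 0 <= t by exact: le_trans st.
  have H1 : vnorm (f s - f t0) <= eta.
    by apply/ltW/Hd1; [rewrite D0E|rewrite /ball/= distrC].
  have H2 : vnorm (f t - f t0) <= eta.
    by apply/ltW/Hd1; [rewrite D0E|rewrite /ball/= distrC].
  have H3 : vnorm (U t s (f t0) - f t0) <= eta.
    have sst : 0 <= s <= t by rewrite s0.
    have := Hd2 t s sst t2 s2; rewrite (evolution_id Uev _ t00) => ?; exact: ltW.
  have -> : U t s (f s) - f t = U t s (f s - f t0) + (U t s (f t0) - f t0) - (f t - f t0).
    by rewrite linearB opprB !addrA subrK subrK.
  apply: (le_trans (ler_vnormB _ _)); rewrite -etaE lerD//.
  apply: (le_trans (ler_vnormD _ _)); rewrite lerD//.
  by apply: (le_trans (stable_contraction _ s0 st)); rewrite ler_wpM2l// ltW.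
near=> r => t s s0 st tsr.
have r1 : r <= 1 by near: r; apply: nbhs_right_le.
have rd : r < d by near: r; apply: nbhs_right_lt.
have r0 : 0 < r by near: r; exact: nbhs_right_gt.
have [tT|Tt] := leP t (T + 1).
  apply: (Hd r) => //.
  - by rewrite /ball/= sub0r normrN ger0_norm// ltW.
  - by rewrite /= in_itv/= tT (le_trans s0).
have H1 : vnorm (f s) <= eta by apply: HT; lra.
have H2 : vnorm (f t) <= eta by apply: HT; lra.
apply: (le_trans (ler_vnormB _ _)); rewrite -etaE -[leLHS]addr0 lerD ?(ltW eta0)// lerD//.
by apply: (le_trans (stable_contraction _ s0 st)); rewrite ler_wpM2l// ltW.
Unshelve. all: by end_near. Qed.

Lemma C00_green_quotient f : fcarrier E f ->
  fnorm E (fun t => (h^-1)%:C *: (green U f t - evolution_semigroup U h (green U f) t) - f t)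
      @[h --> 0^'+] --> 0%E.
Proof.
move=> cf; have lbf := C00_locally_bochner cf; have [cont _ f0] := cf.
apply/ge0_cvge0P => [h|e e0]; first exact: fnorm_ge0.
pose eta := e / (M + 1); have M2 : 0 < M + 1 by rewrite addr_gt0.
have eta0 : 0 < eta by rewrite divr_gt0.
have etaE : M * eta + eta = e.
  have -> : M * eta + eta = eta * (M + 1) by ring.
  by rewrite /eta mulfVK// gt_eqF.
move/within_continuous_vnormP : cont => /(_ 0 _ eta eta0)[|d1 d10 Hd1]; first by rewrite D0E.
near=> h.
have h0 : 0 < h by near: h; exact: nbhs_right_gt.
have hd1 : h < d1 by near: h; exact: nbhs_right_lt.
have Hu : forall t s, 0 <= s -> s <= t -> t - s <= h -> vnorm (U t s (f s) - f t) <= e.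
  by near: h; exact: C00_evolution_uniform.
apply: fnorm_le => t t0; have [ht|th] := leP h t.
  apply: (le_trans (green_quotient_dist Uev M1 UM (f t) h0 ht lbf)).
  have mA : measurable (`](t - h)%R, t]%classic : set (measurableTypeR R)) by exact: measurable_itv.
  apply: (@le_trans _ _ ((h^-1)%:E * \int[mu]_(s in `](t - h)%R, t]%classic) e%:E)%E).
    apply: lee_wpmul2l; first by rewrite lee_fin invr_ge0 ltW.
    apply: (ae_ge0_le_integral (mu := mu)) => //.
    - by move=> s _; rewrite lee_fin vnorm_ge0.
    - by move=> s _; rewrite lee_fin ltW.
    apply: aeW => s /=; rewrite in_itv/= lee_fin => /andP[hs st]; apply: Hu => //; lra.
  rewrite integral_cst//=; have := lebesgue_measure_itv `](t - h)%R, t]; rewrite /= lte_fin gtrBl h0 -EFinB => ->.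
  rewrite -!EFinM lee_fin opprB addrC subrK mulrC mulfK// gt_eqF//.
(* Boundary layer: as [f 0 = 0], the quotient and [f t] are small separately. *)
have small s : 0 <= s <= h -> vnorm (f s) <= eta.
  move=> /andP[s0 sh]; rewrite -[f s]subr0 -f0; apply/ltW/Hd1; first by rewrite D0E.
  by rewrite /ball/= sub0r normrN ger0_norm// (le_lt_trans sh).
rewrite lee_fin (green_increment_lt U f th); apply: (le_trans (ler_vnormB _ _)).
rewrite -etaE lerD ?small ?t0 ?(ltW th)//.
rewrite vnormZr ger0_norm ?invr_ge0 ?(ltW h0)// ler_pdivrMl//.
have mA : measurable (`[0%R, t]%classic : set (measurableTypeR R)) by exact: measurable_itv.
have [smf _] := lbf.
have [g [mg g0 gn fg]] := ae_vnorm_measurable smf.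
rewrite -lee_fin; apply: (le_trans (le_vnorm_green_on Uev M1 UM t0 mA (@subset_refl _ _) lbf g0 fg)).
apply: (@le_trans _ _ (\int[mu]_(s in `[0%R, t]%classic) (M * eta)%:E)%E).
  apply: (ae_ge0_le_integral (mu := mu)) => //.
  - by move=> s _; rewrite lee_fin !mulr_ge0 ?expR_ge0// ltW.
  - by move=> s _; rewrite lee_fin mulr_ge0// ltW.
  apply: (aeS _ fg) => s fs /=; rewrite in_itv/= lee_fin => /andP[s0 st].
  apply: ler_pM; rewrite ?mulr_ge0 ?expR_ge0 ?(ltW M0)//.
    by rewrite ler_piMr ?(ltW M0)// -expR0 ler_expR nmulr_rle0// subr_ge0.
  by rewrite -fs// small// s0 (le_trans st)// ltW.
rewrite integral_cst//=; have := lebesgue_measure_itv `[0%R, t]; rewrite /= lte_fin => ->.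
have Me : 0 <= M * eta by rewrite mulr_ge0// ltW.
case: ifP => _; last by rewrite mule0 lee_fin mulr_ge0// ltW.
by rewrite sube0 -EFinM lee_fin mulrC ler_wpM2r// ltW.
Unshelve. all: by end_near. Qed.

End Green.

(** The supremum is an extended seminorm on all functions, so the larger class can be everything. *)
Lemma C00_well_behaved : well_behaved E setT.
Proof.
have re_ge0 := @Re_normc_ge0 R.
have mulE (c : R) f g : 0 <= c -> (forall t, 0 <= t -> (vnorm (f t) <= c * vnorm (g t)) \/ exists2 s, 0 <= s & vnorm (f t) <= c * vnorm (g s)) ->
    (fnorm E f <= c%:E * fnorm E g)%E.
  move=> c0 fg; apply: fnorm_le => t t0.
  have [s s0 fgs] : exists2 s, 0 <= s & vnorm (f t) <= c * vnorm (g s).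
    by case: (fg t t0) => // H; exists t.
  apply: (@le_trans _ _ (c%:E * (vnorm (g s))%:E)%E); first by rewrite -EFinM lee_fin.
  by apply: lee_wpmul2l; rewrite ?lee_fin//; exact: fnorm_ub.
split => //.
- move=> f cf; split => //; have [S S0 HS] := C00_bounded cf.
  by apply: (@le_lt_trans _ _ S%:E); [apply: fnorm_le => t t0; rewrite lee_fin HS|exact: ltry].
- move=> f g [cf fy f0] [cg gy g0]; split; last by rewrite f0 g0 addr0.
    move/subspace_continuousP : cf => cf; move/subspace_continuousP : cg => cg.
    by apply/subspace_continuousP => t Dt; apply: cvgD; [exact: cf|exact: cg].
  by rewrite -(addr0 0); exact: cvgD.
- move=> c f [cf fy f0]; split; last by rewrite f0 scaler0.
    move/subspace_continuousP : cf => cf.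
    by apply/subspace_continuousP => t Dt; apply: cvgZr; exact: cf.
  by rewrite -(@scaler0 _ X c); exact: cvgZr.
- move=> l f l0 [cf fy f0]; split; last by rewrite f0 scaler0.
    exact: within_continuousZr (@continuous_expRM _ (- l)) cf.
  apply: (@cvg_squeeze_vnorm _ _ _ _ _ _ _ (fun t => vnorm (f t))).
    near=> t; have t0 : 0 <= t by near: t; apply: nbhs_pinfty_ge; exact: num_real.
    rewrite subr0 vnormZr ger0_norm ?expR_ge0// ler_piMl ?vnorm_ge0// -expR0 ler_expR.
    by rewrite mulNr oppr_le0 mulr_ge0.
  by rewrite -(@vnorm0 _ X); exact: cvg_vnorm.
- move=> f g fg; apply: fnorm_le => t t0; apply: (le_trans _ (fnorm_ub g t0)).
  by rewrite lee_fin fg.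
- move=> f g _ _; apply: fnorm_le => t t0.
  apply: (@le_trans _ _ ((vnorm (f t))%:E + (vnorm (g t))%:E)%E).
    by rewrite -EFinD lee_fin; exact: ler_vnormD.
  by apply: leeD; exact: fnorm_ub.
- by move=> c f _; apply: mulE => // t _; left; rewrite vnormZ.
- move=> l f _ H; apply/eqP; rewrite eq_le fnorm_ge0 andbT.
  apply: fnorm_le => t t0; have := fnorm_ub (fun t => (expR (- l * t))%:C *: f t) t0.
  rewrite [X in (_ <= X)%E]H !lee_fin vnormZr ger0_norm ?expR_ge0//.
  by rewrite pmulr_rle0// expR_gt0.
- move=> U M omega h f Uev M1 UM h0 _; split => //.
  have C0 : 0 <= M * expR (omega * h) by rewrite mulr_ge0 ?expR_ge0// (le_trans ler01).
  apply: mulE => // t t0; rewrite /evolution_semigroup h0/=; case: ifPn => [ht|_]; last first.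
    by left; rewrite vnorm0 mulr_ge0// vnorm_ge0.
  right; exists (t - h); first by rewrite subr_ge0.
  have tt : 0 <= t - h <= t by rewrite subr_ge0 ht lerBlDr lerDl.
  by have := UM _ _ tt (f (t - h)); rewrite subKr.
- by move=> U M omega Uev M1 w0 UM; exists (M / - omega) => f; exact: C00_green.
- by move=> U M omega f Uev M1 w0 UM; exact: (C00_green_quotient Uev M1 w0 UM).
- move=> f a b c a0 ab c0 cf f0 fc.
  have b0 : 0 <= b by lra.
  have fc' t : 0 <= t -> vnorm (f t) <= c.
    move=> t0; have [tab|] := boolP (a <= t <= b); first exact: fc.
    rewrite negb_and -!ltNge => tab; rewrite f0 ?vnorm0//.
    by case/orP : tab => /ltW ->; rewrite ?orbT.
  split; last first.
    by apply: fnorm_le => t t0; rewrite lee_fin (le_trans (fc' t t0))// ler_peMr.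
  split => //; last by apply: f0 => //; rewrite a0.
  apply: cvg_near_cst; near=> t; apply: f0.
    by near: t; apply: nbhs_pinfty_ge; exact: num_real.
  by apply/orP; right; near: t; apply: nbhs_pinfty_ge; exact: num_real.
- move=> f c nu c0 nu0 cf f0 fc; split => //.
  apply/vnorm_cvgP/cvgrPdist_le => e e0; near=> t.
  have t0 : 0 <= t by near: t; apply: nbhs_pinfty_ge; exact: num_real.
  have c1 : 0 < c + 1 by rewrite ltr_wpDl.
  have ec : 0 < e / (c + 1) by rewrite divr_gt0.
  have nu1 : - nu < 0 by rewrite oppr_lt0.
  have ex : expR (- nu * t) <= e / (c + 1).
    rewrite -[leRHS](@lnK R)// ler_expR -(ler_ndivrMl _ _ nu1).
    by near: t; apply: nbhs_pinfty_ge; exact: num_real.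
  rewrite sub0r normrN subr0 ger0_norm ?vnorm_ge0// (le_trans (fc t t0))//.
  rewrite -(@divfK _ (c + 1) _ e) ?gt_eqF// [leRHS]mulrC ler_pM ?expR_ge0//.
  by rewrite lerDl.
- move=> f a c a0 c0 fc; apply: le_trans (fnorm_ub f a0).
  by rewrite lee_fin; apply: fc; rewrite lexx lerDl ler01.
Unshelve. all: by end_near. Qed.

End VanishingFunctions.

(** * Generators, rescaling and the resolvent *)

Section EvolutionSemigroup.
Context (R : realType) (X : completeNormedModType R[i]).
Implicit Types (U : R -> R -> {linear X -> X}) (f g : R -> X).

Lemma evolution_semigroupD U a b f : evolution_family U -> 0 <= a -> 0 <= b ->
  evolution_semigroup U (a + b) f = evolution_semigroup U a (evolution_semigroup U b f).
Proof.
move=> Uev a0 b0; apply/funext => t; rewrite /evolution_semigroup a0 b0 addr_ge0//=.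
rewrite addrC -lerBrDr opprD addrA [t - b - a]addrAC.
have [bta|] := leP b (t - a); last by case: ifP => // _; rewrite linear0.
have at_ : a <= t by rewrite -subr_ge0 (le_trans b0).
rewrite at_; apply: (evolution_cocycle Uev).
- by rewrite subr_ge0.
- by rewrite lerBlDr lerDl.
- by rewrite lerBlDr lerDl.
Qed.

Lemma evolution_semigroupDf U a f g :
  evolution_semigroup U a (fun t => f t + g t) =
  (fun t => evolution_semigroup U a f t + evolution_semigroup U a g t).
Proof.
by apply/funext => t; rewrite /evolution_semigroup; case: ifP => _; rewrite ?linearD ?addr0.
Qed.

Lemma evolution_semigroupZ U a (c : R[i]) f :
  evolution_semigroup U a (fun t => c *: f t) = (fun t => c *: evolution_semigroup U a f t).
Proof.
by apply/funext => t; rewrite /evolution_semigroup; case: ifP => _; rewrite ?linearZ ?scaler0.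
Qed.

Lemma evolution_semigroupN U a f :
  evolution_semigroup U a (fun t => - f t) = (fun t => - evolution_semigroup U a f t).
Proof.
by apply/funext => t; rewrite /evolution_semigroup; case: ifP => _; rewrite ?linearN ?oppr0.
Qed.

End EvolutionSemigroup.

Section Generator.
Context (R : realType) (X : completeNormedModType R[i]) (E : function_space X) (W : set (R -> X)).
Hypothesis wb : well_behaved E W.
Implicit Types (U : R -> R -> {linear X -> X}) (f g : R -> X) (S : R -> (R -> X) -> R -> X).

Let fge0 := wb_fnorm_ge0 wb.

Lemma carrier_W f : fcarrier E f -> W f. Proof. by case/(wb_carrier wb). Qed.
Lemma carrier_fin f : fcarrier E f -> fnorm E f \is a fin_num.
Proof. by case/(wb_carrier wb) => _ fy; rewrite ge0_fin_numE. Qed.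

Lemma W_sub f g : W f -> W g -> W (fun t => f t - g t).
Proof.
move=> Wf Wg; have := wb_D wb Wf (wb_Z wb (-1) Wg).
by congr W; apply/funext => t; rewrite scaleN1r.
Qed.

Lemma carrierN f : fcarrier E f -> fcarrier E (fun t => - f t).
Proof.
move=> cf; have := wb_carrierZ wb (-1) cf.
by congr (fcarrier _ _); apply/funext => t; rewrite scaleN1r.
Qed.

Lemma carrierB f g : fcarrier E f -> fcarrier E g -> fcarrier E (fun t => f t - g t).
Proof. by move=> cf cg; apply: (wb_carrierD wb) => //; exact: carrierN. Qed.

Lemma fnormN f : fnorm E (fun t => - f t) = fnorm E f.
Proof.
by apply/eqP; rewrite eq_le; apply/andP; split; apply: (wb_fnorm_mono wb) => t _; rewrite vnormN.
Qed.

Lemma eq_fnorm f g : (forall t, 0 <= t -> f t = g t) -> fnorm E f = fnorm E g.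
Proof.
by move=> fg; apply/eqP; rewrite eq_le; apply/andP; split; apply: (wb_fnorm_mono wb) => t t0; rewrite fg.
Qed.

Lemma fnormB f g : W f -> W g -> (fnorm E (fun t => (f t - g t)%R) <= fnorm E f + fnorm E g)%E.
Proof.
move=> Wf Wg; rewrite -(fnormN g).
apply: (wb_fnormD wb (g := fun t => - g t)) => //.
by have := wb_Z wb (-1) Wg; congr W; apply/funext => t; rewrite scaleN1r.
Qed.

Lemma fnorm0 : fnorm E (fun=> 0) = 0%E.
Proof.
have W0 : W (fun=> 0).
  by apply: (wb_continuous wb); apply: continuous_subspaceT => t; exact: cvg_cst.
apply/eqP; rewrite eq_le fge0 andbT.
have := wb_fnormZ wb 0 W0; rewrite normr0 mul0e.
by under eq_fun do rewrite scaler0.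
Qed.

Definition preserves_W S := forall h f, 0 <= h -> W f -> W (S h f).

Lemma W_evolution_semigroup U (M omega : R) : evolution_family U -> 1 <= M -> growth_bound U M omega ->
  preserves_W (evolution_semigroup U).
Proof. by move=> Uev M1 UM h f h0 Wf; have [] := wb_semigroup wb Uev M1 UM h0 Wf. Qed.

Let W_quotient S f h : preserves_W S -> W f -> 0 <= h -> W (fun t => (h^-1)%:C *: (S h f t - f t)).
Proof. by move=> WS Wf h0; apply: (wb_Z wb); apply: W_sub => //; exact: WS. Qed.

Lemma cvg_fnorm_le (F G : R -> \bar R) : (forall h, 0 <= F h)%E ->
  (\forall h \near 0^'+, (F h <= G h)%E) -> G h @[h --> 0^'+] --> 0%E -> F h @[h --> 0^'+] --> 0%E.
Proof.
move=> F0 FG G0; apply: (@squeeze_cvge _ _ _ _ (cst 0%E) _ G) => //; last exact: cvg_cst.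
by apply: filterS FG => h -> ; rewrite F0.
Qed.

Lemma cvge0D (F G : R -> \bar R) : F h @[h --> 0^'+] --> 0%E -> G h @[h --> 0^'+] --> 0%E ->
  (F h + G h)%E @[h --> 0^'+] --> 0%E.
Proof. by move=> F0 G0; rewrite -(adde0 0%E); apply: cvgeD. Qed.

Lemma generatorD S f1 f2 g1 g2 : preserves_W S ->
  (forall h f g, S h (fun t => f t + g t) = (fun t => S h f t + S h g t)) ->
  generator E S f1 g1 -> generator E S f2 g2 ->
  generator E S (fun t => f1 t + f2 t) (fun t => g1 t + g2 t).
Proof.
move=> WS SD [cf1 cg1 H1] [cf2 cg2 H2]; split; [exact: (wb_carrierD wb)|exact: (wb_carrierD wb)|].
have H := cvge0D H1 H2.
apply: cvg_fnorm_le H => //.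
near=> h; have h0 : 0 <= h by near: h; exact: nbhs_right_ge.
rewrite (_ : (fun tau => _) = (fun t => ((h^-1)%:C *: (S h f1 t - f1 t) - g1 t) + ((h^-1)%:C *: (S h f2 t - f2 t) - g2 t))); last first.
  by apply/funext => t; rewrite SD !opprD addrACA scalerDr addrACA.
by apply: (wb_fnormD wb); apply: W_sub; (apply: W_quotient || idtac) => //; exact: carrier_W.
Unshelve. all: by end_near. Qed.

Lemma generatorN S f g : (forall h f, S h (fun t => - f t) = (fun t => - S h f t)) ->
  generator E S f g -> generator E S (fun t => - f t) (fun t => - g t).
Proof.
move=> SN [cf cg H]; split; [exact: carrierN|exact: carrierN|].
apply: cvg_trans H; apply: near_eq_cvg; apply: nearW => h /=.
rewrite -fnormN; congr (fnorm _ _); apply/funext => t.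
by rewrite SN -opprD scalerN -opprD.
Qed.

(** The new quotient minus its limit is [c h] times the old one minus [g], plus [(c h - 1) g], plus
    [(h^-1 (c h - 1) + l) f]. The hypotheses on [c] control these three terms: [c] is 1 at 0 with
    derivative [- l]. *)
Lemma generator_rescale S S' (c : R -> R[i]) (l : R[i]) f g : preserves_W S ->
  (forall h f, S' h f = (fun t => c h *: S h f t)) ->
  complex.Re `|c h| @[h --> 0^'+] --> (1 : R) ->
  complex.Re `|c h - 1| @[h --> 0^'+] --> (0 : R) ->
  complex.Re `|(h^-1)%:C * (c h - 1) + l| @[h --> 0^'+] --> (0 : R) ->
  generator E S f g -> generator E S' f (fun t => g t - l *: f t).
Proof.
move=> WS S'E c1 c0 cl [cf cg H].
split; [by []|by apply: carrierB => //; exact: (wb_carrierZ wb)|].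
have cstE f' : fcarrier E f' -> forall k : R -> R, k h @[h --> 0^'+] --> (0 : R) ->
    ((k h)%:E * fnorm E f')%E @[h --> 0^'+] --> 0%E.
  move=> cf' k k0; rewrite -(fineK (carrier_fin cf')); under eq_fun do rewrite -EFinM.
  apply/cvg_EFin; first by apply: nearW.
  by rewrite -[X in _ --> X](mul0r (fine (fnorm E f'))); apply: (cvgM k0); exact: cvg_cst.
have H1 : ((complex.Re `|c h|)%:E * fnorm E (fun t => ((h^-1)%:C *: (S h f t - f t) - g t)%R))%E @[h --> 0^'+] --> 0%E.
  rewrite -[X in _ --> X](mule0 1%E); apply: cvgeM => //.
  by apply/cvg_EFin => //; exact: nearW.
have H2 := cvge0D (cvge0D H1 (cstE g cg _ c0)) (cstE f cf _ cl);
  apply: cvg_fnorm_le H2 => [h|]; first exact: fge0.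
near=> h; have h0 : 0 <= h by near: h; exact: nbhs_right_ge.
have hn0 : h != 0 by rewrite gt_eqF//; near: h; exact: nbhs_right_gt.
rewrite (_ : (fun tau => _) = (fun t => (c h *: ((h^-1)%:C *: (S h f t - f t) - g t) + (c h - 1) *: g t) + ((h^-1)%:C * (c h - 1) + l) *: f t)); last first.
  apply/funext => t; rewrite S'E.
  rewrite [c h *: (_ - _)]scalerBr [(_ - 1) *: g t]scalerBl scale1r addrA subrK.
  rewrite [(_ + l) *: _]scalerDl mulrBr mulr1 [(_ - _) *: f t]scalerBl opprB.
  rewrite !scalerBr !scalerA [c h * _]mulrC -!addrA; congr (_ + _).
  by rewrite [in RHS](addrCA (- g t)) addKr addrA [RHS]addrC.
have WQ : W (fun t => (h^-1)%:C *: (S h f t - f t) - g t).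
  by apply: W_sub; [apply: W_quotient => //|]; exact: carrier_W.
have [Wf Wg] := (carrier_W cf, carrier_W cg).
apply: (le_trans (wb_fnormD wb _ _)); [by apply: (wb_D wb); exact: (wb_Z wb)|exact: (wb_Z wb)|].
apply: leeD; last exact: (wb_fnormZ wb).
apply: (le_trans (wb_fnormD wb _ _)); [exact: (wb_Z wb)|exact: (wb_Z wb)|].
by apply: leeD; exact: (wb_fnormZ wb).
Unshelve. all: by end_near. Qed.

Section Injectivity.
Variables (U : R -> R -> {linear X -> X}) (M omega : R).
Hypotheses (Uev : evolution_family U) (M1 : 1 <= M) (w0 : omega < 0) (UM : growth_bound U M omega).
Local Notation S := (evolution_semigroup U).

Let M0 : 0 < M. Proof. exact: lt_le_trans M1. Qed.
Let WS : preserves_W S. Proof. exact: W_evolution_semigroup Uev M1 UM. Qed.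

Let le_fnorm_semigroup h f : 0 <= h -> W f -> (fnorm E (S h f) <= M%:E * fnorm E f)%E.
Proof.
move=> h0 Wf; have [_ /le_trans] := wb_semigroup wb Uev M1 UM h0 Wf; apply.
rewrite lee_wpmul2r// lee_fin ler_piMr ?(ltW M0)// -expR0 ler_expR.
by rewrite nmulr_rle0.
Qed.

(** No orbit is differentiated: telescoping over [n] steps of length [t / n] bounds [S t u - u] by
    [M * t] times the difference quotient at [t / n], which tends to 0. A time [t] at which [S t]
    halves norms then concludes. *)
Lemma generator_kernel_trivial u : generator E S u (fun=> 0) -> fnorm E u = 0%E.
Proof.
move=> [cu _ H]; have Wu := carrier_W cu.
have D_fin h : 0 <= h -> fnorm E (fun t => (S h u t - u t)%R) \is a fin_num.
  move=> h0; rewrite ge0_fin_numE ?fge0//.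
  apply: (le_lt_trans (fnormB (WS h0 Wu) Wu)); rewrite lte_add_pinfty//; last first.
    by rewrite -ge0_fin_numE ?fge0// carrier_fin.
  apply: (le_lt_trans (le_fnorm_semigroup h0 Wu)).
  by rewrite -(fineK (carrier_fin cu)) -EFinM ltry.
(* Telescoping: [S ((n+1) h) u - u] is [S (n h)] applied to [S h u - u], plus [S (n h) u - u], and
   [M] bounds every [S (n h)]. *)
have iter h n : 0 <= h -> (fnorm E (fun t => (S (n%:R * h) u t - u t)%R) <=
    (n%:R * M)%:E * fnorm E (fun t => (S h u t - u t)%R))%E.
  move=> h0; elim: n => [|n IHn].
    rewrite !mul0r mul0e (@eq_fnorm (fun t => S 0 u t - u t) (fun=> 0)) ?fnorm0// => t t0.
    rewrite /evolution_semigroup lexx t0/= subr0 (evolution_id Uev)// subrr//.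
  have nh0 : 0 <= n%:R * h by rewrite mulr_ge0.
  have Wh : W (fun t => S h u t - u t) by apply: W_sub => //; exact: WS.
  rewrite (_ : (fun t => _) = (fun t => S (n%:R * h) (fun t => S h u t - u t) t + (S (n%:R * h) u t - u t))); last first.
    apply/funext => t; rewrite -natr1 mulrDl mul1r evolution_semigroupD//.
    rewrite (_ : (fun t => _) = (fun t => S h u t + (-1) *: u t)); last first.
      by apply/funext => s; rewrite scaleN1r.
    rewrite evolution_semigroupDf evolution_semigroupZ scaleN1r addrA subrK//.
  apply: (le_trans (wb_fnormD wb _ _)); [exact: WS|by apply: W_sub => //; exact: WS|].
  rewrite -natr1 mulrDl mul1r EFinD ge0_muleDl ?lee_fin ?mulr_ge0 ?(ltW M0)// addeC.
  by apply: leeD => //; exact: le_fnorm_semigroup.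
pose N := fine (fnorm E u).
have uN : fnorm E u = N%:E by rewrite fineK// carrier_fin.
have N0 : 0 <= N by rewrite fine_ge0.
suff: N <= 0 by move=> NN; rewrite uN; congr EFin; apply/eqP; rewrite eq_le NN.
(* Chosen so that [M * expR (omega * t)] equals [expR omega / 2]. *)
pose t := 1 + (- omega)^-1 * ln (2 * M).
have wp : 0 < - omega by rewrite oppr_gt0.
have t0 : 0 < t.
  rewrite ltr_wpDr// mulr_ge0 ?invr_ge0 ?(ltW wp)// ln_ge0//.
  by rewrite (le_trans M1)// ler_peMl ?(ltW M0)// ler1n.
have Mt : M * expR (omega * t) <= 2^-1.
  have -> : omega * t = omega - ln (2 * M).
    by rewrite /t mulrDr mulr1 mulrA invrN mulrN divff ?lt_eqF// mulN1r.
  rewrite expRD expRN lnK; last by rewrite posrE mulr_gt0.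
  have -> : M * (expR omega / (2 * M)) = expR omega * 2^-1.
    by field; rewrite gt_eqF.
  by rewrite ler_piMl ?invr_ge0// -expR0 ler_expR ltW.
apply/ler_addgt0Pl => e e0.
(* Then [M * t * d = e / 2], so that [N <= e / 2 + N / 2], that is [N <= e]. *)
pose d := e / (2 * (M * t)).
have Mt0 : 0 < M * t by rewrite mulr_gt0.
have d0 : 0 < d by rewrite divr_gt0// mulr_gt0.
move/ge0_cvge0P : H => /(_ (fun h => fge0 _)) /(_ _ d0) Hd.
have [n n1 Hn] : exists2 n : nat, (0 < n)%N &
    (fnorm E (fun tau => ((t / n%:R)^-1%:C *: (S (t / n%:R) u tau - u tau) - 0)%R) <= d%:E)%E.
  case: Hd => r /= r0 Hr.
  pose n := (Num.truncn (t / r)).+1.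
  exists n => //; apply: Hr; last by rewrite /= divr_gt0// ltr0n.
  rewrite /= sub0r normrN ger0_norm ?divr_ge0 ?(ltW t0)//.
  by rewrite ltr_pdivrMr ?ltr0n// mulrC -ltr_pdivrMr// truncnS_gt.
pose h := t / n%:R.
have h0 : 0 < h by rewrite divr_gt0// ltr0n.
have nh : n%:R * h = t by rewrite mulrC mulfVK// pnatr_eq0 -lt0n.
have Sh : (fnorm E (fun tau => (S h u tau - u tau)%R) <= (h * d)%:E)%E.
  have WQ := W_quotient WS Wu (ltW h0).
  rewrite (_ : (fun tau => _) = fun tau => h%:C *: ((h^-1)%:C *: (S h u tau - u tau))); last first.
    by apply/funext => tau; rewrite scalerA -rmorphM/= divff ?gt_eqF// scale1r.
  apply: (le_trans (wb_fnormZ wb _ WQ)); rewrite EFinM Re_normc_real ger0_norm ?(ltW h0)//.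
  apply: lee_wpmul2l; first by rewrite lee_fin ltW.
  by move: Hn; under eq_fun do rewrite subr0.
have St : (fnorm E (fun tau => (S t u tau - u tau)%R) <= (M * t * d)%:E)%E.
  rewrite -nh; apply: (le_trans (iter h n (ltW h0))).
  apply: (@le_trans _ _ ((n%:R * M)%:E * (h * d)%:E)%E).
    by apply: lee_wpmul2l => //; rewrite lee_fin mulr_ge0// ltW.
  rewrite -EFinM lee_fin le_eqVlt; apply/orP; left; apply/eqP; ring.
have WSt := WS (ltW t0) Wu.
have : (fnorm E u <= (M * t * d)%:E + 2^-1%:E * fnorm E u)%E.
  rewrite {1}(_ : u = fun tau => S t u tau - (S t u tau - u tau)); last first.
    by apply/funext => tau; rewrite opprB addrC subrK.
  apply: (le_trans (fnormB WSt (W_sub WSt Wu))); rewrite addeC; apply: leeD => //.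
  have [_ /le_trans] := wb_semigroup wb Uev M1 UM (ltW t0) Wu; apply.
  by rewrite lee_wpmul2r// lee_fin.
rewrite uN -EFinM -EFinD lee_fin addr0.
have -> : M * t * d = e / 2.
  by rewrite /d; field; rewrite ?gt_eqF.
by move=> ?; lra.
Qed.

End Injectivity.

End Generator.

Section StableInverse.
Context (R : realType) (X : completeNormedModType R[i]) (E : function_space X) (W : set (R -> X)).
Hypothesis wb : well_behaved E W.
Variables (U : R -> R -> {linear X -> X}) (M omega : R).
Hypotheses (Uev : evolution_family U) (M1 : 1 <= M) (w0 : omega < 0) (UM : growth_bound U M omega).
Local Notation S := (evolution_semigroup U).

Lemma generator_green g : fcarrier E g -> generator E S (fun t => - green U g t) g.
Proof.
move=> cg; have [C HC] := wb_green wb Uev M1 w0 UM; have [cG _] := HC g cg.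
split=> //; first exact: (carrierN wb cG).
apply: cvg_trans (wb_green_quotient wb Uev M1 w0 UM cg); apply: near_eq_cvg; apply: nearW => h /=.
congr (fnorm _ _); apply/funext => t; congr (_ *: _ - _).
by rewrite evolution_semigroupN opprK addrC.
Qed.

Lemma generator_green_unique f g : generator E S f g -> feq E (fun t => - green U g t) f.
Proof.
move=> fg; have [cf cg _] := fg; have WS := W_evolution_semigroup wb Uev M1 UM.
have := generatorD wb WS (@evolution_semigroupDf _ _ U) (generator_green cg) (generatorN wb (@evolution_semigroupN _ _ _) fg).
rewrite (_ : (fun t => g t + - g t) = fun=> 0); last by apply/funext => t; rewrite subrr.
by move=> /(generator_kernel_trivial wb Uev M1 w0 UM).
Qed.

Lemma stable_bounded_inverse : bounded_inverse E (generator E S) (fun g t => - green U g t).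
Proof.
have [C HC] := wb_green wb Uev M1 w0 UM; split.
- exact: generator_green.
- by move=> f g; exact: generator_green_unique.
- by exists C => g /HC[_]; rewrite (fnormN wb).
Qed.

End StableInverse.

(** * The complex exponential and rescaled evolution families *)

Section ComplexExponential.
Context (R : realType).
Implicit Types (z : R[i]) (r : R).

Lemma Re_normc_le z : complex.Re `|z| <= `|complex.Re z| + `|complex.Im z|.
Proof.
case: z => a b; rewrite normc_def/= -[leRHS]ger0_norm ?addr_ge0// -sqrtr_sqr ler_sqrt ?sqr_ge0//.
rewrite sqrrD -!normrX ![`|_ ^+ 2|]ger0_norm ?sqr_ge0// addrAC lerDl mulrn_wge0// mulr_ge0//.
Qed.

(** This is [e^{z r}] for real [r]. *)
Definition cexp z r : R[i] := expR (complex.Re z * r) * cos (complex.Im z * r) +i*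
  (expR (complex.Re z * r) * sin (complex.Im z * r)).

Lemma cexp0 z : cexp z 0 = 1.
Proof. by rewrite /cexp !mulr0 expR0 cos0 sin0 mulr1 mulr0. Qed.

Lemma cexpD z a b : cexp z (a + b) = cexp z a * cexp z b.
Proof.
rewrite /cexp; apply/eqP; rewrite eq_complex/=; apply/andP; split; apply/eqP.
  by rewrite !mulrDr expRD cosD; ring.
by rewrite !mulrDr expRD sinD; ring.
Qed.

Lemma cexpNK z r : cexp (- z) r * cexp z r = 1.
Proof.
rewrite /cexp; case: z => a b /=; apply/eqP; rewrite eq_complex/=; apply/andP; split; apply/eqP.
  rewrite !mulNr cosN sinN mulrN mulNr opprK -[RHS](cos2Dsin2 (b * r)).
  have H : expR (- (a * r)) * expR (a * r) = 1 by rewrite -expRD addNr expR0.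
  by transitivity (expR (- (a * r)) * expR (a * r) * (cos (b * r) ^+ 2 + sin (b * r) ^+ 2)); [ring|rewrite H mul1r].
by rewrite !mulNr cosN sinN; ring.
Qed.

Lemma Re_norm_cexp z r : complex.Re `|cexp z r| = expR (complex.Re z * r).
Proof.
rewrite normc_def/= !exprMn -mulrDr cos2Dsin2 mulr1 sqrtr_sqr ger0_norm// expR_ge0//.
Qed.

Lemma cexp_continuous z t : complex.Re `|cexp z u - cexp z t| @[u --> t] --> (0 : R).
Proof.
have cM (k : R) : (fun u : R => k * u) @ t --> k * t by apply: cvgM; [exact: cvg_cst|exact: cvg_id].
have ce : expR (complex.Re z * u) @[u --> t] --> expR (complex.Re z * t).
  by apply: (continuous_comp (cM _)); exact: continuous_expR.
have cc : cos (complex.Im z * u) @[u --> t] --> cos (complex.Im z * t).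
  by apply: (continuous_comp (cM _)); exact: continuous_cos.
have cs : sin (complex.Im z * u) @[u --> t] --> sin (complex.Im z * t).
  by apply: (continuous_comp (cM _)); exact: continuous_sin.
have H : `|complex.Re (cexp z u) - complex.Re (cexp z t)| + `|complex.Im (cexp z u) - complex.Im (cexp z t)|
    @[u --> t] --> (0 : R).
  rewrite -[X in _ --> X](addr0 0); apply: cvgD.
    rewrite -[X in _ --> X](@normr0 _ R); apply: cvg_norm.
    rewrite -[X in _ --> X](subrr (complex.Re (cexp z t))); apply: cvgB; last exact: cvg_cst.
    exact: (cvgM ce cc).
  rewrite -[X in _ --> X](@normr0 _ R); apply: cvg_norm.
  rewrite -[X in _ --> X](subrr (complex.Im (cexp z t))); apply: cvgB; last exact: cvg_cst.
  exact: (cvgM ce cs).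
apply: (squeeze_cvgr _ (cvg_cst 0) H); apply: nearW => u.
apply/andP; split; [exact: Re_normc_ge0|apply: (le_trans (Re_normc_le _))].
by case: (cexp z u) => a b; case: (cexp z t).
Qed.

Lemma is_derive_quotient (p : R -> R) (d : R) : is_derive (0 : R) (1 : R) p d ->
  h^-1 * (p h - p 0) @[h --> 0^'+] --> d.
Proof.
move=> dp; have H : derivable p 0 1 by exact: ex_derive.
have : h^-1 *: ((p \o shift 0) (h *: (1 : R)) - p 0) @[h --> 0^'] --> 'D_1 p 0 by exact: H.
rewrite derive_val => /cvg_dnbhs_at_right; apply: cvg_trans; apply: near_eq_cvg; apply: nearW => h.
by rewrite /= addr0 /GRing.scale/= mulr1.
Qed.

Lemma cexp_quotient z : complex.Re `|(h^-1)%:C * (cexp z h - 1) - z| @[h --> 0^'+] --> (0 : R).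
Proof.
case: z => a b.
have H1 : h^-1 * (expR (a * h) * cos (b * h) - 1) @[h --> 0^'+] --> a.
  have := @is_derive_quotient (fun h => expR (a * h) * cos (b * h)) a _.
  rewrite !mulr0 expR0 cos0 mulr1; apply.
  apply: is_derive_eq; rewrite /= !mulr0 expR0 cos0 sin0.
  by rewrite -![_ *: _]/(_ * _); ring.
have H2 : h^-1 * (expR (a * h) * sin (b * h) - 0) @[h --> 0^'+] --> b.
  have := @is_derive_quotient (fun h => expR (a * h) * sin (b * h)) b _.
  rewrite !mulr0 sin0 mulr0; apply.
  apply: is_derive_eq; rewrite /= !mulr0 expR0 cos0 sin0.
  by rewrite -![_ *: _]/(_ * _); ring.
have H : `|h^-1 * (expR (a * h) * cos (b * h) - 1) - a| +
    `|h^-1 * (expR (a * h) * sin (b * h) - 0) - b| @[h --> 0^'+] --> (0 : R).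
  rewrite -[X in _ --> X](addr0 0); apply: cvgD.
    rewrite -[X in _ --> X](@normr0 _ R); apply: cvg_norm.
    by rewrite -[X in _ --> X](subrr a); apply: cvgB => //; exact: cvg_cst.
  rewrite -[X in _ --> X](@normr0 _ R); apply: cvg_norm.
  by rewrite -[X in _ --> X](subrr b); apply: cvgB => //; exact: cvg_cst.
apply: (squeeze_cvgr _ (cvg_cst 0) H); apply: nearW => h.
apply/andP; split; [exact: Re_normc_ge0|apply: (le_trans (Re_normc_le _))].
rewrite (_ : complex.Re _ = h^-1 * (expR (a * h) * cos (b * h) - 1) - a); last by rewrite /=; ring.
by rewrite (_ : complex.Im _ = h^-1 * (expR (a * h) * sin (b * h) - 0) - b)//= ; ring.
Qed.

End ComplexExponential.

Section Rescaling.
Context (R : realType) (X : completeNormedModType R[i]).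
Variable z : R[i].
Implicit Type U : R -> R -> {linear X -> X}.

(** With this sign the generator becomes [Gamma + z] and the growth exponent [omega + Re z]. *)
Definition rescale U : R -> R -> {linear X -> X} := fun t s => cexp z (t - s) \*: U t s.

Lemma rescaleE U t s x : rescale U t s x = cexp z (t - s) *: U t s x.
Proof. by []. Qed.

Lemma rescale_evolution_family U : evolution_family U -> evolution_family (rescale U).
Proof.
move=> [Ub Uc Uid Ucont]; split.
- move=> t s ts; have [C HC] := Ub t s ts.
  exists (expR (complex.Re z * (t - s)) * C) => x.
  by rewrite rescaleE vnormZ Re_norm_cexp -mulrA ler_wpM2l ?expR_ge0.
- move=> t s tau tau0 ts st x; rewrite !rescaleE (Uc t s tau)// linearZ/= scalerA -cexpD.
  by rewrite addrA subrK.
- by move=> t t0 x; rewrite rescaleE subrr cexp0 scale1r Uid.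
move=> x; apply: (within_continuousZ (phi := fun w : R * R => cexp z (w.1 - w.2)) _ (Ucont x)) => w _.
apply: (@cvg_within_filter _ _ _ (nbhs w)) => //.
have H : u.1 - u.2 @[u --> w] --> w.1 - w.2 by apply: cvgB; [exact: cvg_fst|exact: cvg_snd].
exact: (cvg_comp _ _ H (@cexp_continuous _ z (w.1 - w.2))).
Qed.

Lemma rescale_growth_bound U M omega : growth_bound U M omega ->
  growth_bound (rescale U) M (omega + complex.Re z).
Proof.
move=> UM t s ts x; rewrite rescaleE vnormZ Re_norm_cexp.
apply: (@le_trans _ _ (expR (complex.Re z * (t - s)) * (M * expR (omega * (t - s)) * vnorm x))).
  by rewrite ler_wpM2l ?expR_ge0// UM.
by rewrite mulrDl expRD le_eqVlt; apply/orP; left; apply/eqP; ring.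
Qed.

Lemma evolution_semigroup_rescale U h (f : R -> X) :
  evolution_semigroup (rescale U) h f = (fun t => cexp z h *: evolution_semigroup U h f t).
Proof.
apply/funext => t; rewrite /evolution_semigroup; case: ifP => _; last by rewrite scaler0.
by rewrite rescaleE subKr.
Qed.

End Rescaling.

Section Resolvent.
Context (R : realType) (X : completeNormedModType R[i]) (E : function_space X) (W : set (R -> X)).
Hypothesis wb : well_behaved E W.
Variables (U : R -> R -> {linear X -> X}) (M omega : R).
Hypotheses (Uev : evolution_family U) (M1 : 1 <= M) (UM : growth_bound U M omega).

Let cexp_cvg1 (z : R[i]) : complex.Re `|cexp z h| @[h --> 0^'+] --> (1 : R).
Proof.
rewrite [X in X @ _ --> _](_ : _ = fun h => 1 * expR (complex.Re z * h)); last first.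
  by apply/funext => h; rewrite Re_norm_cexp mul1r.
have H : 1 * expR (complex.Re z * h) @[h --> 0^'+] --> 1 * expR (complex.Re z * 0).
  by apply: cvg_at_right_filter; exact: continuous_mexp.
by rewrite mulr0 expR0 mulr1 in H.
Qed.

Let cexp_cvg0 (z : R[i]) : complex.Re `|cexp z h - 1| @[h --> 0^'+] --> (0 : R).
Proof.
by rewrite -(cexp0 z); apply: cvg_at_right_filter; exact: cexp_continuous.
Qed.

(** The converse undoes the rescaling with the factor [cexp (- z) h]. *)
Lemma generator_rescaleP (z : R[i]) f g :
  generator E (evolution_semigroup U) f g <->
  generator E (evolution_semigroup (rescale z U)) f (fun t => g t + z *: f t).
Proof.
have Uzev := rescale_evolution_family z Uev.
have UzM := rescale_growth_bound z UM.
split=> H.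
  have := generator_rescale wb (W_evolution_semigroup wb Uev M1 UM) (evolution_semigroup_rescale z U)
    (cexp_cvg1 z) (cexp_cvg0 z) (l := - z) (cexp_quotient z) H.
  by under [X in generator _ _ _ X]eq_fun do rewrite scaleNr opprK.
have SE h f' : evolution_semigroup U h f' =
    (fun t => cexp (- z) h *: evolution_semigroup (rescale z U) h f' t).
  rewrite evolution_semigroup_rescale; apply/funext => t.
  by rewrite scalerA cexpNK scale1r.
have q : complex.Re `|(h^-1)%:C * (cexp (- z) h - 1) + z| @[h --> 0^'+] --> (0 : R).
  by have := cexp_quotient (- z); under eq_fun do rewrite opprK.
have := generator_rescale wb (W_evolution_semigroup wb Uzev M1 UzM) SE
    (cexp_cvg1 (- z)) (cexp_cvg0 (- z)) q H.
by under [X in generator _ _ _ X]eq_fun do rewrite addrK.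
Qed.

(** The family rescaled by [- l] is stable with generator [Gamma - l], whose inverse is minus its
    Green operator; hence [l - Gamma] is inverted by the Green operator itself. *)
Lemma stable_resolvent (l : R[i]) : omega < complex.Re l ->
  resolvent_set E (evolution_generator E U) l.
Proof.
move=> wl; pose Ul := rescale (- l) U.
have Ulev : evolution_family Ul by exact: rescale_evolution_family.
have UlM : growth_bound Ul M (omega - complex.Re l).
  have -> : - complex.Re l = complex.Re (- l) by case: (l).
  exact: rescale_growth_bound.
have wl0 : omega - complex.Re l < 0 by rewrite subr_lt0.
have [C HC] := wb_green wb Ulev M1 wl0 UlM.
exists (green Ul); split.
- move=> g cg; rewrite /scalar_sub; apply/(generator_rescaleP (- l)).
  have := generatorN wb (@evolution_semigroupN _ _ _) (generator_green wb Ulev M1 wl0 UlM cg).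
  rewrite (_ : (fun t => - - green Ul g t) = green Ul g); last by apply/funext => t; rewrite opprK.
  by congr (generator _ _ _ _); apply/funext => t; rewrite scaleNr addrAC subrr add0r.
- move=> f g; rewrite /scalar_sub => /(generator_rescaleP (- l)) H.
  have {}H : generator E (evolution_semigroup Ul) f (fun t => - g t).
    by move: H; congr (generator _ _ _ _); apply/funext => t; rewrite scaleNr addrAC subrr add0r.
  have := generator_green_unique wb Ulev M1 wl0 UlM (generatorN wb (@evolution_semigroupN _ _ _) H).
  rewrite /feq -(fnormN wb) => <-; congr (fnorm _ _); apply/funext => t /=.
  rewrite (_ : (fun t => - - g t) = g); last by apply/funext => s; rewrite opprK.
  by rewrite !opprD !opprK.
- by exists C => g /HC[].
Qed.

Lemma spectral_bound_le : (spectral_bound E (evolution_generator E U) <= omega%:E)%E.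
Proof.
apply: ge_ereal_sup => _ [l + <-]; rewrite lee_fin leNgt => lspec.
by apply/negP => wl; apply: lspec; exact: stable_resolvent.
Qed.

End Resolvent.

(** * From solvability to stability *)

Section Ramp.
Context (R : realType).
Implicit Types (t u h a N : R).

Definition ramp t : R := if t <= 0 then 0 else if t <= 1 then t else 1.

(** The primitive of [ramp] that vanishes on the negatives, in closed form, so that case analysis
    replaces integration. *)
Definition ramp_integral t : R := if t <= 0 then 0 else if t <= 1 then t ^+ 2 / 2 else t - 2^-1.

Lemma ramp_lipschitz t u : u <= t -> 0 <= ramp t - ramp u <= t - u.
Proof.
rewrite /ramp => ut; apply/andP.
by case: (leP t 0); case: (leP t 1); case: (leP u 0); case: (leP u 1) => *; split; lra.
Qed.

Lemma ramp_integral_lipschitz t u : u <= t -> 0 <= ramp_integral t - ramp_integral u <= t - u.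
Proof.
rewrite /ramp_integral => ut; apply/andP.
by case: (leP t 0); case: (leP t 1); case: (leP u 0); case: (leP u 1) => *; split; nra.
Qed.

(** First-order expansion with a uniform error, as [ramp] is 1-Lipschitz. *)
Lemma ramp_integral_quotient t h : 0 <= h ->
  `|ramp_integral t - ramp_integral (t - h) - h * ramp t| <= h ^+ 2.
Proof.
rewrite /ramp_integral /ramp ler_norml => h0; apply/andP.
by case: (leP t 0); case: (leP t 1); case: (leP (t - h) 0); case: (leP (t - h) 1) => *; split; nra.
Qed.

Lemma lipschitz1_continuous (p : R -> R) : (forall t u, u <= t -> 0 <= p t - p u <= t - u) ->
  continuous p.
Proof.
move=> pl t; apply/cvgrPdist_le => e e0; near=> u.
have tu : `|t - u| <= e by near: u; have := @nbhsx_ballx _ _ t _ e0; apply: filterS => w /ltW.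
apply: le_trans tu; have [ut|/ltW tu] := leP u t.
  by have /andP[p0 p1] := pl _ _ ut; rewrite !ger0_norm// subr_ge0.
by have /andP[p0 p1] := pl _ _ tu; rewrite distrC [leRHS]distrC !ger0_norm// subr_ge0.
Unshelve. all: by end_near. Qed.

(** For [N >= 1] it rises from 0 to 1 on [[a, a + 1]], stays at 1 until [a + N] and is back to 0 at
    [a + N + 1]. Its total integral is [N]. *)
Definition trapezoid a N t : R := ramp (t - a) - ramp (t - a - N).

Definition trapezoid_integral a N t : R := ramp_integral (t - a) - ramp_integral (t - a - N).

Lemma trapezoid_itv01 a N t : 0 <= N -> 0 <= trapezoid a N t <= 1.
Proof.
move=> N0; have H : t - a - N <= t - a by rewrite lerBlDr lerDl.
have /andP[H1 _] := ramp_lipschitz H; rewrite /trapezoid H1/=.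
rewrite /ramp; case: (leP (t - a) 0); case: (leP (t - a) 1); case: (leP (t - a - N) 0); case: (leP (t - a - N) 1) => *; lra.
Qed.

Lemma trapezoid_support a N t : 0 <= N -> (t <= a) || (a + N + 1 <= t) -> trapezoid a N t = 0.
Proof.
move=> N0 /orP[ta|ta]; rewrite /trapezoid /ramp.
  by rewrite !ifT ?subrr//; lra.
have -> : (t - a <= 0) = false by apply/negbTE; rewrite -ltNge; lra.
have -> : (t - a - N <= 0) = false by apply/negbTE; rewrite -ltNge; lra.
by case: (leP (t - a) 1); case: (leP (t - a - N) 1) => *; lra.
Qed.

Lemma trapezoid_integral_itv a N t : 0 <= N -> 0 <= trapezoid_integral a N t <= N.
Proof.
move=> N0; have H : t - a - N <= t - a by rewrite lerBlDr lerDl.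
by have := ramp_integral_lipschitz H; rewrite /trapezoid_integral opprB addrCA subrr addr0.
Qed.

Lemma trapezoid_integral_left a N t : 0 <= N -> t <= a -> trapezoid_integral a N t = 0.
Proof.
by move=> N0 ta; rewrite /trapezoid_integral /ramp_integral !ifT ?subrr//; lra.
Qed.

Lemma trapezoid_integral_right a N t : 0 <= N -> a + N + 1 <= t -> trapezoid_integral a N t = N.
Proof.
move=> N0 ta; rewrite /trapezoid_integral /ramp_integral.
have -> : (t - a <= 0) = false by apply/negbTE; rewrite -ltNge; lra.
have -> : (t - a - N <= 0) = false by apply/negbTE; rewrite -ltNge; lra.
by case: (leP (t - a) 1); case: (leP (t - a - N) 1) => *; nra.
Qed.

Lemma continuous_difference (p : R -> R) a N : continuous p ->
  continuous (fun t => p (t - a) - p (t - a - N)).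
Proof.
move=> cp t.
have H1 : u - a @[u --> t] --> t - a by apply: cvgB; [exact: cvg_id|exact: cvg_cst].
have H2 : u - a - N @[u --> t] --> t - a - N by apply: cvgB; [exact: H1|exact: cvg_cst].
exact: (cvgB (cvg_comp _ _ H1 (cp _)) (cvg_comp _ _ H2 (cp _))).
Qed.

Lemma trapezoid_continuous a N : continuous (trapezoid a N).
Proof. exact: continuous_difference (lipschitz1_continuous ramp_lipschitz). Qed.

Lemma trapezoid_integral_continuous a N : continuous (trapezoid_integral a N).
Proof. exact: continuous_difference (lipschitz1_continuous ramp_integral_lipschitz). Qed.

(** Each of the two ramps contributes an error [h]. *)
Lemma trapezoid_integral_quotient a N t h : 0 < h ->
  `|h^-1 * (trapezoid_integral a N t - trapezoid_integral a N (t - h)) - trapezoid a N t| <= 2 * h.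
Proof.
move=> h0; rewrite -(ler_pM2l h0) -{1}[h](gtr0_norm h0) -normrM.
rewrite mulrBr mulrA divff ?gt_eqF// mul1r /trapezoid_integral /trapezoid.
have := ramp_integral_quotient (t - a) (ltW h0).
have := ramp_integral_quotient (t - a - N) (ltW h0).
rewrite (_ : t - a - N - h = t - h - a - N); last by ring.
rewrite (_ : t - a - h = t - h - a); last by ring.
rewrite !ler_norml => /andP[A1 A2] /andP[B1 B2]; apply/andP; split; nra.
Qed.

End Ramp.

(** * Norm estimates along trajectories *)

Section Datko.
Context (R : realType) (X : completeNormedModType R[i]) (E : function_space X) (W : set (R -> X)).
Hypothesis wb : well_behaved E W.
Variables (U : R -> R -> {linear X -> X}) (M omega C : R).
Hypotheses (Uev : evolution_family U) (M1 : 1 <= M) (UM : growth_bound U M omega).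
Hypotheses (C0 : 0 <= C) (solvable : forall g, fcarrier E g ->
  exists2 f, generator E (evolution_semigroup U) f g & (fnorm E f <= C%:E * fnorm E g)%E).

Let M0 : 0 < M. Proof. exact: lt_le_trans M1. Qed.

Let cexp_real (l h : R) : cexp (- l%:C) h = (expR (- l * h))%:C.
Proof. by rewrite /cexp/= oppr0 mul0r cos0 sin0 mulr1 mulr0. Qed.

(** The weight intertwines the two semigroups: [e^{- l h} e^{- l (t - h)} = e^{- l t}]. *)
Lemma evolution_semigroup_weight (l h : R) f t : 0 <= h ->
  evolution_semigroup (rescale (- l%:C) U) h (fun s => (expR (- l * s))%:C *: f s) t =
  (expR (- l * t))%:C *: evolution_semigroup U h f t.
Proof.
move=> h0; rewrite evolution_semigroup_rescale cexp_real /evolution_semigroup h0/=.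
case: ifP => _; last by rewrite !scaler0.
rewrite linearZ/= scalerA -rmorphM/= -expRD; congr (_%:C *: _); congr expR; ring.
Qed.

Lemma le_fnorm_weight (l : R) f : 0 <= l -> (fnorm E (fun t => (expR (- l * t))%:C *: f t) <= fnorm E f)%E.
Proof.
move=> l0; apply: (wb_fnorm_mono wb) => t t0.
rewrite vnormZr ger0_norm ?expR_ge0// ler_piMl ?vnorm_ge0// -expR0 ler_expR.
by rewrite mulNr oppr_le0 mulr_ge0.
Qed.

(** The shift of the generator by [- l] is compensated by the derivative of the weight, so the
    equation keeps its form. *)
Lemma generator_weight (l : R) f g : 0 <= l -> generator E (evolution_semigroup U) f g ->
  generator E (evolution_semigroup (rescale (- l%:C) U))
    (fun t => (expR (- l * t))%:C *: f t) (fun t => (expR (- l * t))%:C *: g t).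
Proof.
move=> l0 [cf cg H]; split; [exact: (wb_carrier_weight wb)|exact: (wb_carrier_weight wb)|].
apply: cvg_fnorm_le H => [h|]; first exact: (wb_fnorm_ge0 wb).
near=> h; have h0 : 0 <= h by near: h; exact: nbhs_right_ge.
apply: le_trans (le_fnorm_weight _ l0).
rewrite le_eqVlt; apply/orP; left; apply/eqP; congr (fnorm _ _); apply/funext => t.
by rewrite evolution_semigroup_weight// !scalerBr !scalerA [(h^-1)%:C * _]mulrC.
Unshelve. all: by end_near. Qed.

Section Trajectory.
Variables (s : R) (x : X).
Hypothesis s0 : 0 <= s.

(* The trajectory from [s], frozen before [s]; it only matters there multiplied by [0]. *)
Let v (t : R) : X := U (Num.max t s) s x.

Let vE t : s <= t -> v t = U t s x.
Proof. by move=> st; rewrite /v; have /max_idPl -> := st. Qed.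

Lemma trajectory_continuous : {within `[0, +oo[, continuous v}.
Proof.
apply/within_continuous_vnormP => t _ e e0.
have smax (u : R) : 0 <= s <= Num.max u s by rewrite s0 le_max lexx orbT.
have [d d0 Hd] := @evolution_continuous _ _ _ Uev x _ _ _ (smax t) e0.
exists d => // u _ tu; apply: Hd; rewrite ?smax ?subrr ?normr0//.
apply: le_lt_trans tu; rewrite [leRHS]distrC.
have [ts|/ltW st] := leP t s; have [us|/ltW su] := leP u s; rewrite ?subrr ?normr0//.
  have ut : t <= u by exact: le_trans su.
  by rewrite !ger0_norm ?subr_ge0// lerB.
have ut : u <= t by exact: le_trans st.
by rewrite !ler0_norm ?subr_le0// !opprB lerB.
Qed.

Lemma trajectory_bound t L : 0 <= L -> t - s <= L -> vnorm (v t) <= M * expR (`|omega| * L) * vnorm x.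
Proof.
move=> L0 tL; apply: (growth_bound_itv M1 UM) => //; first by rewrite le_max lexx orbT.
by rewrite /Num.max; case: ifP; rewrite ?subrr.
Qed.

Let continuous_weight (phi : R -> R) : continuous phi ->
  {within `[0, +oo[, continuous (fun t => (phi t)%:C *: v t)}.
Proof. by move=> cphi; apply: within_continuousZr => //; exact: trajectory_continuous. Qed.

(** [w] may grow and need not belong to [E], so it is compared with the solution [f] only after
    weighting; [wb_weight0] then removes the weight from [f + w], which leaves the bound of [f] for
    [w]. *)
Lemma trapezoid_estimate a N : s <= a -> 0 <= N ->
  (fnorm E (fun t => (trapezoid_integral a N t)%:C *: v t)
    <= C%:E * fnorm E (fun t => (trapezoid a N t)%:C *: v t))%E.
Proof.
move=> sa N0; have a0 : 0 <= a by exact: le_trans sa.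
pose g t := (trapezoid a N t)%:C *: v t; pose w t := (trapezoid_integral a N t)%:C *: v t.
have cg : fcarrier E g.
  pose K := M * expR (`|omega| * (a + N + 1 - s)) * vnorm x.
  suff [] : fcarrier E g /\ (fnorm E g <= (K * (a + N + 1 - a))%:E)%E by [].
  apply: (wb_bump wb a0).
  - by lra.
  - by rewrite !mulr_ge0 ?expR_ge0 ?vnorm_ge0// ltW.
  - exact: continuous_weight (@trapezoid_continuous _ a N).
  - by move=> t _ ta; rewrite /g trapezoid_support// scale0r.
  move=> t /andP[ta tb]; rewrite /g vnormZr.
  have /andP[p0 p1] := trapezoid_itv01 a t N0.
  rewrite ger0_norm//; apply: (@le_trans _ _ (1 * vnorm (v t))); first by rewrite ler_wpM2r ?vnorm_ge0.
  by rewrite mul1r; apply: trajectory_bound; lra.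
have [f fg fC] := solvable cg.
(* [v] grows at most like [expR] of [|omega| t], so [weight w] decays like [expR (- t)]; moreover
   [omega - l < 0]. *)
pose l := `|omega| + 1; have l0 : 0 <= l by rewrite addr_ge0.
pose Ul := rescale (- l%:C) U.
have Ulev : evolution_family Ul by exact: rescale_evolution_family.
have UlM : growth_bound Ul M (omega - l).
  have -> : - l = complex.Re (- l%:C) by [].
  exact: rescale_growth_bound.
have wl : omega - l < 0 by rewrite /l; have := ler_norm omega; lra.
pose weight (u : R -> X) t := (expR (- l * t))%:C *: u t.
have Ww : W w by apply: (wb_continuous wb); exact: continuous_weight (@trapezoid_integral_continuous _ a N).
have cw : fcarrier E (weight w).
  apply: (@wb_decay _ _ _ _ wb _ (N * M * vnorm x) 1) => //.
  - by rewrite !mulr_ge0 ?vnorm_ge0// ltW.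
  - apply: within_continuousZr; last exact: continuous_weight (@trapezoid_integral_continuous _ a N).
    exact: continuous_expRM.
  - by rewrite /weight /w trapezoid_integral_left// scale0r scaler0.
  move=> t t0; rewrite /weight vnormZr ger0_norm ?expR_ge0//.
  have [ta|/ltW at_] := leP t a.
    rewrite /w trapezoid_integral_left// scale0r vnorm0 mulr0.
    by rewrite !mulr_ge0 ?vnorm_ge0 ?expR_ge0// ltW.
  rewrite /w vnormZr; have /andP[p0 p1] := trapezoid_integral_itv a t N0.
  rewrite ger0_norm//.
  have H : vnorm (v t) <= M * expR (`|omega| * t) * vnorm x.
    by apply: trajectory_bound => //; rewrite lerBlDr lerDl.
  apply: (@le_trans _ _ (expR (- l * t) * (N * (M * expR (`|omega| * t) * vnorm x)))).
    by rewrite ler_wpM2l ?expR_ge0// ler_pM ?vnorm_ge0.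
  have -> : - l * t = - 1 * t + - (`|omega| * t) by rewrite /l; ring.
  rewrite expRD expRN le_eqVlt; apply/orP; left; apply/eqP; field.
  by rewrite gt_eqF ?expR_gt0.
have WS := W_evolution_semigroup wb Ulev M1 UlM.
(* The semigroup carries [v] along itself, so its quotient only differentiates the scalar factor,
   whose derivative is the trapezoid. *)
have gw : generator E (evolution_semigroup Ul) (fun t => - weight w t) (weight g).
  split; [exact: (carrierN wb)|exact: (wb_carrier_weight wb)|].
  pose q h t := h^-1 * (trapezoid_integral a N t - trapezoid_integral a N (t - h)) - trapezoid a N t.
  have SW h t : 0 < h -> evolution_semigroup Ul h (weight w) t =
      (expR (- l * t))%:C *: ((trapezoid_integral a N (t - h))%:C *: v t).
    move=> h0; rewrite (evolution_semigroup_weight _ _ _ (ltW h0)); congr (_ *: _).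
    rewrite /evolution_semigroup (ltW h0)/= /w.
    have [sth|/ltW ths] := leP s (t - h); last first.
      rewrite trapezoid_integral_left ?(le_trans ths)// !scale0r linear0.
      by case: ifP.
    have th : t - h <= t by rewrite lerBlDr lerDl ltW.
    rewrite ifT; last by rewrite -subr_ge0 (le_trans s0).
    by rewrite linearZ/= !vE ?(le_trans sth)// -(evolution_cocycle Uev).
  have quot h t : 0 < h ->
      (h^-1)%:C *: (evolution_semigroup Ul h (fun t => - weight w t) t - - weight w t) - weight g t =
      (expR (- l * t))%:C *: ((q h t)%:C *: v t).
    move=> h0; rewrite evolution_semigroupN SW// opprK [- _ + weight w t]addrC /weight /g /w /q.
    rewrite !scalerA -scalerBl !scalerA -!scaleNr -scalerDl; congr (_ *: _).
    by rewrite -!rmorphM -!rmorphB/= -!rmorphM -!rmorphN -!rmorphD/=; congr (_%:C); ring.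
  (* For [h <= 1] the function [q h] is supported in [[a, a + N + 2]]: one unit more than the
     trapezoid, for the shift by [h]. *)
  pose K := M * expR (`|omega| * (a + N + 2 - s)) * vnorm x.
  have K0 : 0 <= K by rewrite !mulr_ge0 ?expR_ge0 ?vnorm_ge0// ltW.
  apply: (@cvg_fnorm_le _ _ (fun h => (h * (2 * K * (a + N + 2 - a)))%:E)) => [h||].
  - exact: (wb_fnorm_ge0 wb).
  - near=> h; have h0 : 0 < h by near: h; exact: nbhs_right_gt.
    have h1 : h <= 1 by near: h; exact: nbhs_right_le.
    rewrite (_ : (fun tau => _) = weight (fun t => (q h t)%:C *: v t)); last first.
      by apply/funext => t; exact: quot.
    apply: (le_trans (le_fnorm_weight _ l0)).
    have -> : h * (2 * K * (a + N + 2 - a)) = 2 * h * K * (a + N + 2 - a) by ring.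
    suff [] : fcarrier E (fun t => (q h t)%:C *: v t) /\
        (fnorm E (fun t => ((q h t)%:C *: v t)%R) <= (2 * h * K * (a + N + 2 - a))%:E)%E by [].
    apply: (wb_bump wb a0).
    + by lra.
    + by rewrite mulr_ge0// mulr_ge0// ltW.
    + apply: continuous_weight => t.
      have cP := @trapezoid_integral_continuous _ a N.
      have th : u - h @[u --> t] --> t - h by apply: cvgB; [exact: cvg_id|exact: cvg_cst].
      apply: cvgB; last exact: trapezoid_continuous.
      apply: cvgM; first exact: cvg_cst.
      exact: (cvgB (cP t) (cvg_comp _ _ th (cP _))).
    + move=> t _ ta; rewrite /q [X in _ * X - _](_ : _ = 0).
        by rewrite mulr0 sub0r trapezoid_support ?oppr0 ?scale0r//; apply/orP; move/orP: ta => [?|?]; [left|right]; lra.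
      case/orP: ta => ta; first by rewrite !trapezoid_integral_left ?subrr//; lra.
      by rewrite !trapezoid_integral_right ?subrr//; lra.
    move=> t /andP[_ tb]; rewrite vnormZr; apply: ler_pM; rewrite ?vnorm_ge0//.
      exact: trapezoid_integral_quotient.
    by apply: trajectory_bound; lra.
  - apply/cvg_EFin; first exact: nearW.
    rewrite /comp/= -[X in _ --> X](mul0r (2 * K * (a + N + 2 - a))); apply: cvgM; last exact: cvg_cst.
    by apply: cvg_at_right_filter; exact: cvg_id.
have gf : generator E (evolution_semigroup Ul) (weight f) (weight g) by exact: generator_weight.
have [cf _ _] := fg.
have Wf := carrier_W wb cf.
have sum0 : fnorm E (fun t => f t + w t) = 0%E.
  apply: (wb_weight0 wb (l := l)); first exact: (wb_D wb Wf Ww).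
  have := generatorD wb WS (@evolution_semigroupDf _ _ Ul) gf (generatorN wb (@evolution_semigroupN _ _ _) gw).
  rewrite (_ : (fun t => weight g t + - weight g t) = fun=> 0); last by apply/funext => t; rewrite subrr.
  move=> /(generator_kernel_trivial wb Ulev M1 wl UlM) <-.
  by congr (fnorm _ _); apply/funext => t; rewrite opprK /weight scalerDr.
apply: le_trans fC.
rewrite (_ : (fun t => _) = (fun t => (f t + w t) - f t)); last first.
  by apply/funext => t; rewrite addrAC subrr add0r.
apply: (le_trans (fnormB wb _ Wf)); first exact: (wb_D wb).
by rewrite sum0 add0e.
Unshelve. all: by end_near. Qed.

(** The first trapezoid lives on [[s, s + 2]] and its primitive is 1 from [s + 2] on. The second
    lives on [[s + 2, s + N + 3]] and its primitive is [N] from [s + N + 3] on, which is exploited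
    on the unit interval that follows. *)
Lemma trajectory_decay N : 0 <= N ->
  N * vnorm (U (s + N + 4) s x) <=
  C * (C * (M * expR (`|omega| * 2) * vnorm x * 2)) * (M * expR `|omega|).
Proof.
move=> N0; pose K := M * expR (`|omega| * 2) * vnorm x.
have K0 : 0 <= K by rewrite !mulr_ge0 ?expR_ge0 ?vnorm_ge0// ltW.
have E1 : (fnorm E (fun t => ((trapezoid s 1 t)%:C *: v t)%R) <= (K * 2)%:E)%E.
  have -> : K * 2 = K * (s + 2 - s) by ring.
  suff [] : fcarrier E (fun t => (trapezoid s 1 t)%:C *: v t) /\
      (fnorm E (fun t => ((trapezoid s 1 t)%:C *: v t)%R) <= (K * (s + 2 - s))%:E)%E by [].
  apply: (wb_bump wb s0) => //.
  - by lra.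
  - exact: continuous_weight (@trapezoid_continuous _ s 1).
  - move=> t _ ts; rewrite trapezoid_support ?scale0r//.
    by rewrite -addrA.
  move=> t /andP[_ t2]; rewrite vnormZr; have /andP[p0 p1] := trapezoid_itv01 s t (@ler01 R).
  rewrite ger0_norm//; apply: (@le_trans _ _ (1 * vnorm (v t))); first by rewrite ler_wpM2r ?vnorm_ge0.
  by rewrite mul1r; apply: trajectory_bound; lra.
have s2 : s <= s + 2 by rewrite lerDl.
(* The decisive bound independent of [N]: the second trapezoid is at most 1 and supported where the
   first primitive equals 1. *)
have E2 : (fnorm E (fun t => ((trapezoid (s + 2) N t)%:C *: v t)%R) <= (C * (K * 2))%:E)%E.
  apply: (@le_trans _ _ (fnorm E (fun t => ((trapezoid_integral s 1 t)%:C *: v t)%R))).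
    apply: (wb_fnorm_mono wb) => t _; rewrite !vnormZr ler_wpM2r ?vnorm_ge0//.
    have /andP[p0 p1] := trapezoid_itv01 (s + 2) t N0.
    have [ts|st] := leP t (s + 2); first by rewrite trapezoid_support ?ts// normr0.
    rewrite trapezoid_integral_right//; last by lra.
    by rewrite normr1 ger0_norm.
  apply: (le_trans (trapezoid_estimate (lexx s) ler01)).
  by rewrite EFinM lee_wpmul2l.
have E3 : (fnorm E (fun t => ((trapezoid_integral (s + 2) N t)%:C *: v t)%R) <= (C * (C * (K * 2)))%:E)%E.
  by apply: (le_trans (trapezoid_estimate s2 N0)); rewrite EFinM lee_wpmul2l.
have Mw : 0 < M * expR `|omega| by rewrite mulr_gt0 ?expR_gt0.
rewrite -ler_pdivrMr// -lee_fin; apply: le_trans E3.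
(* For [t] in this unit interval [U (s + N + 4) s x] is the image of [v t] under an operator of norm
   at most [M * expR] of [|omega|]. *)
apply: (wb_lower wb (a := s + N + 3)).
- by rewrite !addr_ge0.
- by rewrite divr_ge0 ?mulr_ge0 ?vnorm_ge0// ltW.
move=> t /andP[ta tb].
have st : s <= t by lra.
rewrite vnormZr trapezoid_integral_right//; last by lra.
rewrite (ger0_norm N0) -mulrA ler_wpM2l// ler_pdivrMr// vE//.
have t4 : t <= s + N + 4 by lra.
have t0 : 0 <= t by exact: le_trans st.
rewrite (evolution_cocycle Uev x s0 st t4) [leRHS]mulrC -[`|omega|]mulr1.
by apply: (growth_bound_itv M1 UM) => //; lra.
Qed.

End Trajectory.

Lemma halving_stable (L : R) : 0 < L ->
  (forall s x, 0 <= s -> vnorm (U (s + L) s x) <= 2^-1 * vnorm x) -> exponentially_stable U.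
Proof.
move=> L0 half; pose K := M * expR (`|omega| * L).
have K1 : 1 <= K.
  by rewrite -[1]mulr1 ler_pM// -expR0 ler_expR mulr_ge0// ltW.
(* [K] pays for the last incomplete step of length at most [L], and 2 for rounding [(t - s) / L]
   down to an integer. *)
exists (K * 2), (- (ln 2 / L)); split.
- by clearbody K; lra.
- by rewrite oppr_lt0 divr_gt0// ln_gt0// ltr1n.
move=> t s /andP[s0 st] x.
have iter n y r : 0 <= r -> vnorm (U (r + n%:R * L) r y) <= 2^-1 ^+ n * vnorm y.
  move=> r0; elim: n => [|n IHn]; first by rewrite mul0r addr0 expr0 mul1r (evolution_id Uev).
  have rn : r <= r + n%:R * L by rewrite lerDl mulr_ge0// ltW.
  have rn1 : r + n%:R * L <= r + n.+1%:R * L by rewrite lerD2l ler_wpM2r ?(ltW L0)// ler_nat.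
  rewrite (evolution_cocycle Uev y r0 rn rn1) -natr1 mulrDl mul1r addrA exprS -mulrA.
  by apply: (le_trans (half _ _ _)); [exact: le_trans rn|rewrite ler_wpM2l// invr_ge0].
pose n := Num.truncn ((t - s) / L).
have q0 : 0 <= (t - s) / L by rewrite divr_ge0 ?subr_ge0// ltW.
have /andP[n1 n2] : n%:R <= (t - s) / L < n.+1%:R by exact: truncn_itv.
have ns : s <= s + n%:R * L by rewrite lerDl mulr_ge0// ltW.
have nt : s + n%:R * L <= t by rewrite addrC -lerBrDr -ler_pdivlMr.
rewrite (evolution_cocycle Uev x s0 ns nt).
have tn : t - (s + n%:R * L) <= L.
  move: n2; rewrite ltr_pdivrMr// -natr1 mulrDl mul1r => /ltW; lra.
apply: (le_trans (growth_bound_itv M1 UM _ (le_trans s0 ns) nt tn)).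
apply: (@le_trans _ _ (K * (2^-1 ^+ n * vnorm x))).
  by rewrite ler_wpM2l ?(le_trans ler01)// iter.
rewrite mulrA ler_wpM2r ?vnorm_ge0// -mulrA ler_wpM2l ?(le_trans ler01)//.
have -> : 2^-1 ^+ n = expR (- (ln 2 * n%:R)) :> R.
  by rewrite expRN mulrC expRM_natl lnK ?posrE// exprVn.
have -> : (2 : R) = expR (ln 2) by rewrite lnK// posrE.
rewrite -expRD ler_expR.
have l2 : 0 < ln 2 :> R by rewrite ln_gt0// ltr1n.
have -> : ln (expR (ln 2)) = ln 2 :> R by rewrite expRK.
have : ln 2 * ((t - s) / L) <= ln 2 * n.+1%:R by rewrite ler_wpM2l ?(ltW l2)// ltW.
rewrite -[n.+1%:R]natr1 mulrDr mulr1.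
have -> : - (ln 2 / L) * (t - s) = - (ln 2 * ((t - s) / L)) by ring.
lra.
Qed.

Lemma solvable_stable : exponentially_stable U.
Proof.
pose K := C * (C * (M * expR (`|omega| * 2) * 2)) * (M * expR `|omega|).
have K0 : 0 <= K by rewrite !mulr_ge0 ?expR_ge0// ltW.
(* Makes [K <= N / 2] and keeps [N] positive even if [K = 0]. *)
pose N := 2 * K + 1; have N0 : 0 < N by rewrite ltr_wpDl// mulr_ge0.
apply: (@halving_stable (N + 4)); first by rewrite addr_gt0.
move=> s x s0; rewrite -(ler_pM2l N0) addrA.
apply: (le_trans (trajectory_decay x s0 (ltW N0))).
apply: (@le_trans _ _ (K * vnorm x)); first by rewrite le_eqVlt; apply/orP; left; apply/eqP; rewrite /K; ring.
by rewrite mulrA ler_wpM2r ?vnorm_ge0// /N; lra.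
Qed.

End Datko.

(** * The equivalence in a well-behaved space *)

Section Characterization.
Context (R : realType) (X : completeNormedModType R[i]) (E : function_space X) (W : set (R -> X)).
Hypothesis wb : well_behaved E W.
Variables (U : R -> R -> {linear X -> X}).
Hypotheses (Uev : evolution_family U) (Ubd : exponentially_bounded U).

Lemma spectral_bound_lt0_stable :
  (spectral_bound E (evolution_generator E U) < 0)%E -> exponentially_stable U.
Proof.
move=> sb; have [M [omega [M1 UM]]] := Ubd.
have [B [BP _ [C BC]]] : resolvent_set E (evolution_generator E U) 0.
  apply: contrapT => n0; move: sb; rewrite ltNge => /negP; apply.
  by apply: ereal_sup_ubound; exists 0.
apply: (@solvable_stable _ _ _ _ wb U M omega `|C|) => // g cg.
(* For [lambda = 0] the graph [scalar_sub] relates [f] to [g] when Gamma maps [f] to [- g], so Gamma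
   [f = g] is solved by [B] applied to [- g]. *)
have cNg := carrierN wb cg.
exists (B (fun t => - g t)).
  have := BP _ cNg; congr (generator _ _ _ _); apply/funext => t.
  by rewrite scale0r sub0r opprK.
apply: (le_trans (BC _ cNg)); rewrite (fnormN wb) lee_wpmul2r ?lee_fin ?ler_norm//.
exact: (wb_fnorm_ge0 wb).
Qed.

Lemma stable_spectral_bound_lt0 :
  exponentially_stable U -> (spectral_bound E (evolution_generator E U) < 0)%E.
Proof.
move=> [M [omega [M1 w0 UM]]].
by apply: (le_lt_trans (spectral_bound_le wb Uev M1 UM)); rewrite lte_fin.
Qed.

Lemma invertible_stable :
  bounded_inverse E (evolution_generator E U) (fun f t => - green U f t) -> exponentially_stable U.
Proof.
move=> [BP _ [C BC]]; have [M [omega [M1 UM]]] := Ubd.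
apply: (@solvable_stable _ _ _ _ wb U M omega `|C|) => // g cg.
exists (fun t => - green U g t); first exact: BP.
apply: (le_trans (BC _ cg)); rewrite lee_wpmul2r ?lee_fin ?ler_norm//.
exact: (wb_fnorm_ge0 wb).
Qed.

Lemma stability_characterization :
  [<-> exponentially_stable U;
       bounded_inverse E (evolution_generator E U) (fun f t => - green U f t);
       (spectral_bound E (evolution_generator E U) < 0)%E].
Proof.
tfae.
- move=> [M [omega [M1 w0 UM]]]; exact: (stable_bounded_inverse wb Uev M1 w0 UM).
(* Invertibility at 0 alone does not locate the rest of the spectrum; the implication passes through
   stability. *)
- by move=> /invertible_stable; exact: stable_spectral_bound_lt0.
- exact: spectral_bound_lt0_stable.
Qed.

End Characterization.

Unset Implicit Arguments.
Set Strict Implicit.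
Set Printing Implicit Defensive.

Theorem corollary3p6 (R : realType) (X : completeNormedModType R[i])
    (U : R -> R -> {linear X -> X})
    (U_evol : evolution_family U) (U_bounded : exponentially_bounded U)
    (E : function_space X)
    (E_Lp_or_C00 : (exists p : R, 1 <= p /\ E = Lp_space X p)
                   \/ E = C00_space X) :
  [<-> exponentially_stable U;
       bounded_inverse E (evolution_generator E U) (fun f t => - green U f t);
       (spectral_bound E (evolution_generator E U) < 0)%E].
Proof.
case: E_Lp_or_C00 => [[p [p1 ->]]|->].
- exact: (stability_characterization (Lp_well_behaved X p1) U_evol U_bounded).
- exact: (stability_characterization (C00_well_behaved X) U_evol U_bounded).
Qed.
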